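(* There exist universal constants $c,C>0$ such that for every integer $n\ge 2$, if $M\in\mathbb{R}^{n\times n}$ is a random matrix with i.i.d. $\mathcal{N}(0,1)$ entries, then $$\frac{c}{n}\;\le\;\sigma(v(M))\;\le\;\frac{C}{n},$$ i.e. $\sigma(v(M))=\Theta(1/n)$.
   Context: For $d\ge 1$, $\Delta_d=\{\boldsymbol{x}\in\mathbb{R}^d: x_i\ge 0\ \forall i,\ \sum_i x_i=1\}$. For a real matrix $M\in\mathbb{R}^{n\times m}$, $v(M)=\min_{\boldsymbol{x}\in\Delta_n}\max_{\boldsymbol{y}\in\Delta_m}\boldsymbol{x}^TM\boldsymbol{y}$ is the value of the two-player zero-sum game defined by $M$. For a real random variable $X$, $\sigma(X)=\sqrt{\mathrm{Var}(X)}$ is its standard deviation. *)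

(* Defs.v *)
From HB Require Import structures.
From mathcomp Require Import all_boot all_order all_algebra.
From mathcomp Require Import all_classical all_reals all_analysis.

Set Implicit Arguments.
Unset Strict Implicit.
Unset Printing Implicit Defensive.

Import Order.TTheory GRing.Theory Num.Theory.
Import numFieldNormedType.Exports.

Local Open Scope classical_set_scope.
Local Open Scope ring_scope.

Definition simplex (R : realType) (d : nat) : set 'cV[R]_d :=
  [set x | (forall i, 0 <= x i 0) /\ \sum_i x i 0 = 1].
Arguments simplex {R} d.

Definition payoff (R : realType) (n m : nat) (M : 'M[R]_(n, m))
  (x : 'cV[R]_n) (y : 'cV[R]_m) : R := (x^T *m M *m y) 0 0.

(* The real-valued [sup] and [inf] below are attained as soon as the dimensions
   are positive: see [best_reply_max] and [game_value_minmax]. *)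
Definition best_reply (R : realType) (n m : nat) (M : 'M[R]_(n, m))
  (x : 'cV[R]_n) : R := sup [set payoff M x y | y in simplex m].

Definition game_value (R : realType) (n m : nat) (M : 'M[R]_(n, m)) : R :=
  inf [set best_reply M x | x in simplex n].

Section minmax_attained.
Context (R : realType) (n m : nat).
Implicit Types (M : 'M[R]_(n, m)) (x : 'cV[R]_n) (y : 'cV[R]_m).

Let delta_colE (d : nat) (i k : 'I_d) :
  (delta_mx i 0 : 'cV[R]_d) k 0 = (k == i)%:R.
Proof. by rewrite mxE eqxx andbT. Qed.

Lemma simplex_delta (d : nat) (i : 'I_d) :
  simplex d (delta_mx i 0 : 'cV[R]_d).
Proof.
split=> [k|]; first by rewrite delta_colE ler0n.
rewrite (bigD1 i) //= delta_colE eqxx big1 ?addr0 // => k /negPf ki.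
by rewrite delta_colE ki.
Qed.

Lemma payoffE M x y : payoff M x y = \sum_j (x^T *m M) 0 j * y j 0.
Proof. by rewrite /payoff mxE. Qed.

Lemma payoff_delta M x j : payoff M x (delta_mx j 0) = (x^T *m M) 0 j.
Proof.
rewrite payoffE (bigD1 j) //= delta_colE eqxx mulr1 big1 ?addr0 // => k.
by move=> /negPf kj; rewrite delta_colE kj mulr0.
Qed.

Lemma payoff_le M x (b : R) y :
  (forall j, (x^T *m M) 0 j <= b) -> simplex m y -> payoff M x y <= b.
Proof.
move=> xMb [y0 y1]; rewrite payoffE -[leRHS]mulr1 -y1 mulr_sumr.
by apply: ler_sum => j _; exact: ler_wpM2r.
Qed.

Lemma best_reply_max M x : (0 < m)%N ->
  exists2 y, simplex m y & best_reply M x = payoff M x y /\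
    forall z, simplex m z -> payoff M x z <= payoff M x y.
Proof.
move=> m0; pose i := [arg max_(i > Ordinal m0) (x^T *m M) 0 i]%O.
have iP j : (x^T *m M) 0 j <= (x^T *m M) 0 i.
  by rewrite /i; case: arg_maxP => // k _; exact.
have ub z : simplex m z -> payoff M x z <= payoff M x (delta_mx i 0).
  by rewrite payoff_delta; exact: payoff_le.
exists (delta_mx i 0); first exact: simplex_delta.
split=> //; apply/eqP; rewrite eq_le; apply/andP; split.
  apply: ge_sup; last by move=> _ [z sz <-]; exact: ub.
  by exists (payoff M x (delta_mx i 0)), (delta_mx i 0); [exact: simplex_delta|].
apply: ub_le_sup.
  by exists (payoff M x (delta_mx i 0)) => _ [z sz <-]; exact: ub.
by exists (delta_mx i 0); [exact: simplex_delta|].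
Qed.

Lemma best_reply_bigmax M x (j0 : 'I_m) : best_reply M x =
  \big[Order.max/(x^T *m M) 0 j0]_(j < m) (x^T *m M) 0 j.
Proof.
have [y sy [-> ymax]] := best_reply_max M x (leq_ltn_trans (leq0n _) (ltn_ord j0)).
apply/eqP; rewrite eq_le; apply/andP; split.
  apply: payoff_le sy => j.
  exact: le_bigmax.
apply/bigmax_leP; split=> [|j _]; rewrite -payoff_delta; apply: ymax;
  exact: simplex_delta.
Qed.

Let continuous_sum (T : topologicalType) (s : seq 'I_n) (f : 'I_n -> T -> R) :
  (forall i, continuous (f i)) -> continuous (fun t => \sum_(i <- s) f i t).
Proof.
move=> cf; elim: s => [|i s IHs] t.
  under eq_fun do rewrite big_nil; exact: cvg_cst.
under eq_fun do rewrite big_cons.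
by apply: (@continuousD _ R^o); [exact: cf|exact: IHs].
Qed.

Let continuous_bigmax (T : topologicalType) (s : seq 'I_m) (f : 'I_m -> T -> R)
    (g : T -> R) : continuous g -> (forall i, continuous (f i)) ->
  continuous (fun t => \big[Order.max/g t]_(i <- s) f i t).
Proof.
move=> cg cf; elim: s => [|i s IHs] t.
  under eq_fun do rewrite big_nil; exact: cg.
under eq_fun do rewrite big_cons.
by apply: continuous_max; [exact: cf|exact: IHs].
Qed.

Lemma continuous_best_reply M : (0 < m)%N ->
  continuous (fun u : 'rV[R]_n => best_reply M u^T).
Proof.
move=> m0.
rewrite [X in continuous X](_ : _ = fun u : 'rV[R]_n =>
  \big[Order.max/(u *m M) 0 (Ordinal m0)]_(j < m) (u *m M) 0 j);
  last first.
  by apply/funext => u; rewrite (best_reply_bigmax _ _ (Ordinal m0)) trmxK.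
have cM j : continuous (fun u : 'rV[R]_n => (u *m M) 0 j).
  under eq_fun do rewrite mxE; apply: continuous_sum => k u.
  by apply: (@continuousM _ _ (fun u : 'rV[R]_n => u 0 k) (cst (M k j)));
    [exact: coord_continuous|exact: cst_continuous].
exact: continuous_bigmax.
Qed.

Lemma compact_simplex : compact [set u : 'rV[R]_n | simplex n u^T].
Proof.
have K : compact [set u : 'rV[R]_n | forall i, `[0, 1]%classic (u ord0 i)].
  by apply: (@rV_compact R n (fun=> `[0, 1]%classic)) => _; exact: segment_compact.
pose H i := [set u : 'rV[R]_n | 0 <= u 0 i].
rewrite (_ : mkset _ = (\bigcap_i H i) `&` [set u | \sum_i u 0 i = 1]).
  apply: subclosed_compact K _.
    apply: closedI.
      apply: closed_bigI => i _.
      apply: (@preimage_closed _ _ (fun u : 'rV[R]_n => u 0 i) [set x | 0 <= x]).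
        by move=> u _; exact: coord_continuous.
      exact: closed_ge.
    apply: (@preimage_closed _ _ (fun u : 'rV[R]_n => \sum_i u 0 i) [set x | x = 1]).
      by move=> u _; apply: continuous_sum => i; exact: coord_continuous.
    exact: closed_eq.
  move=> u [u0 u1] i /=; have u0' j : 0 <= u 0 j by exact: u0.
  rewrite in_itv /= u0' /= -u1 (bigD1 i) //= lerDl.
  by apply: sumr_ge0.
apply/seteqP; split=> u /=; rewrite /simplex /=.
  by move=> [u0 u1]; split=> [i _|]; [have := u0 i; rewrite mxE|
    rewrite -u1; apply: eq_bigr => i _; rewrite mxE].
move=> [u0 u1]; split=> [i|]; first by rewrite mxE; exact: u0.
by rewrite -u1; apply: eq_bigr => i _; rewrite mxE.
Qed.

Lemma game_value_minmax M : (0 < n)%N -> (0 < m)%N ->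
  exists2 x, simplex n x & game_value M = best_reply M x /\
    forall z, simplex n z -> best_reply M x <= best_reply M z.
Proof.
move=> n0 m0.
have sn0 : [set u : 'rV[R]_n | simplex n u^T] !=set0.
  exists (delta_mx (Ordinal n0) 0)^T; rewrite /= trmxK; exact: simplex_delta.
have [u] := EVT_min_rV sn0 compact_simplex
  (continuous_subspaceT (@continuous_best_reply M m0)).
rewrite inE => su umin.
have lb z : simplex n z -> best_reply M u^T <= best_reply M z.
  by move=> sz; have := umin z^T; rewrite inE /= trmxK; exact.
exists u^T => //; split=> //; apply/eqP; rewrite eq_le; apply/andP; split.
  by apply: ge_inf; [exists (best_reply M u^T) => _ [z sz <-]; exact: lb|exists u^T].
by apply: lb_le_inf; [exists (best_reply M u^T), u^T|move=> _ [z sz <-]; exact: lb].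
Qed.

End minmax_attained.

Section random_matrix.
Context (d : measure_display) (T : measurableType d) (R : realType)
  (P : probability T R).

Definition std_dev (X : T -> R) : \bar R := sqrte 'V_P[X].

Definition mutually_independent (I : finType) (X : I -> {RV P >-> R}) : Prop :=
  forall (J : {set I}) (B : I -> set R), (forall i, measurable (B i)) ->
    P (\bigcap_(i in [set` J]) (X i @^-1` B i)) =
    (\prod_(i in J) P (X i @^-1` B i))%E.

Definition has_normal_law (X : {RV P >-> R}) (mean sd : R) : Prop :=
  forall B : set R, measurable B ->
    distribution P X B = normal_prob mean sd B.

Definition iid_normal_entries (n m : nat) (M : 'M[{RV P >-> R}]_(n, m))
    (mean sd : R) : Prop :=
  mutually_independent (fun ij : 'I_n * 'I_m => M ij.1 ij.2) /\
  forall i j, has_normal_law (M i j) mean sd.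

Definition realization (n m : nat) (M : 'M[{RV P >-> R}]_(n, m)) (w : T) :
  'M[R]_(n, m) := \matrix_(i, j) M i j w.

End random_matrix.

(* Main.v *)
Require Import Defs.
From HB Require Import structures.
From mathcomp Require Import all_boot all_order all_algebra.
From mathcomp Require Import all_classical all_reals all_analysis.
From mathcomp Require Import measurable_realfun.
From mathcomp Require Import ring lra.

Set Implicit Arguments.
Unset Strict Implicit.
Unset Printing Implicit Defensive.

Import Order.TTheory GRing.Theory Num.Theory.
Import numFieldNormedType.Exports.

Local Open Scope classical_set_scope.
Local Open Scope ring_scope.

(** Let A be the Gaussian matrix and v its value.

    Lower bound. Lowering all entries by 1/n lowers the value by 1/n
    ([game_value_shift]). The law of the lowered matrix has a density u^2 with
    respect to the law of A, and the mean of u is exp(-1/8), so the two laws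
    are not nearly singular. Hence v cannot stay within o(1/n) of a constant:
    a pointwise quadratic inequality ([shift_ineq]), integrated, bounds the
    mean of (v - m)^2 below for all m ([game_value_variance_ge]).

    Upper bound. Let w be the value of the game with payoff
    x^T A y + (e/2)|x|^2 - (e/2)|y|^2, where e = 1/n; it is within 2/n of v, so
    it suffices to show E w^2 = O(1/n^2). This game has a unique saddle point
    (x, y), which is a Lipschitz function of A ([saddle_stable]); hence w is
    differentiable, with partial derivatives x_i y_j ([reg_value_diff]). The
    Efron-Stein inequality ([dvar_powm]) and the Poincare inequality on the
    line ([gauss_poincare]) bound the variance of w by a multiple of the mean
    of the energy |x|^2 |y|^2. As - A^T has the same law as A and value - w,
    this gives E w^2 <= 2 E |x|^2 |y|^2 ([reg_w_energy]).

    The energy is in turn controlled by w. A strategy y for which all entries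
    of B y are at most W is spread over many coordinates: with overwhelming
    probability on the Gaussian matrix B, every such y satisfies
    |y|^2 <= K (W^2 + 1/n) ([norm_bound]). To see this, write a multiple of y
    as an integer vector z plus a remainder in [0, 1]^n. For a fixed z the
    positive parts of the entries of B z have a sum of order n |z|, up to a
    probability exponentially small in n, and this survives a weighted union
    bound over all z ([net_exp_mean]); the contribution of the remainder is at
    most of order n^(3/2) ([cut_exp_mean]). Let V = x^T A y. Apply this to both
    players, with W = max(-V, 0) + e and W = max(V, 0) + e: one of the two
    bounds is O(1/n), whence
    |x|^2 |y|^2 <= (K/n) (w^2 + 1/n) + (an exponentially small mean)
    ([energy_pointwise]). So m = E w^2 satisfies m <= (K/n) m + K/n^2, which
    improves itself to m = O(1/n^2) ([second_moment_le]).

    The exceptional events enter only through nonnegative functions that are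
    at least 1 on them, so that all integrals are integrals of nonnegative
    functions. *)

(** * Double variance and the Efron-Stein inequality *)

Section product_probability.
Context (R : realType) d1 d2 (S1 : measurableType d1) (S2 : measurableType d2).
Variables (m1 : probability S1 R) (m2 : probability S2 R).
Local Open Scope ereal_scope.

Definition prod_prob : set (S1 * S2) -> \bar R := m1 \x m2.

HB.instance Definition _ := Measure.on prod_prob.

Let prod_probT : prod_prob setT = 1.
Proof.
rewrite /prod_prob -setXTT product_measure1E//.
by rewrite [X in X * _]probability_setT [X in _ * X]probability_setT mule1.
Qed.

HB.instance Definition _ := Measure_isProbability.Build _ _ _ prod_prob prod_probT.

Lemma integral_prod_prob (F : S1 * S2 -> \bar R) :
  measurable_fun [set: S1 * S2] F -> (forall z, 0 <= F z) ->
  \int[prod_prob]_z F z = \int[m1]_x \int[m2]_y F (x, y).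
Proof. exact: fubini_tonelli1. Qed.

Lemma measurable_integral_snd (F : S1 * S2 -> \bar R) :
  measurable_fun [set: S1 * S2] F -> (forall z, 0 <= F z) ->
  measurable_fun [set: S1] (fun x => \int[m2]_y F (x, y)).
Proof. exact: measurable_fun_fubini_tonelli_F. Qed.

Lemma integral_swap (F : S1 * S2 -> \bar R) :
  measurable_fun [set: S1 * S2] F -> (forall z, 0 <= F z) ->
  \int[m1]_x \int[m2]_y F (x, y) = \int[m2]_y \int[m1]_x F (x, y).
Proof. exact: fubini_tonelli. Qed.
End product_probability.

Section double_variance.
Context (R : realType).
Local Open Scope ereal_scope.

(** For square integrable f this is twice the variance; as an integral of a
    nonnegative function it makes sense for all measurable f. *)
Definition dvar d (S : measurableType d) (mu : probability S R) (f : S -> R) :=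
  \int[mu]_x \int[mu]_y (((f x - f y) ^+ 2)%R)%:E.

Context d1 d2 (S1 : measurableType d1) (S2 : measurableType d2).
Variables (m1 : probability S1 R) (m2 : probability S2 R).

Lemma integral_prob_cst d (S : measurableType d) (mu : probability S R) (c : \bar R) :
  \int[mu]_x c = c.
Proof. by rewrite integral_cst//= [X in _ * X]probability_setT mule1. Qed.

Lemma lee_double (u v : \bar R) : u + u <= v + v -> u <= v.
Proof.
case: u => [u| |]; case: v => [v| |] //=; rewrite ?leey ?leNye//.
by rewrite -!EFinD !lee_fin; lra.
Qed.

Lemma measurable_sq_diff d (S : measurableType d) (f g : S -> R) :
  measurable_fun [set: S] f -> measurable_fun [set: S] g ->
  measurable_fun [set: S] (fun x => (((f x - g x) ^+ 2)%R)%:E).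
Proof.
move=> mf mg; apply/measurable_EFinP; apply: measurable_funX.
exact: measurable_funB.
Qed.

Lemma sq_ge0E (x : R) : 0 <= (x ^+ 2)%:E.
Proof. by rewrite lee_fin sqr_ge0. Qed.

(** The difference of the two sides is (a - b - c + e)^2. If a, b, c, e are the
    values of a function at the vertices of a rectangle, the squared increments
    along the diagonals are bounded by those along the four sides. *)
Lemma quadrilateral (a b c e : R) :
  ((a - e) ^+ 2 + (c - b) ^+ 2 <=
   ((a - c) ^+ 2 + (b - e) ^+ 2) + ((a - b) ^+ 2 + (c - e) ^+ 2))%R.
Proof.
rewrite -subr_ge0.
rewrite [leRHS](_ : _ = (a - b - c + e) ^+ 2)%R ?sqr_ge0//.
by ring.
Qed.

Variable F : S1 * S2 -> R.
Hypothesis mF : measurable_fun [set: S1 * S2] F.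

Let mFc d (S : measurableType d) (f : S -> S1) (g : S -> S2) :
  measurable_fun [set: S] f -> measurable_fun [set: S] g ->
  measurable_fun [set: S] (fun s => F (f s, g s)).
Proof.
move=> mf mg; apply: (measurableT_comp mF).
exact: measurable_fun_pair.
Qed.

Let P : probability (S1 * S1)%type R := prod_prob m1 m1.
Let Q : probability (S2 * S2)%type R := prod_prob m2 m2.
Let PQ : probability ((S1 * S1) * (S2 * S2))%type R := prod_prob P Q.
Let T4 : Type := ((S1 * S1) * (S2 * S2))%type.

Let I (g : T4 -> R) := \int[m1]_x \int[m1]_x'
  \int[m2]_y \int[m2]_y' (g ((x, x'), (y, y')))%:E.

Let IE (g : T4 -> R) : measurable_fun [set: (S1 * S1) * (S2 * S2)] g ->
  (forall z, (0 <= g z)%R) ->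
  I g = \int[PQ]_z (g z)%:E.
Proof.
move=> mg g0; have mg' : measurable_fun [set: (S1 * S1) * (S2 * S2)] (EFin \o g).
  exact/measurable_EFinP.
have g0' z : 0 <= (EFin \o g) z by rewrite lee_fin.
rewrite (integral_prod_prob P Q mg' g0').
rewrite (integral_prod_prob m1 m1 (measurable_integral_snd Q mg' g0')); last first.
  by move=> z; exact: integral_ge0.
apply: eq_integral => x _; apply: eq_integral => x' _.
rewrite (@integral_prod_prob _ _ _ _ _ m2 m2 (fun y => (g ((x, x'), y))%:E)) //.
- by apply: measurableT_comp mg' _.
- by move=> y; rewrite lee_fin.
Qed.

Let mfst1 : measurable_fun [set: (S1 * S1) * (S2 * S2)] (fun z => z.1.1).
Proof. exact: measurableT_comp. Qed.
Let msnd1 : measurable_fun [set: (S1 * S1) * (S2 * S2)] (fun z => z.1.2).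
Proof. exact: measurableT_comp. Qed.
Let mfst2 : measurable_fun [set: (S1 * S1) * (S2 * S2)] (fun z => z.2.1).
Proof. exact: measurableT_comp. Qed.
Let msnd2 : measurable_fun [set: (S1 * S1) * (S2 * S2)] (fun z => z.2.2).
Proof. exact: measurableT_comp. Qed.

Let sq (p q : T4 -> S1 * S2) (z : T4) : R := ((F (p z) - F (q z)) ^+ 2)%R.

Let sq_ge0 p q z : (0 <= sq p q z)%R. Proof. exact: sqr_ge0. Qed.

(* The vertices of the rectangle spanned by (x, y) and (x', y'), for
   z = ((x, x'), (y, y')). *)
Let va (z : T4) := (z.1.1, z.2.1).
Let vb (z : T4) := (z.1.2, z.2.1).
Let vc (z : T4) := (z.1.1, z.2.2).
Let ve (z : T4) := (z.1.2, z.2.2).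

Let msq (p q : T4 -> S1 * S2) : measurable_fun [set: (S1 * S1) * (S2 * S2)] p ->
  measurable_fun [set: (S1 * S1) * (S2 * S2)] q ->
  measurable_fun [set: (S1 * S1) * (S2 * S2)] (sq p q).
Proof.
move=> mp mq; apply: measurable_funX.
by apply: measurable_funB; exact: measurableT_comp.
Qed.

Let mva : measurable_fun [set: (S1 * S1) * (S2 * S2)] va.
Proof. exact: (measurable_fun_pair mfst1 mfst2). Qed.
Let mvb : measurable_fun [set: (S1 * S1) * (S2 * S2)] vb.
Proof. exact: (measurable_fun_pair msnd1 mfst2). Qed.
Let mvc : measurable_fun [set: (S1 * S1) * (S2 * S2)] vc.
Proof. exact: (measurable_fun_pair mfst1 msnd2). Qed.
Let mve : measurable_fun [set: (S1 * S1) * (S2 * S2)] ve.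
Proof. exact: (measurable_fun_pair msnd1 msnd2). Qed.

Let ID (g h : T4 -> R) : measurable_fun [set: (S1 * S1) * (S2 * S2)] g ->
  measurable_fun [set: (S1 * S1) * (S2 * S2)] h ->
  (forall z, (0 <= g z)%R) -> (forall z, (0 <= h z)%R) ->
  I (fun z => g z + h z)%R = I g + I h.
Proof.
move=> mg mh g0 h0; rewrite !IE//; last 2 first.
- exact: measurable_funD.
- by move=> z; exact: addr_ge0.
rewrite -ge0_integralD//.
- by move=> z _; rewrite lee_fin.
- exact/measurable_EFinP.
- by move=> z _; rewrite lee_fin.
- exact/measurable_EFinP.
Qed.

Let Ile (g h : T4 -> R) : measurable_fun [set: (S1 * S1) * (S2 * S2)] g ->
  measurable_fun [set: (S1 * S1) * (S2 * S2)] h ->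
  (forall z, (0 <= g z)%R) -> (forall z, (g z <= h z)%R) -> I g <= I h.
Proof.
move=> mg mh g0 gh; have h0 z : (0 <= h z)%R by exact: le_trans (gh z).
rewrite !IE//; apply: ge0_le_integral => //.
- by move=> z _; rewrite lee_fin.
- exact/measurable_EFinP.
- exact/measurable_EFinP.
- by move=> z _; rewrite lee_fin.
Qed.

Let V1 := \int[m2]_y dvar m1 (fun x => F (x, y)).
Let V2 := \int[m1]_x dvar m2 (fun y => F (x, y)).

Let Ibc : I (sq vb vc) = I (sq va ve).
Proof.
apply: eq_integral => x _; apply: eq_integral => x' _.
rewrite (@integral_swap _ _ _ _ _ m2 m2 (fun p => (sq vb vc ((x, x'), p))%:E)).
- apply: eq_integral => y _; apply: eq_integral => y' _.
  by rewrite /sq /va /vb /vc /ve /= -sqrrN opprB.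
- apply/measurable_EFinP; apply: (measurableT_comp (msq mvb mvc)) => //.
- by move=> p; rewrite lee_fin.
Qed.

Let Iac : I (sq va vc) = V2.
Proof.
apply: eq_integral => x _.
exact: (integral_prob_cst m1 (dvar m2 (fun y => F (x, y)))).
Qed.

Let Ibe : I (sq vb ve) = V2.
Proof. exact: (integral_prob_cst m1 V2). Qed.

Let IabE : \int[m1]_x \int[m1]_x' \int[m2]_y (((F (x, y) - F (x', y)) ^+ 2)%R)%:E = V1.
Proof.
pose g (q : (S1 * S1) * S2) : \bar R := (((F (q.1.1, q.2) - F (q.1.2, q.2)) ^+ 2)%R)%:E.
have mg : measurable_fun [set: (S1 * S1) * S2] g.
  apply: measurable_sq_diff.
    exact: (mFc (measurableT_comp measurable_fst measurable_fst) measurable_snd).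
  exact: (mFc (measurableT_comp measurable_snd measurable_fst) measurable_snd).
have g0 q : 0 <= g q by exact: sq_ge0E.
transitivity (\int[P]_p \int[m2]_y g (p, y)).
  apply/esym/(@integral_prod_prob _ _ _ _ _ m1 m1 (fun p => \int[m2]_y g (p, y))).
    exact: (measurable_integral_snd m2 mg g0).
  by move=> p; exact: integral_ge0.
transitivity (\int[m2]_y \int[P]_p g (p, y)).
  exact: (@integral_swap _ _ _ _ _ P m2 g mg g0).
apply: eq_integral => y _.
have mgy : measurable_fun [set: S1 * S1] (fun p => g (p, y)).
  exact: (measurableT_comp mg (pair2_measurable y)).
exact: (integral_prod_prob m1 m1 mgy (fun p => g0 (p, y))).
Qed.

Let Iab : I (sq va vb) = V1.
Proof.
rewrite -IabE; apply: eq_integral => x _; apply: eq_integral => x' _.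
apply: eq_integral => y _.
exact: (integral_prob_cst m2 (((F (x, y) - F (x', y)) ^+ 2)%R)%:E).
Qed.

Let Ice : I (sq vc ve) = V1.
Proof.
rewrite -IabE; apply: eq_integral => x _; apply: eq_integral => x' _.
exact: (integral_prob_cst m2 (\int[m2]_y (((F (x, y) - F (x', y)) ^+ 2)%R)%:E)).
Qed.

(** The two diagonals of a random rectangle have the same mean squared
    increment, and so do opposite sides; [quadrilateral] is integrated over the
    four independent coordinates. *)
Lemma dvar_prod :
  \int[m1]_x \int[m2]_y \int[m1]_x' \int[m2]_y' (((F (x, y) - F (x', y')) ^+ 2)%R)%:E
  <= V1 + V2.
Proof.
have -> : \int[m1]_x \int[m2]_y \int[m1]_x' \int[m2]_y'
    (((F (x, y) - F (x', y')) ^+ 2)%R)%:E = I (sq va ve).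
  apply: eq_integral => x _.
  pose g (q : (S2 * S1) * S2) : \bar R :=
    (((F (x, q.1.1) - F (q.1.2, q.2)) ^+ 2)%R)%:E.
  have mg : measurable_fun [set: (S2 * S1) * S2] g.
    apply: measurable_sq_diff.
      apply: (mFc (measurable_cst x)).
      exact: (measurableT_comp measurable_fst measurable_fst).
    exact: (mFc (measurableT_comp measurable_snd measurable_fst) measurable_snd).
  have g0 q : 0 <= g q by exact: sq_ge0E.
  have G0 p : 0 <= \int[m2]_y' g (p, y') by exact: integral_ge0.
  exact: (integral_swap m2 m1 (measurable_integral_snd m2 mg g0) G0).
apply: lee_double.
have E1 := ID (msq mva mve) (msq mvb mvc) (sq_ge0 _ _) (sq_ge0 _ _).
have E2 := ID (msq mva mvc) (msq mvb mve) (sq_ge0 _ _) (sq_ge0 _ _).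
have E3 := ID (msq mva mvb) (msq mvc mve) (sq_ge0 _ _) (sq_ge0 _ _).
rewrite Ibc in E1; rewrite Iac Ibe in E2; rewrite Iab Ice in E3.
rewrite -E1.
have mm2 := measurable_funD (msq mva mvc) (msq mvb mve).
have mm3 := measurable_funD (msq mva mvb) (msq mvc mve).
have p2 z : (0 <= sq va vc z + sq vb ve z)%R by rewrite addr_ge0.
have p3 z : (0 <= sq va vb z + sq vc ve z)%R by rewrite addr_ge0.
have E4 := ID mm2 mm3 p2 p3.
rewrite E2 E3 in E4.
rewrite addeACA addeC -E4.
apply: Ile.
- exact: (measurable_funD (msq mva mve) (msq mvb mvc)).
- exact: (measurable_funD mm2 mm3).
- by move=> z; rewrite addr_ge0.
- move=> z; rewrite /sq -[in X in (_ + X <= _)%R](sqrrN (F (vb z) - F (vc z))) opprB.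
  exact: quadrilateral.
Qed.

End double_variance.

Lemma emeasurable_prod d (T : measurableType d) (R : realType) (I : Type)
    (r : seq I) (F : I -> T -> \bar R) :
  (forall i, measurable_fun [set: T] (F i)) ->
  measurable_fun [set: T] (fun t => \prod_(i <- r) F i t)%E.
Proof.
move=> mF; elim: r => [|i r IH].
  by under eq_fun do rewrite big_nil; exact: measurable_cst.
under eq_fun do rewrite big_cons; exact: emeasurable_funM.
Qed.

Section power_measure.
Context (R : realType) (d : measure_display) (S : measurableType d).
Variable mu : probability S R.
Local Open Scope ereal_scope.

Definition consp k (p : S * k.-tuple S) : k.+1.-tuple S := [tuple of p.1 :: p.2].

Lemma measurable_consp k : measurable_fun setT (@consp k).
Proof. exact: measurable_cons. Qed.

HB.instance Definition _ k :=
  @isMeasurableFun.Build _ _ _ _ (@consp k) (@measurable_consp k).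

(** The product probability of k copies of mu, built one coordinate at a time
    so that integrals over it unfold by induction ([integral_powmS]). *)
Fixpoint powm k : probability (k.-tuple S) R :=
  if k is k'.+1 then distribution (prod_prob mu (powm k')) (@consp k')
  else dirac [tuple].

Lemma integral_powmS k (F : k.+1.-tuple S -> \bar R) :
  measurable_fun [set: k.+1.-tuple S] F -> (forall t, 0 <= F t) ->
  \int[powm k.+1]_t F t = \int[mu]_x \int[powm k]_t F (consp (x, t)).
Proof.
move=> mF F0.
have mFc : measurable_fun [set: S * k.-tuple S] (F \o @consp k).
  exact: (measurableT_comp mF (@measurable_consp k)).
rewrite [LHS](ge0_integral_distribution _ mF F0).
exact: (integral_prod_prob mu (powm k) mFc (fun p => F0 (consp p))).
Qed.

Lemma tnth_consp0 k (p : S * k.-tuple S) : tnth (consp p) ord0 = p.1.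
Proof. by rewrite (tnth_nth p.1). Qed.

Lemma tnth_consp_lift k (p : S * k.-tuple S) i :
  tnth (consp p) (lift ord0 i) = tnth p.2 i.
Proof. by rewrite tnthS. Qed.

Lemma integral_powm_prod k (G : 'I_k -> S -> \bar R) :
  (forall i, measurable_fun [set: S] (G i)) -> (forall i s, 0 <= G i s) ->
  \int[powm k]_t \prod_(i < k) G i (tnth t i) = \prod_(i < k) \int[mu]_s G i s.
Proof.
elim: k => [|k IH] in G * => mG G0.
  under eq_integral do rewrite big_ord0.
  by rewrite big_ord0 integral_prob_cst.
have mP : measurable_fun [set: k.-tuple S]
    (fun t => \prod_(i < k) G (lift ord0 i) (tnth t i)).
  apply: emeasurable_prod => i.
  exact: (measurableT_comp (mG _) (measurable_tnth i)).
have P0 (t : k.-tuple S) : 0 <= \prod_(i < k) G (lift ord0 i) (tnth t i).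
  exact: prode_ge0.
rewrite integral_powmS; last 2 first.
- apply: emeasurable_prod => i.
  exact: (measurableT_comp (mG _) (measurable_tnth i)).
- by move=> t; exact: prode_ge0.
transitivity (\int[mu]_x (G ord0 x *
    \int[powm k]_t \prod_(i < k) G (lift ord0 i) (tnth t i))).
  apply: eq_integral => x _; rewrite -(ge0_integralZl _ _ mP)//.
  apply: eq_integral => t _; rewrite big_ord_recl tnth_consp0; congr (_ * _).
  by apply: eq_bigr => i _; rewrite tnth_consp_lift.
under eq_integral do rewrite (IH (fun i => G (lift ord0 i)))//.
rewrite ge0_integralZr ?big_ord_recl//.
by apply: prode_ge0 => i _; exact: integral_ge0.
Qed.

Definition upd k (t : k.-tuple S) (i : 'I_k) (s : S) : k.-tuple S :=
  [tuple if j == i then s else tnth t j | j < k].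

Lemma tnth_upd k (t : k.-tuple S) i s j :
  tnth (upd t i s) j = if j == i then s else tnth t j.
Proof. by rewrite tnth_mktuple. Qed.

Lemma measurable_upd k (i : 'I_k) :
  measurable_fun [set: k.-tuple S * S] (fun p => upd p.1 i p.2).
Proof.
apply/measurable_fun_tnthP => j.
have [->|ji] := eqVneq j i.
  rewrite (_ : _ \o _ = snd)//.
  by apply/funext => p /=; rewrite tnth_upd eqxx.
rewrite (_ : _ \o _ = (fun t => tnth t j) \o fst)//.
  exact: (measurableT_comp (measurable_tnth j) measurable_fst).
by apply/funext => p /=; rewrite tnth_upd (negPf ji).
Qed.

Lemma upd_consp0 k x (t : k.-tuple S) s : upd (consp (x, t)) ord0 s = consp (s, t).
Proof.
apply: eq_from_tnth => j; rewrite tnth_upd.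
have [->|] := eqVneq j ord0; first by rewrite tnth_consp0.
by case: (unliftP ord0 j) => [j' ->|->//] _; rewrite !tnth_consp_lift.
Qed.

Lemma upd_consp_lift k x (t : k.-tuple S) i s :
  upd (consp (x, t)) (lift ord0 i) s = consp (x, upd t i s).
Proof.
apply: eq_from_tnth => j; rewrite tnth_upd.
case: (unliftP ord0 j) => [j' ->|->]; last by rewrite !tnth_consp0.
by rewrite (inj_eq lift_inj) !tnth_consp_lift tnth_upd.
Qed.

Lemma measurable_dvar d' (T : measurableType d') (F : T * S -> R) :
  measurable_fun [set: T * S] F ->
  measurable_fun [set: T] (fun t => dvar mu (fun s => F (t, s))).
Proof.
move=> mF.
pose g (q : (T * S) * S) : \bar R := (((F q.1 - F (q.1.1, q.2)) ^+ 2)%R)%:E.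
have mg : measurable_fun [set: (T * S) * S] g.
  apply: measurable_sq_diff; first exact: (measurableT_comp mF measurable_fst).
  apply: (measurableT_comp mF).
  exact: (measurable_fun_pair (measurableT_comp measurable_fst measurable_fst) measurable_snd).
have g0 q : 0 <= g q by exact: sq_ge0E.
have mG := measurable_integral_snd mu mg g0.
apply: (measurable_integral_snd mu mG) => p; exact: integral_ge0.
Qed.

Lemma dvar_ge0 d' (T : measurableType d') (nu : probability T R) (f : T -> R) :
  0 <= dvar nu f.
Proof. by do 2 (apply: integral_ge0 => ? _); exact: sq_ge0E. Qed.

(** Efron-Stein inequality, by induction on k from [dvar_prod]. *)
Theorem dvar_powm k (f : k.-tuple S -> R) : measurable_fun [set: k.-tuple S] f ->
  dvar (powm k) f <=
  \sum_(i < k) \int[powm k]_t dvar mu (fun s => f (upd t i s)).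
Proof.
elim: k => [|k IH] in f * => mf.
  rewrite big_ord0 /dvar.
  have E (t t' : 0.-tuple S) : ((f t - f t') ^+ 2)%R = 0%R.
    by rewrite (tuple0 t) (tuple0 t') subrr expr0n.
  under eq_integral do under eq_integral do rewrite E.
  by under eq_integral do rewrite integral0; rewrite integral0.
have mcons : measurable_fun [set: S * k.-tuple S] (f \o @consp k).
  exact: (measurableT_comp mf (@measurable_consp k)).
have mupd i : measurable_fun [set: k.+1.-tuple S * S] (fun p => f (upd p.1 i p.2)).
  exact: (measurableT_comp mf (@measurable_upd _ i)).
have msq : measurable_fun [set: k.+1.-tuple S * k.+1.-tuple S]
    (fun p => (((f p.1 - f p.2) ^+ 2)%R)%:E).
  exact: (measurable_sq_diff (measurableT_comp mf measurable_fst)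
     (measurableT_comp mf measurable_snd)).
have -> : dvar (powm k.+1) f = \int[mu]_x \int[powm k]_y \int[mu]_x' \int[powm k]_y'
   (((f (consp (x, y)) - f (consp (x', y'))) ^+ 2)%R)%:E.
  rewrite /dvar integral_powmS; last 2 first.
  - exact: (measurable_integral_snd (powm k.+1) msq (fun=> sq_ge0E _)).
  - by move=> t; apply: integral_ge0 => t' _; exact: sq_ge0E.
  apply: eq_integral => x _; apply: eq_integral => t _.
  apply: integral_powmS => [|t']; last exact: sq_ge0E.
  exact: (measurable_sq_diff (measurable_cst _) mf).
apply: (le_trans (dvar_prod mu (powm k) mcons)).
rewrite big_ord_recl; apply: leeD.
  rewrite integral_powmS; last 2 first.
  - exact: (measurable_dvar (mupd ord0)).
  - by move=> t; exact: dvar_ge0.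
  under [leRHS]eq_integral do under eq_integral do
    under eq_fun do rewrite upd_consp0.
  by rewrite integral_prob_cst.
have mI i : measurable_fun [set: S] (fun x => \int[powm k]_t
    dvar mu (fun s => f (consp (x, upd t i s)))).
  apply: (@measurable_integral_snd _ _ _ _ _ (powm k)
    (fun p => dvar mu (fun s => f (consp (p.1, upd p.2 i s))))).
    apply: (@measurable_dvar _ _ (fun q => f (consp (q.1.1, upd q.1.2 i q.2)))).
    apply: (measurableT_comp mcons); apply: measurable_fun_pair.
      exact: (measurableT_comp measurable_fst measurable_fst).
    exact: (measurableT_comp (@measurable_upd _ i)
      (measurable_fun_pair (measurableT_comp measurable_snd measurable_fst)
        measurable_snd)).
  by move=> p; exact: dvar_ge0.
under [leRHS]eq_bigr => i _.
  rewrite integral_powmS; last 2 first.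
  - exact: (measurable_dvar (mupd _)).
  - by move=> t; exact: dvar_ge0.
  under eq_integral do under eq_integral do
    under eq_fun do rewrite upd_consp_lift.
  over.
rewrite -ge0_integral_sum//; last first.
  by move=> i x _; apply: integral_ge0 => t _; exact: dvar_ge0.
apply: ge0_le_integral => //.
- by move=> x _; exact: dvar_ge0.
- apply: (@measurable_integral_snd _ _ _ _ _ (powm k)
    (fun p => \int[powm k]_t (((f (consp p) - f (consp (p.1, t))) ^+ 2)%R)%:E)).
    apply: (@measurable_integral_snd _ _ _ _ _ (powm k)
      (fun q => (((f (consp q.1) - f (consp (q.1.1, q.2))) ^+ 2)%R)%:E)).
      apply: measurable_sq_diff; first exact: (measurableT_comp mcons measurable_fst).
      apply: (measurableT_comp mcons).
      exact: (measurable_fun_pair (measurableT_comp measurable_fst measurable_fst)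
        measurable_snd).
    by move=> q; exact: sq_ge0E.
  by move=> p; apply: integral_ge0 => t _; exact: sq_ge0E.
- exact: emeasurable_sum.
- move=> x _; apply: IH.
  exact: (measurableT_comp mcons (pair1_measurable x)).
Qed.

End power_measure.

(** * The Gaussian law on the line *)

Section density.
Context (R : realType) d (T : measurableType d).
Variables (mu nu : {measure set T -> \bar R}) (p : T -> R).
Hypothesis mp : measurable_fun [set: T] p.
Hypothesis p0 : forall x, (0 <= p x)%R.
Hypothesis nuE : forall A, measurable A -> nu A = (\int[mu]_(x in A) (p x)%:E)%E.
Local Open Scope ereal_scope.
Import HBNNSimple.

(** For indicators this is the definition of a density; both sides pass to
    increasing limits of simple functions. *)
Lemma ge0_integral_density (f : T -> \bar R) :
  measurable_fun [set: T] f -> (forall x, 0 <= f x) ->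
  \int[nu]_x f x = \int[mu]_x (f x * (p x)%:E).
Proof.
move=> mf f0; pose g := nnsfun_approx measurableT mf.
have gf x : EFin (g n x) @[n --> \oo] --> f x.
  exact: cvg_nnsfun_approx.
have -> : \int[nu]_x f x = limn (fun n => \int[nu]_x (g n x)%:E).
  rewrite -monotone_convergence//.
  - by apply: eq_integral => x _; apply/esym/cvg_lim => //; exact: gf.
  - by move=> n; exact/measurable_EFinP.
  - by move=> n x _; rewrite lee_fin.
  - by move=> x _ a b ab; rewrite lee_fin; exact/lefP/nd_nnsfun_approx.
have -> : \int[mu]_x (f x * (p x)%:E) = limn (fun n => \int[mu]_x ((g n x)%:E * (p x)%:E)).
  rewrite -monotone_convergence//.
  - apply: eq_integral => x _; apply/esym/cvg_lim => //.
    by apply: cvgeZr => //; exact: gf.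
  - by move=> n; apply: emeasurable_funM; exact/measurable_EFinP.
  - by move=> n x _; rewrite mule_ge0 ?lee_fin.
  - move=> x _ a b ab; rewrite lee_pmul ?lee_fin//.
    exact/lefP/nd_nnsfun_approx.
congr (limn _); apply/funext => n.
under eq_integral do rewrite fimfunE -fsumEFin//.
rewrite ge0_integral_fsum//; last 2 first.
- by move=> y; exact/measurable_EFinP/measurable_funM.
- by move=> y x _; rewrite EFinM nnfun_muleindic_ge0.
under [RHS]eq_integral => x _.
  rewrite fimfunE -fsumEFin// ge0_mule_fsuml; last by move=> r; rewrite EFinM nnfun_muleindic_ge0.
  over.
rewrite ge0_integral_fsum//; last 2 first.
- move=> y; apply: (@emeasurable_funM _ _ _ _
    (fun x => (y * \1_(g n @^-1` [set y]) x)%:E) (EFin \o p)).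
    exact/measurable_EFinP/measurable_funM.
  exact/measurable_EFinP.
- by move=> y x _; rewrite mule_ge0 ?lee_fin// -lee_fin EFinM nnfun_muleindic_ge0.
apply: eq_fsbigr => r /set_mem[x _ <-].
under [RHS]eq_integral do rewrite EFinM -muleA.
rewrite [RHS]ge0_integralZl//; last 3 first.
- apply: (@emeasurable_funM _ _ _ _ (EFin \o \1_(g n @^-1` [set g n x])) (EFin \o p)).
    by apply/measurable_EFinP; exact: measurable_indic.
  exact/measurable_EFinP.
- by move=> y _; rewrite mule_ge0 ?lee_fin.
- by rewrite lee_fin.
under eq_integral do rewrite EFinM.
rewrite ge0_integralZl//; last 2 first.
- by apply/measurable_EFinP; exact: measurable_indic.
- by rewrite lee_fin.
congr (_ * _); rewrite integral_indic// setIT nuE//.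
rewrite integral_mkcond; apply: eq_integral => y _.
by rewrite patchE indicE; case: ifPn; rewrite ?mul1e ?mul0e.
Qed.
End density.

Section gaussian_line.
Context (R : realType).
Local Notation mu := (@lebesgue_measure R).
Local Notation gam := (normal_prob (0 : R) 1).
Local Notation phi := (normal_pdf (0 : R) 1).

Definition gauss : probability (measurableTypeR R) R := normal_prob (0 : R) 1.

Lemma gauss_pdfE (x : R) : phi x = normal_peak 1 * expR (- x ^+ 2 / 2).
Proof.
rewrite normal_pdfE// /normal_fun subr0 expr1n.
by congr (_ * expR (_ / _)); rewrite mulr2n.
Qed.

Lemma gauss_pdf_ge0 (x : R) : 0 <= phi x.
Proof. exact: normal_pdf_ge0. Qed.

Lemma measurable_gauss_pdf : measurable_fun [set: measurableTypeR R] phi.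
Proof. exact: measurable_normal_pdf. Qed.

Lemma measurable_gauss_epdf :
  measurable_fun [set: measurableTypeR R] (fun x : measurableTypeR R => (phi x)%:E).
Proof. by apply/measurable_EFinP; exact: measurable_gauss_pdf. Qed.

Local Open Scope ereal_scope.

Lemma integral_gauss (f : R -> \bar R) :
  measurable_fun [set: measurableTypeR R] f -> (forall x, 0 <= f x) ->
  \int[gauss]_x f x = \int[mu]_x (f x * (phi x)%:E).
Proof.
move=> mf f0; apply: ge0_integral_density => //.
- exact: measurable_gauss_pdf.
- exact: gauss_pdf_ge0.
Qed.

Lemma lebesgue_measureD (t : R) (A : set R) : measurable A ->
  pushforward mu (fun x : measurableTypeR R => (x + t)%R : measurableTypeR R) A = mu A.
Proof.
move=> mA; have mf : measurable_fun [set: measurableTypeR R]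
    (fun x : measurableTypeR R => (x + t)%R : measurableTypeR R).
  exact: measurable_funD.
pose f : {mfun measurableTypeR R >-> measurableTypeR R} :=
  HB.pack (fun x : measurableTypeR R => (x + t)%R : measurableTypeR R)
    (isMeasurableFun.Build _ _ _ _ _ mf).
apply/esym; apply: (@lebesgue_measure_unique R (pushforward mu f)) => //.
move=> _ [[a b]] _ <-.
have E : (fun x : R => x + t)%R @^-1` `]a, b] = `](a - t)%R, (b - t)%R]%classic.
  by apply/seteqP; split => x; rewrite /= !in_itv/= ltrBlDr lerBrDr.
transitivity (mu `](a - t)%R, (b - t)%R]%classic); last by rewrite -E.
by rewrite !lebesgue_measure_itv/= !lte_fin ltrD2r -!EFinB opprB addrA subrK.
Qed.

Lemma integral_translate (t : R) (f : R -> \bar R) :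
  measurable_fun [set: measurableTypeR R] f -> (forall x, 0 <= f x) ->
  \int[mu]_x f (x + t)%R = \int[mu]_x f x.
Proof.
move=> mf f0; have mg : measurable_fun [set: measurableTypeR R]
    (fun x : measurableTypeR R => (x + t)%R : measurableTypeR R).
  exact: measurable_funD.
rewrite -[LHS](@ge0_integral_pushforward _ _ _ _ _ _ mg mu setT)//.
by apply: eq_measure_integral => A mA _; exact: lebesgue_measureD.
Qed.

(** Cameron-Martin formula on the line. *)
Lemma gauss_shift (t : R) (f : R -> \bar R) :
  measurable_fun [set: measurableTypeR R] f -> (forall x, 0 <= f x) ->
  \int[gauss]_x (f (x + t)%R * (expR (- (t * x) - t ^+ 2 / 2))%:E) =
  \int[gauss]_x f x.
Proof.
move=> mf f0.
have mg : measurable_fun [set: measurableTypeR R]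
    (fun x : measurableTypeR R => (x + t)%R : measurableTypeR R).
  exact: measurable_funD.
have mh : measurable_fun [set: measurableTypeR R]
    (fun x : R => (expR (- (t * x) - t ^+ 2 / 2))%:E).
  apply/measurable_EFinP; apply: measurableT_comp => //.
  by apply: measurable_funB => //; apply: measurable_funN; exact: measurable_funM.
rewrite !integral_gauss//; last 2 first.
- exact: (emeasurable_funM (measurableT_comp mf mg) mh).
- by move=> x; rewrite mule_ge0// lee_fin expR_ge0.
rewrite -[RHS](@integral_translate t (fun x => f x * (phi x)%:E)); last 2 first.
- exact: (emeasurable_funM mf measurable_gauss_epdf).
- by move=> x; rewrite mule_ge0// lee_fin gauss_pdf_ge0.
apply: eq_integral => x _; rewrite -muleA -EFinM; congr (_ * _%:E).
rewrite !gauss_pdfE mulrCA -expRD; congr (_ * expR _)%R.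
by field.
Qed.

(** [gauss_shift] by - a, applied to the constant 1. *)
Lemma gauss_mgf (a : R) : \int[gauss]_x (expR (a * x))%:E = (expR (a ^+ 2 / 2))%:E.
Proof.
have := @gauss_shift (- a) (cst 1) (measurable_cst _) (fun=> lee01).
rewrite integral_prob_cst => H.
rewrite -[RHS]mule1 -[in RHS]H -ge0_integralZl//.
- apply: eq_integral => x _; rewrite mul1e -EFinM -expRD.
  by congr (expR _)%:E; rewrite sqrrN mulNr opprK addrCA subrr addr0.
- apply: (@emeasurable_funM _ _ _ _ (cst 1)
    (fun x : measurableTypeR R => (expR (- (- a * x) - (- a) ^+ 2 / 2))%:E)) => //.
  apply/measurable_EFinP; apply: measurableT_comp => //.
  by apply: measurable_funB => //; apply: measurable_funN; exact: measurable_funM.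
- by move=> x _; rewrite mul1e lee_fin expR_ge0.
Qed.

End gaussian_line.

(** * The Gaussian Poincare inequality on the line *)

Section gaussian_poincare_line.
Context (R : realType).
Local Notation mu := (@lebesgue_measure R).
Local Notation phi := (normal_pdf (0 : R) 1).

Let peak : R := normal_peak (1 : R).

Lemma gauss_pdf_cvg0 : phi x @[x --> +oo] --> (0 : R).
Proof.
apply: (@squeeze_cvgr _ _ _ _ (fun=> 0) (fun x => (peak * expR (2^-1)) * expR (- x))).
- near=> x; rewrite gauss_pdf_ge0/= gauss_pdfE -mulrA ler_wpM2l ?normal_peak_ge0//.
  rewrite -expRD ler_expR.
  have := sqr_ge0 (x - 1); rewrite sqrrB expr1n mulr1; lra.
- exact: cvg_cst.
- rewrite -[X in _ --> X](mulr0 (peak * expR (2^-1))).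
  by apply: cvgMl_tmp; exact: cvgr_expR.
Unshelve. all: by end_near. Qed.

Lemma is_derive_gauss_pdf (x : R) : is_derive x 1 (fun y => - phi y) (x * phi x).
Proof.
rewrite (_ : (fun y => - phi y) = (fun y => (- peak) * expR (- y ^+ 2 / 2))); last first.
  by apply/funext => y; rewrite gauss_pdfE [RHS]mulNr.
rewrite gauss_pdfE.
have E : is_derive x 1 (fun y : R => - y ^+ 2 / 2) (- x).
  apply: is_derive_eq.
  by rewrite /GRing.scale/=; field.
rewrite (_ : x * _ = - peak *: (expR (- x ^+ 2 / 2) * - x)).
  exact: is_deriveZ.
by rewrite /GRing.scale/= /peak; ring.
Qed.

(** - phi is a primitive of the integrand. *)
Lemma gauss_tail_moment (t : R) : 0 <= t ->
  (\int[mu]_(x in `[t, +oo[) (x * phi x)%:E = (phi t)%:E)%E.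
Proof.
move=> t0.
have d (x : R) : is_derive x 1 (fun y => - phi y) (x * phi x).
  exact: is_derive_gauss_pdf.
have cphi : continuous phi by apply: continuous_normal_pdf; exact: oner_neq0.
rewrite (@ge0_continuous_FTC2y _ _ (fun y => - phi y) t 0).
- by rewrite sub0e -EFinN opprK.
- by move=> x tx; rewrite mulr_ge0 ?gauss_pdf_ge0// (le_trans t0).
- apply: continuous_subspaceT => x; apply: continuousM => //; exact: cphi.
- by have := @cvgN _ _ _ _ _ _ _ gauss_pdf_cvg0; rewrite oppr0; exact.
- by move=> x _; have [] := d x.
- apply: cvg_at_right_filter; apply: cvgN; exact: cphi.
- by move=> x _; have [_] := d x; rewrite derive1E.
Qed.

Variables f h : R -> R.
Hypothesis fh : forall x : R, is_derive x 1 f (h x).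
Hypothesis ch : continuous h.

(** The Cauchy-Schwarz inequality for f x - f 0, the integral of h over [0, x]:
    with c the mean slope of f on this interval, h^2 >= 2 c h - c^2. *)
Lemma sq_increment_le (x : R) : 0 < x ->
  (((f x - f 0) ^+ 2)%:E <= x%:E * \int[mu]_(t in `[0%R, x]) (h t ^+ 2)%:E)%E.
Proof.
move=> x0; pose c := (f x - f 0) / x.
pose k t := 2 * c * h t - c ^+ 2.
have ck : continuous k.
  move=> t; apply: (@cvgB _ R^o); last exact: cvg_cst.
  by apply: cvgMl_tmp; exact: ch.
have ch2 : continuous (fun t => h t ^+ 2).
  by move=> t; apply: (@continuous_comp _ _ _ h (fun z => z ^+ 2)); [exact: ch|exact: exprn_continuous].
have dK (t : R) : is_derive t 1 (fun t : R => 2 * c * f t - c ^+ 2 * t) (k t).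
  have := fh t => ft.
  by apply: is_derive_eq; rewrite /k /GRing.scale/=; ring.
have FTC : (\int[mu]_(t in `[0%R, x]) (k t)%:E = ((f x - f 0) ^+ 2 / x)%:E)%E.
  rewrite (@continuous_FTC2 _ _ (fun t => 2 * c * f t - c ^+ 2 * t))//.
  - by rewrite -EFinB; congr EFin; rewrite /c; field; rewrite gt_eqF.
  - exact: continuous_subspaceT.
  - have cK : continuous (fun t => 2 * c * f t - c ^+ 2 * t).
      move=> t; apply: differentiable_continuous; apply/derivable1_diffP.
      by have [] := dK t.
    split=> [t _||]; first by have [] := dK t.
    + by apply: cvg_at_right_filter; exact: cK.
    + by apply: cvg_at_left_filter; exact: cK.
  - by move=> t _; have [_] := dK t; rewrite derive1E.
have : (\int[mu]_(t in `[0%R, x]) (k t)%:E <= \int[mu]_(t in `[0%R, x]) (h t ^+ 2)%:E)%E.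
  apply: le_integral => //.
  - apply: continuous_compact_integrable; first exact: segment_compact.
    exact: continuous_subspaceT.
  - apply: continuous_compact_integrable; first exact: segment_compact.
    exact: continuous_subspaceT.
  - move=> t _; rewrite lee_fin /k -subr_ge0.
    by rewrite (_ : _ - _ = (h t - c) ^+ 2) ?sqr_ge0//; ring.
rewrite FTC => H; apply: le_trans (lee_wpmul2l _ H); last by rewrite lee_fin ltW.
by rewrite -EFinM lee_fin mulrC divfK// gt_eqF.
Qed.

(* The integrand obtained from sq_increment_le after multiplication by phi,
   as a function of both variables. *)
Let g (z : R * R) : \bar R :=
  (if (0 <= z.2) && (z.2 <= z.1) then z.1 * phi z.1 * h z.2 ^+ 2 else 0)%:E.

Let g_ge0 z : (0 <= g z)%E.
Proof.
rewrite lee_fin; case: ifPn => // /andP[z0 zx].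
apply: mulr_ge0; last exact: sqr_ge0.
by apply: mulr_ge0; [exact: le_trans zx|exact: gauss_pdf_ge0].
Qed.

Let mh : measurable_fun [set: measurableTypeR R] h.
Proof. exact: continuous_measurable_fun. Qed.

Let mg : measurable_fun [set: measurableTypeR R * measurableTypeR R] g.
Proof.
apply/measurable_EFinP; apply: measurable_fun_ifT.
- apply: measurable_and; first exact: measurable_fun_ler.
  exact: (measurable_fun_ler measurable_snd measurable_fst).
- apply: measurable_funM; first apply: measurable_funM.
  + exact: measurable_fst.
  + exact: (measurableT_comp (@measurable_gauss_pdf R) measurable_fst).
  + by apply: measurable_funX; exact: (measurableT_comp mh measurable_snd).
- exact: measurable_cst.
Qed.

Let inner_t (x : R) : 0 <= x ->
  (\int[mu]_t g (x, t) = (x * phi x)%:E * \int[mu]_(t in `[0%R, x]) (h t ^+ 2)%:E)%E.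
Proof.
move=> x0; rewrite -ge0_integralZl//; last 3 first.
- apply/measurable_funTS/measurable_EFinP; exact: measurable_funX.
- by move=> t _; rewrite lee_fin sqr_ge0.
- by rewrite lee_fin mulr_ge0// gauss_pdf_ge0.
rewrite [RHS]integral_mkcond; apply: eq_integral => t _.
rewrite patchE mem_setE in_itv/= /g/=.
by case: ifP => _; rewrite -?EFinM.
Qed.

Let inner_x (t : R) : 0 <= t -> (\int[mu]_x g (x, t) = (h t ^+ 2 * phi t)%:E)%E.
Proof.
move=> t0; rewrite EFinM -gauss_tail_moment// -ge0_integralZl//; last 3 first.
- apply/measurable_funTS/measurable_EFinP; apply: measurable_funM => //.
  exact: measurable_gauss_pdf.
- move=> x /=; rewrite in_itv/= andbT => tx.
  by rewrite lee_fin mulr_ge0 ?gauss_pdf_ge0// (le_trans t0).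
- by rewrite lee_fin sqr_ge0.
rewrite [RHS]integral_mkcond; apply: eq_integral => x _.
rewrite patchE mem_setE in_itv/= /g/= t0/= andbT.
by case: ifP => _; rewrite -?EFinM// mulrC.
Qed.

(** [sq_increment_le] is integrated against phi. After the exchange of the two
    integrals, the weight of h(t)^2 is the integral of x * phi x over
    [t, +oo[, that is phi t. *)
Lemma half_line_poincare :
  (\int[mu]_(x in `[0%R, +oo[) ((f x - f 0) ^+ 2 * phi x)%:E <=
   \int[mu]_(x in `[0%R, +oo[) (h x ^+ 2 * phi x)%:E)%E.
Proof.
have cf : continuous f.
  by move=> x; apply: differentiable_continuous; apply/derivable1_diffP; have [] := fh x.
have mf : measurable_fun [set: measurableTypeR R] f by exact: continuous_measurable_fun.
have -> : (\int[mu]_(x in `[0%R, +oo[) (h x ^+ 2 * phi x)%:E =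
    \int[mu]_t \int[mu]_x g (x, t))%E.
  rewrite integral_mkcond; apply: eq_integral => t _.
  rewrite patchE mem_setE in_itv/= andbT.
  case: ifPn => [t0|t0]; first by rewrite inner_x.
  rewrite integral0_eq// => x _; rewrite /g/=; by rewrite (negbTE t0).
have -> : (\int[mu]_t \int[mu]_x g (x, t) = \int[mu]_x \int[mu]_t g (x, t))%E.
  by apply/esym;
    exact: (@fubini_tonelli _ _ (measurableTypeR R) (measurableTypeR R) R mu mu g mg g_ge0).
rewrite integral_mkcond.
apply: ge0_le_integral => //.
- move=> x _; rewrite patchE; case: ifP => // _.
  by rewrite lee_fin mulr_ge0 ?sqr_ge0 ?gauss_pdf_ge0.
- apply/(measurable_restrictT _ _).1 => //.
  apply/measurable_funTS/measurable_EFinP; apply: measurable_funM.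
    by apply: measurable_funX; exact: measurable_funB.
  exact: measurable_gauss_pdf.
- exact: (@measurable_fun_fubini_tonelli_F _ _ (measurableTypeR R) (measurableTypeR R)
    R mu g mg g_ge0).
- move=> x _; rewrite patchE mem_setE in_itv/= andbT.
  case: ifPn => [x0|_]; last exact: integral_ge0.
  rewrite inner_t//.
  move: x0; rewrite le_eqVlt => /orP[/eqP <-|x0].
    by rewrite subrr expr2 !mul0r mul0e.
  have -> : (x * phi x)%:E = ((phi x)%:E * x%:E)%E by rewrite -EFinM mulrC.
  rewrite mulrC EFinM -muleA; apply: lee_wpmul2l.
    by rewrite lee_fin gauss_pdf_ge0.
  exact: sq_increment_le.
Qed.

End gaussian_poincare_line.

Section gauss_poincare.
Context (R : realType).
Local Notation mu := (@lebesgue_measure R).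
Local Notation phi := (normal_pdf (0 : R) 1).
Variables f h : R -> R.
Hypothesis fh : forall x : R, is_derive x 1 f (h x).
Hypothesis ch : continuous h.

Let integral_split (g : R -> R) : measurable_fun [set: measurableTypeR R] g ->
  (forall x, 0 <= g x) ->
  (\int[mu]_x (g x)%:E = \int[mu]_(x in `[0%R, +oo[) (g x)%:E +
     \int[mu]_(x in `[0%R, +oo[) (g (- x))%:E)%E.
Proof.
move=> mg g0; have mg' : measurable_fun [set: measurableTypeR R] (EFin \o g).
  exact/measurable_EFinP.
have mgN : measurable_fun [set: measurableTypeR R] (fun x => g (- x)).
  by apply: (measurableT_comp mg); exact: measurable_funN.
have -> : (\int[mu]_(x in `[0%R, +oo[) (g (- x))%:E =
    \int[mu]_(x in `]-oo, 0%R[) (g x)%:E)%E.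
  rewrite integral_itv_bndo_bndc; last exact/measurable_funTS/measurable_EFinP.
  rewrite (@ge0_integration_by_substitution0 _ (fun x => (g (- x))%:E)).
  - by apply: eq_integral => x _; rewrite opprK.
  - exact/measurable_EFinP.
  - by move=> x; rewrite lee_fin.
rewrite addeC -ge0_integral_setU//=.
- by rewrite -itv_bndbnd_setU// set_itvE.
- exact/measurable_funTS.
- by move=> x _; rewrite lee_fin.
- apply/disj_setPLR => x /=; rewrite !in_itv/= andbT => x0.
  by apply/negP; rewrite -ltNge.
Qed.

Let phiN (x : R) : phi (- x) = phi x.
Proof. by rewrite !gauss_pdfE sqrrN. Qed.

(** Since (f x - f y)^2 <= 2 (f x - f 0)^2 + 2 (f y - f 0)^2, it suffices to
    bound increments from 0; these are treated on each half-line separately. *)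
Lemma gauss_poincare :
  (dvar (gauss R) f <= 4%:E * \int[gauss R]_x (h x ^+ 2)%:E)%E.
Proof.
have cf : continuous f.
  by move=> x; apply: differentiable_continuous; apply/derivable1_diffP; have [] := fh x.
have mf : measurable_fun [set: measurableTypeR R] f by exact: continuous_measurable_fun.
have mh : measurable_fun [set: measurableTypeR R] h by exact: continuous_measurable_fun.
pose F x := (f x - f 0) ^+ 2.
have mF : measurable_fun [set: measurableTypeR R] F.
  by apply: measurable_funX; exact: measurable_funB.
have F0 x : 0 <= F x by exact: sqr_ge0.
have mF' : measurable_fun [set: measurableTypeR R] (fun x => (F x)%:E).
  exact/measurable_EFinP.
have intF0 : (0 <= \int[gauss R]_x (F x)%:E)%E.
  by apply: integral_ge0 => x _; rewrite lee_fin.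
have step1 : (dvar (gauss R) f <= 4%:E * \int[gauss R]_x (F x)%:E)%E.
  apply: (@le_trans _ _ (\int[gauss R]_x \int[gauss R]_y (2%:E * (F x)%:E + 2%:E * (F y)%:E))%E).
    apply: ge0_le_integral => //.
    - by move=> x _; apply: integral_ge0 => y _; exact: sq_ge0E.
    - apply: (@measurable_integral_snd _ _ _ _ _ (gauss R)
        (fun p => ((f p.1 - f p.2) ^+ 2)%:E)) => [|p]; last exact: sq_ge0E.
      exact: (measurable_sq_diff (measurableT_comp mf measurable_fst)
        (measurableT_comp mf measurable_snd)).
    - apply: (@measurable_integral_snd _ _ _ _ _ (gauss R)
        (fun p => (2%:E * (F p.1)%:E + 2%:E * (F p.2)%:E)%E)) => [|p].
        apply: emeasurable_funD; apply: emeasurable_funM => //.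
          exact: (measurableT_comp mF' measurable_fst).
        exact: (measurableT_comp mF' measurable_snd).
      by rewrite adde_ge0// mule_ge0// lee_fin.
    - move=> x _; apply: ge0_le_integral => //.
      + by move=> y _; exact: sq_ge0E.
      + exact: (measurable_sq_diff (measurable_cst _) mf).
      + apply: emeasurable_funD => //; exact: emeasurable_funM.
      + move=> y _; rewrite -!EFinM -EFinD lee_fin /F -subr_ge0.
        by rewrite (_ : _ - _ = ((f x - f 0) + (f y - f 0)) ^+ 2) ?sqr_ge0//; ring.
  have E x : (\int[gauss R]_y (2%:E * (F x)%:E + 2%:E * (F y)%:E) =
      2%:E * (F x)%:E + 2%:E * \int[gauss R]_y (F y)%:E)%E.
    rewrite ge0_integralD//; last 3 first.
    - by move=> y _; rewrite mule_ge0 ?lee_fin.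
    - by move=> y _; rewrite mule_ge0 ?lee_fin.
    - exact: emeasurable_funM.
    rewrite integral_prob_cst ge0_integralZl//.
    by move=> y _; rewrite lee_fin.
  under eq_integral do rewrite E.
  rewrite ge0_integralD//; last 3 first.
  - by move=> y _; rewrite mule_ge0 ?lee_fin.
  - exact: emeasurable_funM.
  - by move=> y _; rewrite mule_ge0.
  rewrite integral_prob_cst ge0_integralZl//; last by move=> y _; rewrite lee_fin.
  rewrite -ge0_muleDl ?lee_fin// -EFinD.
  by rewrite (_ : 2 + 2 = 4 :> R)//; lra.
apply: (le_trans step1); apply: lee_wpmul2l => //.
have mh2 : measurable_fun [set: measurableTypeR R] (fun x => h x ^+ 2).
  exact: measurable_funX.
rewrite !integral_gauss//; last 2 first.
- exact/measurable_EFinP.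
- by move=> x; rewrite lee_fin sqr_ge0.
under eq_integral do rewrite -EFinM.
under [leRHS]eq_integral do rewrite -EFinM.
rewrite !integral_split//.
- under [X in (_ <= _ + X)%E]eq_integral do rewrite phiN -sqrrN.
  under [X in (_ + X <= _)%E]eq_integral do rewrite phiN.
  apply: leeD; first exact: half_line_poincare.
  have := @half_line_poincare _ (fun x => f (- x)) (fun x => - h (- x)).
  rewrite oppr0; apply.
  + move=> x.
    have H := @is_derive1_comp _ f -%R x _ _ (fh (- x)) (is_deriveN _).
    by rewrite -mulrN1; apply: H.
  + by move=> x; apply: cvgN; apply: (@continuous_comp _ _ _ -%R h);
      [exact: opp_continuous|exact: ch].
- by apply: measurable_funM => //; exact: measurable_gauss_pdf.
- by move=> x; rewrite mulr_ge0 ?sqr_ge0 ?gauss_pdf_ge0.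
- by apply: measurable_funM => //; exact: measurable_gauss_pdf.
- by move=> x; rewrite mulr_ge0 ?F0 ?gauss_pdf_ge0.
Qed.
End gauss_poincare.

(** * Laws of independent families *)

Section law_of_independent_family.
Context (R : realType) d (T : measurableType d) (P : probability T R).
Context d' (S : measurableType d') (mu : probability S R).
Local Open Scope ereal_scope.

Lemma measurable_mktuple k (X : 'I_k -> T -> S) :
  (forall i, measurable_fun [set: T] (X i)) ->
  measurable_fun [set: T] (fun w => [tuple X i w | i < k]).
Proof.
move=> mX; apply/measurable_fun_tnthP => i.
rewrite (_ : _ \o _ = X i)//.
by apply/funext => w /=; rewrite tnth_mktuple.
Qed.

Lemma measure_powm0 (B : set (0.-tuple S)) : powm mu 0 B = (\1_B [tuple])%:E.
Proof. by []. Qed.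

(** The event E carries the conditions on the coordinates that the induction
    has already removed. *)
Lemma law_powm k (X : 'I_k -> T -> S) (E : set T) : measurable E ->
  (forall i, measurable_fun [set: T] (X i)) ->
  (forall B : 'I_k -> set S, (forall i, measurable (B i)) ->
     P (E `&` [set w | forall i, B i (X i w)]) = P E * \prod_(i < k) mu (B i)) ->
  forall B, measurable B ->
    P (E `&` (fun w => [tuple X i w | i < k]) @^-1` B) = P E * powm mu k B.
Proof.
elim: k => [|k IH] in X E * => mE mX HX B mB.
  have E0 w : [tuple X i w | i < 0] = [tuple] by exact: tuple0.
  rewrite measure_powm0 indicE; have [tB|tB] := boolP (_ \in B).
    rewrite mule1 (_ : _ @^-1` _ = setT) ?setIT//.
    by apply/seteqP; split => // w _; rewrite /= E0; exact: set_mem.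
  rewrite mule0 (_ : _ @^-1` _ = set0) ?setI0 ?measure0//.
  by apply/seteqP; split => // w /=; rewrite E0 => /mem_set; rewrite (negbTE tB).
have mtl := measurable_mktuple (fun i => mX (lift ord0 i)).
pose Y w := (X ord0 w, [tuple X (lift ord0 i) w | i < k]).
have mY : measurable_fun [set: T] Y by exact: measurable_fun_pair.
have XY w : [tuple X i w | i < k.+1] = consp (Y w).
  apply: eq_from_tnth => j; rewrite tnth_mktuple.
  case: (unliftP ord0 j) => [j' ->|->]; last by rewrite tnth_consp0.
  by rewrite tnth_consp_lift tnth_mktuple.
rewrite (_ : _ @^-1` B = Y @^-1` (@consp _ _ k @^-1` B)); last first.
  by apply/seteqP; split => w /=; rewrite XY.
have mC : measurable (@consp _ _ k @^-1` B).
  by rewrite -[X in measurable X]setTI; exact: measurable_consp.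
rewrite -[powm mu k.+1 B]/((mu \x powm mu k) (@consp _ _ k @^-1` B)).
move: (_ @^-1` B) mC => C mC {B mB XY}.
have HE A : measurable A -> P (E `&` X ord0 @^-1` A) = P E * mu A.
  move=> mA.
  have := HX (fun i => if i == ord0 then A else setT).
  rewrite big_ord_recl eqxx big1 ?mule1; last by move=> i _; rewrite probability_setT.
  move=> <-; last by move=> i; case: ifP.
  congr (P (_ `&` _)); apply/seteqP; split => w /= Aw.
    by move=> i; case: eqP => [->|//].
  exact: (Aw ord0).
have rect A D : measurable A -> measurable D ->
    P (E `&` Y @^-1` (A `*` D)) = P E * (mu A * powm mu k D).
  move=> mA mD.
  have mXA : measurable (X ord0 @^-1` A).
    by rewrite -[X in measurable X]setTI; exact: mX.
  rewrite muleA -HE// -(IH (fun i => X (lift ord0 i)))//.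
  - by congr (P _); apply/seteqP; split => w /=; [move=> [? []]|move=> [[? ?] ?]].
  - exact: measurableI.
  - move=> B mB.
    rewrite HE// -muleA.
    have := HX (fun i => if unlift ord0 i is Some j then B j else A).
    rewrite big_ord_recl unlift_none.
    under eq_bigr do rewrite liftK.
    move=> <-; last by move=> i; case: unliftP.
    congr (P _); apply/seteqP; split => w /=.
      move=> [[Ew Aw] Bw]; split => // i.
      by case: unliftP => [j|] ->.
    move=> [Ew Hw]; split; [split => //|move=> i].
      by have := Hw ord0; rewrite unlift_none.
    by have := Hw (lift ord0 i); rewrite liftK.
have [PE0|PE0] := eqVneq (P E) 0.
  rewrite PE0 mul0e; apply/eqP; rewrite -measure_le0 -PE0.
  have mYC : measurable (Y @^-1` C) by rewrite -[X in measurable X]setTI; exact: mY.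
  by apply: le_measure; rewrite ?inE//; exact: measurableI.
have fP : P E \is a fin_num by rewrite fin_num_measure.
have c0 : (0 <= (fine (P E))^-1)%R by rewrite invr_ge0 fine_ge0.
have cN0 : (fine (P E) != 0)%R.
  by apply: contra PE0 => /eqP cE; rewrite -(fineK fP) cE.
pose Q : {measure set T -> \bar R} := mrestr P mE.
pose nu' : {measure set (S * k.-tuple S)%type -> \bar R} :=
  mscale (NngNum c0) (pushforward Q Y).
pose nu := nu' mY.
have nuE D : nu D = (fine (P E))^-1%:E * P (E `&` Y @^-1` D).
  by rewrite /nu /nu' /mscale/= /pushforward /Q /mrestr setIC.
rewrite (@product_measure_unique _ _ _ _ _ mu (powm mu k) nu)//; last first.
  move=> A D mA mD; rewrite nuE rect// muleA -{2}(fineK fP) -EFinM mulVf// mul1e.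
  by [].
by rewrite nuE muleA -{1}(fineK fP) -EFinM mulfV// mul1e.
Qed.
End law_of_independent_family.

Section gaussian_family.
Context (R : realType) (I : finType).
Local Open Scope ereal_scope.

Definition gvec : probability (#|I|.-tuple (measurableTypeR R)) R :=
  powm (gauss R) #|I|.

Context d (T : measurableType d) (P : probability T R).
Variable X : I -> {RV P >-> R}.
Hypothesis indX : mutually_independent X.
Hypothesis normX : forall i, has_normal_law (X i) 0 1.

Definition sample (w : T) : #|I|.-tuple (measurableTypeR R) :=
  [tuple X (enum_val k) w | k < #|I|].

Lemma measurable_sample : measurable_fun [set: T] sample.
Proof.
apply: measurable_mktuple => k.
exact: (@measurable_funPT _ _ _ _ (X (enum_val k))).
Qed.

Lemma gvec_law (F : #|I|.-tuple (measurableTypeR R) -> \bar R) :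
  measurable_fun [set: #|I|.-tuple (measurableTypeR R)] F -> (forall t, 0 <= F t) ->
  \int[P]_w F (sample w) = \int[gvec]_t F t.
Proof.
move=> mF F0.
have law B : measurable B -> P (sample @^-1` B) = gvec B.
  move=> mB.
  pose Z (k : 'I_#|I|) : T -> measurableTypeR R := X (enum_val k).
  have mZ k : measurable_fun [set: T] (Z k) by exact: (@measurable_funPT _ _ _ _ (X (enum_val k))).
  have := @law_powm _ _ _ P _ _ (gauss R) _ Z setT measurableT mZ.
  rewrite probability_setT => H.
  have : P ([set: T] `&` sample @^-1` B) = 1 * powm (gauss R) #|I| B.
    apply: H => // A mA.
    rewrite setTI mul1e.
    have := indX [set: I]%SET (fun i => mA (enum_rank i)).
    rewrite (_ : \bigcap_(i in _) _ = [set w | forall k, A k (Z k w)]).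
      move=> ->; rewrite (reindex _ (onW_bij _ (@enum_val_bij I)))/=.
      apply: eq_big => [k|k _]; first by rewrite inE.
      by rewrite enum_valK; exact: (normX (enum_val k) (mA k)).
    apply/seteqP; split => w /= HA k.
      by have := HA (enum_val k); rewrite enum_valK; apply; rewrite /= inE.
    by move=> _; have := HA (enum_rank k); rewrite /Z enum_rankK.
  by rewrite setTI mul1e.
rewrite -[LHS](@ge0_integral_pushforward _ _ _ _ _ _ measurable_sample P setT)//.
apply: eq_measure_integral; first exact: measurable_sample. move=> mm B mB _; exact: law.
Qed.

End gaussian_family.

(** A Lipschitz function is the infimum of the countably many cones of the
    same slope with apex on its graph over a rational point. *)
Lemma measurable_lipschitz (R : realType) k (f : k.-tuple (measurableTypeR R) -> R) (L : R) :
  0 <= L ->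
  (forall s t, `|f s - f t| <= L * \sum_(i < k) `|tnth s i - tnth t i|) ->
  measurable_fun [set: k.-tuple (measurableTypeR R)] f.
Proof.
move=> L0 fL.
pose q m : k.-tuple (measurableTypeR R) := [tuple
   ratr (tnth (odflt [tuple 0 | _ < k] (unpickle m : option (k.-tuple rat))) i) | i < k].
pose g m t := f (q m) + L * \sum_(i < k) `|tnth t i - tnth (q m) i|.
have mg m : measurable_fun [set: k.-tuple (measurableTypeR R)] (g m).
  apply: measurable_funD => //; apply: measurable_funM => //.
  apply: measurable_sum => i; apply: measurableT_comp => //.
  by apply: measurable_funB => //; exact: measurable_tnth.
have fg m t : f t <= g m t.
  by have := fL t (q m); rewrite ler_norml => /andP[_]; rewrite lerBlDl.
have gf t (e : R) : 0 < e -> exists m, g m t < f t + e.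
  move=> e0.
  have L2 : 0 < 2 * (L + 1) * k.+1%:R :> R by rewrite !mulr_gt0 ?ltr0n//; lra.
  pose r := e / (2 * (L + 1) * k.+1%:R).
  have r0 : 0 < r by rewrite divr_gt0.
  have A i : exists p : rat, `|tnth t i - ratr p| < r.
    have /rat_in_itvoo[p] : (tnth t i - r < tnth t i + r) by lra.
    rewrite in_itv/= => /andP[p1 p2]; exists p.
    by rewrite ltr_norml; apply/andP; split; lra.
  have [p' p'P] := choice A.
  pose p : k.-tuple rat := [tuple p' i | i < k].
  exists (pickle p).
  have qE i : tnth (q (pickle p)) i = ratr (p' i).
    by rewrite tnth_mktuple pickleK/= tnth_mktuple.
  have S : \sum_(i < k) `|tnth t i - tnth (q (pickle p)) i| <= k%:R * r.
    apply: (@le_trans _ _ (\sum_(i < k) r)).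
      by apply: ler_sum => i _; rewrite qE ltW.
    by rewrite sumr_const card_ord mulr_natl.
  have fq : f (q (pickle p)) <= f t + L * \sum_(i < k) `|tnth t i - tnth (q (pickle p)) i|.
    have := fL t (q (pickle p)); rewrite ler_norml => /andP[+ _].
    lra.
  have H : L * \sum_(i < k) `|tnth t i - tnth (q (pickle p)) i| <= L * (k%:R * r).
    exact: ler_wpM2l.
  have rE : 2 * (L * (k%:R * r)) < e.
    rewrite /r; have k0 : 0 <= k%:R :> R by [].
    rewrite -[ltRHS](@divfK _ (2 * (L + 1) * k.+1%:R))//; last by rewrite gt_eqF.
    rewrite -/r [ltRHS]mulrC -natr1.
    have -> : 2 * (L * (k%:R * r)) = 2 * L * k%:R * r by ring.
    by rewrite ltr_pM2r//; nra.
  rewrite /g; lra.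
rewrite (_ : f = fun t => infs (g ^~ t) 0); last first.
  apply/funext => t; apply/eqP; rewrite eq_le; apply/andP; split.
    apply: lb_le_inf; first by exists (g 0%N t), 0%N.
    by move=> _ [m _ <-]; exact: fg.
  apply/ler_addgt0Pr => e e0; have [m gm] := gf t e e0.
  apply: le_trans (ltW gm); apply: ge_inf; last by exists m.
  by exists (f t) => _ [j _ <-]; exact: fg.
apply: measurable_fun_infs => // t _.
by exists (f t) => _ [j _ <-]; exact: fg.
Qed.

(** * The regularised game *)

Section bilinear.
Context (R : realType).

Definition dot n (u v : 'cV[R]_n) : R := \sum_i u i 0 * v i 0.

Lemma payoffE2 n m (A : 'M[R]_(n, m)) x y :
  payoff A x y = \sum_i \sum_j x i 0 * A i j * y j 0.
Proof.
rewrite payoffE exchange_big/=; apply: eq_bigr => j _.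
by rewrite mxE mulr_suml; apply: eq_bigr => i _; rewrite mxE.
Qed.

Lemma payoffDl n m (A : 'M[R]_(n, m)) x x' y :
  payoff A (x + x') y = payoff A x y + payoff A x' y.
Proof. by rewrite /payoff linearD/= !mulmxDl mxE. Qed.

Lemma payoffDr n m (A : 'M[R]_(n, m)) x y y' :
  payoff A x (y + y') = payoff A x y + payoff A x y'.
Proof. by rewrite /payoff mulmxDr mxE. Qed.

Lemma payoffZl n m (A : 'M[R]_(n, m)) a x y : payoff A (a *: x) y = a * payoff A x y.
Proof. by rewrite /payoff linearZ/= -!scalemxAl mxE. Qed.

Lemma payoffZr n m (A : 'M[R]_(n, m)) a x y : payoff A x (a *: y) = a * payoff A x y.
Proof. by rewrite /payoff -scalemxAr mxE. Qed.

Lemma payoffNl n m (A : 'M[R]_(n, m)) x y : payoff A (- x) y = - payoff A x y.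
Proof. by rewrite -scaleN1r payoffZl mulN1r. Qed.

Lemma payoffNr n m (A : 'M[R]_(n, m)) x y : payoff A x (- y) = - payoff A x y.
Proof. by rewrite -scaleN1r payoffZr mulN1r. Qed.

Lemma payoffDm n m (A D : 'M[R]_(n, m)) x y :
  payoff (A + D) x y = payoff A x y + payoff D x y.
Proof. by rewrite /payoff mulmxDr mulmxDl mxE. Qed.

Lemma payoffNm n m (A : 'M[R]_(n, m)) x y : payoff (- A) x y = - payoff A x y.
Proof. by rewrite /payoff mulmxN mulNmx mxE. Qed.

Lemma payoff_tr n m (A : 'M[R]_(n, m)) x y : payoff A^T y x = payoff A x y.
Proof.
rewrite !payoffE2 exchange_big/=; apply: eq_bigr => i _; apply: eq_bigr => j _.
by rewrite mxE; ring.
Qed.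

Lemma dotC n (u v : 'cV[R]_n) : dot u v = dot v u.
Proof. by apply: eq_bigr => i _; rewrite mulrC. Qed.

Lemma dotDl n (u u' v : 'cV[R]_n) : dot (u + u') v = dot u v + dot u' v.
Proof. by rewrite -big_split; apply: eq_bigr => i _; rewrite mxE mulrDl. Qed.

Lemma dotZl n a (u v : 'cV[R]_n) : dot (a *: u) v = a * dot u v.
Proof. by rewrite mulr_sumr; apply: eq_bigr => i _; rewrite mxE mulrA. Qed.

Lemma dotNl n (u v : 'cV[R]_n) : dot (- u) v = - dot u v.
Proof. by rewrite -scaleN1r dotZl mulN1r. Qed.

Lemma dotDr n (u v v' : 'cV[R]_n) : dot u (v + v') = dot u v + dot u v'.
Proof. by rewrite dotC dotDl !(dotC _ u). Qed.

Lemma dotZr n a (u v : 'cV[R]_n) : dot u (a *: v) = a * dot u v.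
Proof. by rewrite dotC dotZl (dotC _ u). Qed.

Lemma dotNr n (u v : 'cV[R]_n) : dot u (- v) = - dot u v.
Proof. by rewrite dotC dotNl (dotC _ u). Qed.

Lemma dot_ge0 n (u : 'cV[R]_n) : 0 <= dot u u.
Proof. by apply: sumr_ge0 => i _; rewrite -expr2 sqr_ge0. Qed.

Lemma coord_sq_le n (u : 'cV[R]_n) i : u i 0 ^+ 2 <= dot u u.
Proof.
rewrite /dot (bigD1 i)//= -expr2 lerDl.
by apply: sumr_ge0 => j _; rewrite -expr2 sqr_ge0.
Qed.

Definition mxnorm1 n m (D : 'M[R]_(n, m)) : R := \sum_i \sum_j `|D i j|.

Lemma mxnorm1_ge0 n m (D : 'M[R]_(n, m)) : 0 <= mxnorm1 D.
Proof. by do 2 (apply: sumr_ge0 => ? _). Qed.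

Lemma payoff_bound n m (D : 'M[R]_(n, m)) (x : 'cV[R]_n) (y : 'cV[R]_m) (a b : R) : 0 <= a ->
  (forall i, `|x i 0| <= a) -> (forall j, `|y j 0| <= b) ->
  `|payoff D x y| <= mxnorm1 D * (a * b).
Proof.
move=> a0 xa yb; rewrite payoffE2 mulr_suml; apply: le_trans (ler_norm_sum _ _ _) _.
apply: ler_sum => i _; rewrite mulr_suml; apply: le_trans (ler_norm_sum _ _ _) _.
apply: ler_sum => j _; rewrite !normrM mulrAC mulrC.
by apply: ler_wpM2l => //; apply: ler_pM.
Qed.

(** Weighted arithmetic-geometric mean bound for a bilinear form. *)
Lemma payoff_young n m (A : 'M[R]_(n, m)) (x : 'cV[R]_n) : exists2 K : R, 0 <= K &
  forall (z : 'cV[R]_m) (t : R), 0 < t -> 2 * payoff A x z <= K * t + dot z z / t.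
Proof.
pose c j := (x^T *m A) 0 j.
exists (\sum_j c j ^+ 2) => [|z t t0]; first by apply: sumr_ge0 => j _; rewrite sqr_ge0.
rewrite payoffE mulr_sumr !mulr_suml -big_split; apply: ler_sum => j _ /=.
rewrite -/(c j) -subr_ge0.
rewrite (_ : _ - _ = (c j * t - z j 0) ^+ 2 / t).
  by rewrite divr_ge0 ?sqr_ge0 ?ltW.
by field; rewrite gt_eqF.
Qed.

Lemma simplex_le1 n (x : 'cV[R]_n) i : simplex n x -> x i 0 <= 1.
Proof.
move=> [x0 <-]; rewrite (bigD1 i)//= lerDl; exact: sumr_ge0.
Qed.

Lemma simplex_norm_le1 n (x : 'cV[R]_n) i : simplex n x -> `|x i 0| <= 1.
Proof. by move=> sx; rewrite ger0_norm ?simplex_le1//; case: sx. Qed.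

Lemma simplex_dot n (x y : 'cV[R]_n) : simplex n x -> simplex n y -> 0 <= dot x y <= 1.
Proof.
move=> sx sy; have [x0 x1] := sx; have [y0 _] := sy.
apply/andP; split; first by apply: sumr_ge0 => i _; exact: mulr_ge0.
rewrite -x1; apply: ler_sum => i _; rewrite ler_piMr//; exact: simplex_le1.
Qed.

Lemma simplex_segment n (x x' : 'cV[R]_n) t : simplex n x -> simplex n x' ->
  0 <= t <= 1 -> simplex n (x + t *: (x' - x)).
Proof.
move=> [x0 x1] [x0' x1'] /andP[t0 t1]; split=> [i|].
  rewrite !mxE (_ : _ + _ = (1 - t) * x i 0 + t * x' i 0); last by ring.
  by rewrite addr_ge0// mulr_ge0// subr_ge0.
under eq_bigr do rewrite !mxE.
by rewrite big_split/= -mulr_sumr big_split/= sumrN x1 x1' subrr mulr0 addr0.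
Qed.

(** Extracts first-order conditions from inequalities along segments. *)
Lemma le0_of_small (a b : R) : (forall t, 0 < t <= 1 -> a <= t * b) -> a <= 0.
Proof.
move=> H; rewrite leNgt; apply/negP => a0.
have b0 : 0 < b.
  have := H 1; rewrite ltr01 lexx mul1r => /(_ isT); exact: lt_le_trans.
have := H (Num.min 1 (a / (2 * b))).
have r0 : 0 < a / (2 * b) by rewrite divr_gt0// mulr_gt0.
rewrite lt_min ltr01 r0 ge_min lexx/= => /(_ isT).
apply/negP; rewrite -ltNge (@le_lt_trans _ _ (a / (2 * b) * b))//.
  by rewrite ler_pM2r// ge_min lexx orbT.
rewrite (_ : _ * b = a / 2); last by field; rewrite gt_eqF.
lra.
Qed.

End bilinear.

Section saddle_existence.
Context (R : realType) (n m : nat).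
Implicit Types (A D : 'M[R]_(n, m)) (x : 'cV[R]_n) (y : 'cV[R]_m).

(** First-order optimality conditions for the game with payoff
    x^T A y + (e/2)|x|^2 - (e/2)|y|^2, where x minimises and y maximises. *)
Definition saddle (e : R) A x y := [/\ simplex n x, simplex m y,
  forall x', simplex n x' -> 0 <= payoff A (x' - x) y + e * dot (x' - x) x &
  forall y', simplex m y' -> payoff A x (y' - y) - e * dot (y' - y) y <= 0].

Lemma cvg_of_dist_le (T : topologicalType) (f B : T -> R) (u : T) :
  (forall v, `|f u - f v| <= B v) -> B v @[v --> u] --> 0 -> f v @[v --> u] --> f u.
Proof.
move=> fB B0; apply/cvgrPdist_le => r r0; move/cvgrPdist_le : B0 => /(_ r r0) B0.
near=> v; apply: le_trans (fB v) _; apply: le_trans (ler_norm _) _.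
by rewrite -normrN -sub0r; near: v.
Unshelve. all: by end_near. Qed.

Lemma continuous_coordT k (i : 'I_k) : continuous (fun u : 'rV[R]_k => u^T i 0).
Proof. by under eq_fun do rewrite mxE; exact: coord_continuous. Qed.

Lemma continuous_addR (T : topologicalType) (f g : T -> R) :
  continuous f -> continuous g -> continuous (fun t => f t + g t).
Proof. by move=> cf cg t; apply: (@continuousD _ R^o); [exact: cf|exact: cg]. Qed.

Lemma continuous_subR (T : topologicalType) (f g : T -> R) :
  continuous f -> continuous g -> continuous (fun t => f t - g t).
Proof. by move=> cf cg t; apply: (@continuousB _ R^o); [exact: cf|exact: cg]. Qed.

Lemma continuous_bigsum (T : topologicalType) (I : Type) (s : seq I) (f : I -> T -> R) :
  (forall i, continuous (f i)) -> continuous (fun t => \sum_(i <- s) f i t).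
Proof.
move=> cf; elim: s => [|i s IHs] t.
  under eq_fun do rewrite big_nil; exact: cvg_cst.
under eq_fun do rewrite big_cons.
by apply: (@continuousD _ R^o); [exact: cf|exact: IHs].
Qed.

Lemma continuous_dotT k : continuous (fun u : 'rV[R]_k => dot u^T u^T).
Proof.
apply: continuous_bigsum => i u.
by apply: continuousM; exact: continuous_coordT.
Qed.

Lemma continuous_scaled_dotT k (a : R) :
  continuous (fun u : 'rV[R]_k => a * dot u^T u^T).
Proof.
move=> u; apply: (@continuousM _ _ (cst a) (fun u : 'rV[R]_k => dot u^T u^T)).
  exact: cst_continuous.
exact: continuous_dotT.
Qed.

Lemma continuous_payoffT A x : continuous (fun v : 'rV[R]_m => payoff A x v^T).
Proof.
under eq_fun do rewrite payoffE; apply: continuous_bigsum => j v.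
apply: continuousM; [exact: cst_continuous|exact: continuous_coordT].
Qed.

Variable e : R.
Hypothesis e0 : 0 < e.
Hypotheses (n0 : (0 < n)%N) (m0 : (0 < m)%N).

Let q A x y := payoff A x y - e / 2 * dot y y.

Lemma simplex_min k (f : 'cV[R]_k -> R) : (0 < k)%N ->
  continuous (fun u : 'rV[R]_k => f u^T) ->
  exists2 x : 'cV[R]_k, simplex k x & forall x' : 'cV[R]_k, simplex k x' -> f x <= f x'.
Proof.
move=> k0 cf; have sn0 : [set u : 'rV[R]_k | simplex k u^T] !=set0.
  exists (delta_mx (Ordinal k0) 0)^T; rewrite /= trmxK; exact: simplex_delta.
have [u] := EVT_min_rV sn0 (@compact_simplex R k) (continuous_subspaceT cf).
rewrite inE => su umin; exists u^T => // x' sx'.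
by have := umin x'^T; rewrite inE /= trmxK; apply.
Qed.

Let bestY A x : exists2 y, simplex m y & forall y', simplex m y' -> q A x y' <= q A x y.
Proof.
have [|y sy ymin] := @simplex_min m (fun y => e / 2 * dot y y - payoff A x y) m0.
  exact: (continuous_subR (@continuous_scaled_dotT _ _) (@continuous_payoffT A x)).
by exists y => // y' /ymin; rewrite /q; lra.
Qed.

Let Y A x : 'cV[R]_m := projT1 (cid2 (bestY A x)).

Let Y_simplex A x : simplex m (Y A x).
Proof. by rewrite /Y; case: cid2. Qed.

Let Y_max A x y' : simplex m y' -> q A x y' <= q A x (Y A x).
Proof. by rewrite /Y; case: cid2 => y /= _; apply. Qed.

(* First-order condition at the maximiser: compare it with the points of the
   segment that leads to y'. *)
Let Y_VI A x y' : simplex m y' ->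
  payoff A x (y' - Y A x) - e * dot (y' - Y A x) (Y A x) <= 0.
Proof.
move=> sy'; set y := Y A x; have [z zE] : exists z, y' - y = z by exists (y' - y).
rewrite zE.
apply: (@le0_of_small _ _ (e / 2 * dot z z)) => t /andP[t0 t1].
have t01 : 0 <= t <= 1 by rewrite ltW.
have := Y_max A x (simplex_segment (Y_simplex A x) sy' t01).
rewrite -/y zE /q payoffDr payoffZr !(dotDl, dotDr, dotZl, dotZr) (dotC y z).
set p := payoff A x z; set a := dot z y; set b := dot z z => H.
have : t * (p - e * a) <= t * (t * (e / 2 * b)) by lra.
by rewrite ler_pM2l.
Qed.

Let psi A x := q A x (Y A x).

Let psi_lip A x x' : psi A x' - psi A x <= \sum_i `|(x' - x) i 0| * mxnorm1 A.
Proof.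
have := Y_max A x (Y_simplex A x'); rewrite /psi /q; set y := Y A x' => H.
have E : payoff A x' y = payoff A x y + payoff A (x' - x) y.
  by rewrite -payoffDl addrC subrK.
have : payoff A (x' - x) y <= mxnorm1 A * (\sum_i `|(x' - x) i 0| * 1).
  apply: le_trans (ler_norm _) _; rewrite -mulr_suml; apply: payoff_bound.
  - exact: sumr_ge0.
  - by move=> i; rewrite (bigD1 i)//= lerDl; exact: sumr_ge0.
  - by move=> j; apply: simplex_norm_le1; exact: Y_simplex.
under eq_bigr do rewrite mulr1.
by rewrite -mulr_suml [_ * mxnorm1 A]mulrC; lra.
Qed.

Let continuous_psi A : continuous (fun u : 'rV[R]_n => psi A u^T).
Proof.
move=> u; pose B v := \sum_i `|(v - u)^T i 0| * mxnorm1 A.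
have cB : B v @[v --> u] --> (0 : R).
  rewrite [X in _ --> X](_ : _ = B u); last first.
    by rewrite /B subrr big1// => i _; rewrite !mxE normr0 mul0r.
  apply: (@continuous_bigsum _ _ _ (fun i (v : 'rV[R]_n) => `|(v - u)^T i 0| * mxnorm1 A)).
  move=> i v; apply: (@continuousM _ _ (fun v : 'rV[R]_n => `|(v - u)^T i 0|)
    (cst (mxnorm1 A))); last exact: cst_continuous.
  apply: (@continuous_comp _ _ _ (fun v : 'rV[R]_n => (v - u)^T i 0) (fun r : R => `|r|)).
    rewrite (_ : (fun _ => _) = (fun v : 'rV[R]_n => v^T i 0 - u^T i 0)); last first.
      by apply/funext => w; rewrite !mxE.
    exact: (continuous_subR (@continuous_coordT _ i) (@cst_continuous _ _ (u^T i 0))).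
  exact: norm_continuous.
apply: (cvg_of_dist_le _ cB) => v; rewrite ler_norml; apply/andP; split.
  rewrite lerNl opprB; apply: le_trans (psi_lip _ _ _) _.
  by rewrite -linearB.
apply: le_trans (psi_lip _ _ _) _; rewrite -linearB/= -opprB.
by under eq_bigr do rewrite linearN mxE normrN.
Qed.

(** x minimises psi x + (e/2)|x|^2, where psi x is the value of the best reply,
    and y is the best reply to x. For the first-order condition at x, replace x
    by x + t z: as the problem of the second player is strongly concave, the
    best reply moves by O(t), so the increment of psi is t * payoff A z y up to
    O(t^2). *)
Lemma saddle_exists A : exists x y, saddle e A x y.
Proof.
have [|x sx xmin] := @simplex_min n (fun x => psi A x + e / 2 * dot x x) n0.
  exact: (continuous_addR (@continuous_psi A) (@continuous_scaled_dotT _ _)).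
exists x, (Y A x); split => //; last exact: Y_VI.
move=> x' sx'; set y := Y A x; have [z zE] : exists z, x' - x = z by exists (x' - x).
rewrite zE.
have [K K0 HK] := payoff_young A z.
rewrite -oppr_le0.
apply: (@le0_of_small _ _ (K / e + e / 2 * dot z z)) => t /andP[t0 t1].
have t01 : 0 <= t <= 1 by rewrite ltW.
have := xmin _ (simplex_segment sx sx' t01).
rewrite zE; set xt := x + t *: z; set yt := Y A xt => Hmin.
have H1 : q A x yt <= psi A x by apply: Y_max; exact: Y_simplex.
have E1 : psi A xt = q A x yt + t * payoff A z yt.
  by rewrite /psi -/yt /q {1}/xt payoffDl payoffZl; ring.
have E2 : dot xt xt = dot x x + 2 * t * dot z x + t ^+ 2 * dot z z.
  by rewrite /xt !(dotDl, dotDr, dotZl, dotZr) (dotC x z); ring.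
have E3 : payoff A z yt = payoff A z y + payoff A z (yt - y).
  by rewrite -payoffDr addrC subrK.
set s := payoff A z (yt - y) in E3.
have mono : e * dot (yt - y) (yt - y) <= t * s.
  have V1 := @Y_VI A x yt (Y_simplex A xt).
  have V2 := @Y_VI A xt y (Y_simplex A x).
  rewrite -/y in V1; rewrite -/yt in V2.
  have X1 : payoff A xt (y - yt) = - payoff A x (yt - y) - t * s.
    by rewrite -opprB payoffNr /xt payoffDl payoffZl -/s; ring.
  rewrite X1 in V2.
  have X2 : dot (yt - y) (yt - y) = dot (yt - y) yt - dot (yt - y) y.
    by rewrite dotDr dotNr.
  have X3 : dot (y - yt) yt = - dot (yt - y) yt by rewrite -dotNl opprB.
  rewrite X2; rewrite X3 in V2; nra.
have sK : s <= K * t / e.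
  have := HK (yt - y) (t / e) (divr_gt0 t0 e0); rewrite -/s invf_div.
  have : dot (yt - y) (yt - y) * (e / t) <= s.
    rewrite mulrA ler_pdivrMr// mulrC; apply: le_trans mono _; lra.
  rewrite mulrA => ? ?; rewrite -(mulrA K); lra.
set b := dot z z in E2 *; set a := dot z x in E2 *.
set p := payoff A z y in E3 *.
have H2 : 0 <= t * (p + s) + e / 2 * (2 * t * a + t ^+ 2 * b).
  rewrite -E3; move: Hmin; rewrite E1 E2; lra.
have H3 : t * 0 <= t * (p + s + e * a + t * (e / 2 * b)).
  by rewrite mulr0; apply: le_trans H2 _; rewrite le_eqVlt; apply/orP; left; apply/eqP; field.
rewrite ler_pM2l// in H3.
have -> : t * (K / e + e / 2 * b) = K * t / e + t * (e / 2 * b) by ring.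
lra.
Qed.

End saddle_existence.

Section saddle_theory.
Context (R : realType) (n m : nat) (e : R).
Hypothesis e0 : 0 < e.
Hypotheses (n0 : (0 < n)%N) (m0 : (0 < m)%N).
Implicit Types (A D : 'M[R]_(n, m)) (x : 'cV[R]_n) (y : 'cV[R]_m).

Definition reg_value A x y := payoff A x y + e / 2 * dot x x - e / 2 * dot y y.

(** Test the four first-order conditions of the two saddle points against each
    other and add them: all terms in A cancel, and the regularisation leaves
    e (|u|^2 + |v|^2) on one side, with u and v the displacements. *)
Lemma saddle_stable A D x y x' y' :
  saddle e A x y -> saddle e (A + D) x' y' ->
  (forall i, `|(x' - x) i 0| <= 2 * mxnorm1 D / e) /\
  (forall j, `|(y' - y) j 0| <= 2 * mxnorm1 D / e).
Proof.
move=> [sx sy Hx Hy] [sx' sy' Hx' Hy'].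
have [u uE] : exists u, x' - x = u by exists (x' - x).
have [v vE] : exists v, y' - y = v by exists (y' - y).
have x'E : x' = x + u by rewrite -uE addrC subrK.
have y'E : y' = y + v by rewrite -vE addrC subrK.
have uE' : x - x' = - u by rewrite -uE opprB.
have vE' : y - y' = - v by rewrite -vE opprB.
have I1 := Hx _ sx'; have I2 := Hx' _ sx; have I3 := Hy _ sy'; have I4 := Hy' _ sy.
rewrite uE in I1; rewrite uE' in I2; rewrite vE in I3; rewrite vE' in I4.
rewrite uE vE.
set r := Num.sqrt (dot u u + dot v v).
have r0 : 0 <= r by exact: sqrtr_ge0.
have r2 : r ^+ 2 = dot u u + dot v v by rewrite sqr_sqrtr// addr_ge0// dot_ge0.
have ur i : `|u i 0| <= r.
  rewrite -ler_sqr ?nnegrE// r2 real_normK ?num_real//.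
  by apply: le_trans (coord_sq_le u i) _; rewrite lerDl dot_ge0.
have vr j : `|v j 0| <= r.
  rewrite -ler_sqr ?nnegrE// r2 real_normK ?num_real//.
  by apply: le_trans (coord_sq_le v j) _; rewrite lerDr dot_ge0.
have B1 : `|payoff D u y'| <= mxnorm1 D * (r * 1).
  by apply: payoff_bound => // j; exact: simplex_norm_le1.
have B2 : `|payoff D x' v| <= mxnorm1 D * (1 * r).
  by apply: payoff_bound => // i; exact: simplex_norm_le1.
have key : e * r ^+ 2 <= 2 * mxnorm1 D * r.
  move: B1 B2; rewrite !ler_norml => /andP[B1 _] /andP[_ B2].
  rewrite !payoffDm in I2 I4.
  rewrite payoffNl payoffNl dotNl in I2; rewrite payoffNr payoffNr dotNl in I4.
  have E1 : payoff A u y' = payoff A u y + payoff A u v by rewrite y'E payoffDr.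
  have E2 : payoff A x' v = payoff A x v + payoff A u v by rewrite x'E payoffDl.
  have E3 : dot u x' = dot u x + dot u u by rewrite x'E dotDr.
  have E4 : dot v y' = dot v y + dot v v by rewrite y'E dotDr.
  rewrite E1 E3 in I2; rewrite E2 E4 in I4; rewrite r2; lra.
have rle : r <= 2 * mxnorm1 D / e.
  rewrite ler_pdivlMr// mulrC.
  have [r_0|r_gt0] := leP r 0.
    have -> : r = 0 by apply/eqP; rewrite eq_le r_0.
    by rewrite mulr0 mulr_ge0// mxnorm1_ge0.
  by rewrite -(ler_pM2r r_gt0) -mulrA -expr2.
by split=> [i|j]; [exact: le_trans (ur i) _|exact: le_trans (vr j) _].
Qed.

Lemma saddle_unique A x y x' y' : saddle e A x y -> saddle e A x' y' ->
  x' = x /\ y' = y.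
Proof.
move=> s s'; have := @saddle_stable A 0 x y x' y' s.
rewrite addr0 => /(_ s') [].
have -> : mxnorm1 (0 : 'M[R]_(n, m)) = 0.
  by rewrite /mxnorm1 big1// => i _; rewrite big1// => j _; rewrite mxE normr0.
rewrite mulr0 mul0r => Hx Hy; split.
  apply/colP => i; apply/eqP; rewrite -subr_eq0 -normr_le0.
  by have := Hx i; rewrite !mxE.
apply/colP => i; apply/eqP; rewrite -subr_eq0 -normr_le0.
by have := Hy i; rewrite !mxE.
Qed.

Lemma saddle_reg_minx A x y x' : saddle e A x y -> simplex n x' ->
  reg_value A x y <= reg_value A x' y.
Proof.
move=> [sx sy Hx _] sx'.
have [u uE] : exists u, x' - x = u by exists (x' - x).
have x'E : x' = x + u by rewrite -uE addrC subrK.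
have := Hx _ sx'; rewrite uE /reg_value x'E payoffDl !(dotDl, dotDr) (dotC x u).
have : 0 <= e / 2 * dot u u by rewrite mulr_ge0 ?dot_ge0// divr_ge0 ?ltW.
lra.
Qed.

Lemma saddle_reg_maxy A x y y' : saddle e A x y -> simplex m y' ->
  reg_value A x y' <= reg_value A x y.
Proof.
move=> [sx sy _ Hy] sy'.
have [v vE] : exists v, y' - y = v by exists (y' - y).
have y'E : y' = y + v by rewrite -vE addrC subrK.
have := Hy _ sy'; rewrite vE /reg_value y'E payoffDr !(dotDl, dotDr) (dotC y v).
have : 0 <= e / 2 * dot v v by rewrite mulr_ge0 ?dot_ge0// divr_ge0 ?ltW.
lra.
Qed.

(** Both saddle points are compared with the mixed pair (x, y'). *)
Lemma reg_value_increment A D x y x' y' :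
  saddle e A x y -> saddle e (A + D) x' y' ->
  reg_value (A + D) x' y' - reg_value A x y <= payoff D x y'.
Proof.
move=> s s'; have [sx sy _ _] := s; have [sx' sy' _ _] := s'.
have := saddle_reg_minx s' sx; have := saddle_reg_maxy s sy'.
rewrite /reg_value !payoffDm; lra.
Qed.

(** The displacement of the saddle point, of order |D| / e, affects the
    one-sided bounds of [reg_value_increment] only to second order. *)
Lemma reg_value_diff A D x y x' y' :
  saddle e A x y -> saddle e (A + D) x' y' ->
  `|reg_value (A + D) x' y' - reg_value A x y - payoff D x y|
     <= 2 / e * mxnorm1 D ^+ 2.
Proof.
move=> s s'.
have K0 : 0 <= 2 * mxnorm1 D / e.
  by apply: divr_ge0; [rewrite mulr_ge0// mxnorm1_ge0|exact: ltW].
have [sx sy _ _] := s; have [sx' sy' _ _] := s'.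
have [Lx Ly] := saddle_stable s s'.
have H1 := reg_value_increment s s'.
have s2 : saddle e ((A + D) + (- D)) x y by rewrite addrK.
have H2 := reg_value_increment s' s2; rewrite addrK payoffNm in H2.
have B1 : `|payoff D x (y' - y)| <= mxnorm1 D * (1 * (2 * mxnorm1 D / e)).
  by apply: payoff_bound => // i; exact: simplex_norm_le1.
have B2 : `|payoff D (x' - x) y| <= mxnorm1 D * ((2 * mxnorm1 D / e) * 1).
  by apply: payoff_bound => // i; exact: simplex_norm_le1.
have E1 : payoff D x y' = payoff D x y + payoff D x (y' - y).
  by rewrite -payoffDr addrC subrK.
have E2 : payoff D x' y = payoff D x y + payoff D (x' - x) y.
  by rewrite -payoffDl addrC subrK.
have -> : 2 / e * mxnorm1 D ^+ 2 = mxnorm1 D * (2 * mxnorm1 D / e).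
  by field; rewrite gt_eqF.
rewrite mul1r in B1; rewrite mulr1 in B2.
move: B1 B2; rewrite !ler_norml => /andP[B1 B1'] /andP[B2 B2'].
by apply/andP; split; lra.
Qed.

Lemma reg_value_lipschitz A D x y x' y' :
  saddle e A x y -> saddle e (A + D) x' y' ->
  `|reg_value (A + D) x' y' - reg_value A x y| <= mxnorm1 D.
Proof.
move=> s s'; have [sx sy _ _] := s; have [sx' sy' _ _] := s'.
have H1 := reg_value_increment s s'.
have s2 : saddle e ((A + D) + (- D)) x y by rewrite addrK.
have H2 := reg_value_increment s' s2; rewrite addrK payoffNm in H2.
have B1 : `|payoff D x y'| <= mxnorm1 D * (1 * 1).
  by apply: payoff_bound => // i; exact: simplex_norm_le1.
have B2 : `|payoff D x' y| <= mxnorm1 D * (1 * 1).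
  by apply: payoff_bound => // i; exact: simplex_norm_le1.
rewrite !mulr1 in B1 B2.
move: B1 B2; rewrite !ler_norml => /andP[B1 B1'] /andP[B2 B2'].
by apply/andP; split; lra.
Qed.

Lemma saddle_payoff_ge A x y x' : saddle e A x y -> simplex n x' ->
  payoff A x y - e <= payoff A x' y.
Proof.
move=> [sx sy Hx _] sx'; have := Hx _ sx'.
rewrite payoffDl payoffNl dotDl dotNl.
have /andP[_ d1] := simplex_dot sx' sx.
have : e * dot x' x <= e by rewrite ler_piMr// ltW.
have : 0 <= e * dot x x by rewrite mulr_ge0 ?dot_ge0// ltW.
lra.
Qed.

Lemma saddle_payoff_le A x y y' : saddle e A x y -> simplex m y' ->
  payoff A x y' <= payoff A x y + e.
Proof.
move=> [sx sy _ Hy] sy'; have := Hy _ sy'.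
rewrite payoffDr payoffNr dotDl dotNl.
have /andP[_ d1] := simplex_dot sy' sy.
have : e * dot y' y <= e by rewrite ler_piMr// ltW.
have : 0 <= e * dot y y by rewrite mulr_ge0 ?dot_ge0// ltW.
lra.
Qed.

Lemma reg_value_payoff A x y : saddle e A x y ->
  `|reg_value A x y - payoff A x y| <= e / 2.
Proof.
move=> [sx sy _ _].
have /andP[a0 a1] := simplex_dot sx sx; have /andP[b0 b1] := simplex_dot sy sy.
have h : 0 <= e / 2 by rewrite divr_ge0 ?ltW.
have a2 : e / 2 * dot x x <= e / 2 by rewrite ler_piMr.
have b2 : e / 2 * dot y y <= e / 2 by rewrite ler_piMr.
have a3 : 0 <= e / 2 * dot x x by rewrite mulr_ge0.
have b3 : 0 <= e / 2 * dot y y by rewrite mulr_ge0.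
by rewrite /reg_value ler_norml; apply/andP; split; lra.
Qed.

(** Each player, by the first-order conditions, gains at most e in the original
    game by leaving the saddle point. *)
Lemma game_value_saddle A x y : saddle e A x y ->
  `|game_value A - payoff A x y| <= e.
Proof.
move=> s; have [sx sy _ _] := s.
have [z sz [-> zmin]] := game_value_minmax A n0 m0.
have [y1 sy1 [E1 M1]] := best_reply_max A x m0.
have [y2 sy2 [E2 M2]] := best_reply_max A z m0.
rewrite ler_norml; apply/andP; split.
  have := M2 _ sy; rewrite -E2; have := saddle_payoff_ge s sz; lra.
have := zmin _ sx; rewrite E1; have := saddle_payoff_le s sy1; lra.
Qed.

End saddle_theory.

Lemma saddle_opp_tr (R : realType) n m (e : R) (A : 'M[R]_(n, m)) x y :
  saddle e A x y -> saddle e (- A^T) y x.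
Proof.
move=> [sx sy Hx Hy]; split=> // z sz; rewrite payoffNm payoff_tr.
  by have := Hy _ sz; lra.
by have := Hx _ sz; lra.
Qed.

Lemma reg_value_opp_tr (R : realType) n m (e : R) (A : 'M[R]_(n, m)) x y :
  reg_value e (- A^T) y x = - reg_value e A x y.
Proof. by rewrite /reg_value payoffNm payoff_tr; ring. Qed.

(** * Perturbation of the value *)

Section game_value_perturbation.
Context (R : realType) (n m : nat).
Hypotheses (n0 : (0 < n)%N) (m0 : (0 < m)%N).
Implicit Types (A D : 'M[R]_(n, m)).

Lemma game_value_addD A D (b : R) :
  (forall x y, simplex n x -> simplex m y -> payoff D x y <= b) ->
  game_value (A + D) <= game_value A + b.
Proof.
move=> Db.
have [z sz [-> _]] := game_value_minmax A n0 m0.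
have [z' sz' [-> zmin']] := game_value_minmax (A + D) n0 m0.
apply: le_trans (zmin' _ sz) _.
have [y1 sy1 [-> _]] := best_reply_max (A + D) z m0.
have [y2 sy2 [-> M2]] := best_reply_max A z m0.
by rewrite payoffDm lerD// ?M2// Db.
Qed.

Lemma game_value_lipschitz A D :
  `|game_value (A + D) - game_value A| <= mxnorm1 D.
Proof.
have bd (B : 'M[R]_(n, m)) x y : simplex n x -> simplex m y -> payoff B x y <= mxnorm1 B.
  move=> sx sy; apply: le_trans (ler_norm _) _; rewrite -[leRHS]mulr1 -[X in _ * X]mulr1.
  by apply: payoff_bound => // i; exact: simplex_norm_le1.
have H1 := @game_value_addD A D _ (bd D).
have := @game_value_addD (A + D) (- D) _ (bd (- D)); rewrite addrK.
have -> : mxnorm1 (- D) = mxnorm1 D.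
  by apply: eq_bigr => i _; apply: eq_bigr => j _; rewrite mxE normrN.
by move=> H2; rewrite ler_norml; apply/andP; split; lra.
Qed.

Lemma payoff_const (t : R) x y : simplex n x -> simplex m y ->
  payoff (const_mx t : 'M[R]_(n, m)) x y = t.
Proof.
move=> [_ x1] [_ y1]; rewrite payoffE2.
under eq_bigr => i _.
  under eq_bigr do rewrite mxE.
  rewrite -mulr_sumr y1 mulr1; over.
by rewrite -mulr_suml x1 mul1r.
Qed.

Lemma game_value_shift A (t : R) : game_value (A + const_mx t) = game_value A + t.
Proof.
have H (B : 'M[R]_(n, m)) s : game_value (B + const_mx s) <= game_value B + s.
  by apply: game_value_addD => x y sx sy; rewrite payoff_const.
apply/eqP; rewrite eq_le H/=.
have := H (A + const_mx t) (- t).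
rewrite (_ : A + const_mx t + const_mx (- t) = A); last by apply/matrixP => i j; rewrite !mxE addrK.
lra.
Qed.

End game_value_perturbation.

(** * Gaussian exponential moments *)

Section exp_bounds.
Context (R : realType).

Lemma expR_le_inv (x : R) : x < 1 -> expR x <= (1 - x)^-1.
Proof.
move=> x1; rewrite -[x]opprK expRN opprK lef_pV2 ?posrE ?expR_gt0//; last by lra.
exact: expR_ge1Dx.
Qed.

Lemma expR_half_ge : 13 / 8 <= expR (2^-1 : R).
Proof.
have -> : (2^-1 : R) = 16%:R * (32^-1) by field.
rewrite expRM_natl; apply: (@le_trans _ _ ((1 + 32^-1) ^+ 16)); last first.
  by rewrite ler_pXn2r ?nnegrE ?expR_ge0// expR_ge1Dx.
by rewrite !exprS expr0; lra.
Qed.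

Lemma expR_2_le : expR (2 : R) <= 9.
Proof.
have -> : (2 : R) = 16%:R * (8^-1) by field.
have e8 : expR (8^-1 : R) <= 8 / 7.
  have e8 := @expR_le_inv 8^-1; apply: le_trans (e8 _) _; first by lra.
  by rewrite (_ : (1 - 8^-1)^-1 = 8 / 7 :> R)//; field.
rewrite expRM_natl; apply: (@le_trans _ _ ((8 / 7) ^+ 16)).
  by rewrite ler_pXn2r ?nnegrE ?expR_ge0//; lra.
by rewrite !exprS expr0; lra.
Qed.

Lemma expR_10_ge : 1000 <= expR (10 : R).
Proof.
have -> : (10 : R) = 10%:R * 1 by rewrite mulr1.
rewrite expRM_natl; apply: (@le_trans _ _ (2 ^+ 10)).
  by rewrite !exprS expr0; lra.
rewrite ler_pXn2r ?nnegrE ?expR_ge0//.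
by have := expR_ge1Dx (1 : R); lra.
Qed.

(** With u = e^s, after clearing denominators this is a polynomial inequality;
    its integral against the standard Gaussian law shows that the mean of
    e^(-s^+) is less than 1, as the means of e^(b s) are explicit. *)
Lemma exp_pospart_ineq (s : R) :
  200 * expR (- Num.max s 0) + (28 * expR s + 4 * expR (- s))
    <= 230 + (expR (2 * s) + expR (- (2 * s))).
Proof.
have E2 : expR (2 * s) = expR s ^+ 2 by rewrite -expRM_natl.
rewrite !expRN E2; set u := expR s.
have u0 : 0 < u by exact: expR_gt0.
have [s0|s0] := leP s 0.
  rewrite expR0 invr1.
  have u1 : u <= 1 by rewrite -expR0 ler_expR.
  rewrite -subr_ge0 (_ : _ - _ = 24 * (1 - u) + ((1 - u) ^+ 2 / u) ^+ 2).
    by rewrite addr_ge0 ?sqr_ge0// mulr_ge0// subr_ge0.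
  by field; rewrite gt_eqF.
rewrite -/u; have u1 : 1 < u by rewrite -expR0 ltr_expR.
rewrite -subr_ge0 (_ : _ - _ =
  (u - 1) * ((u - 1) * ((u - 1 - 12) ^+ 2 + 8) + 176) / u ^+ 2).
  rewrite divr_ge0 ?sqr_ge0// mulr_ge0//; first by lra.
  by rewrite addr_ge0// mulr_ge0//; [lra|rewrite addr_ge0// sqr_ge0].
by field; rewrite gt_eqF.
Qed.
End exp_bounds.

Section gaussian_exponential_moments.
Context (R : realType) (k : nat).
Local Open Scope ereal_scope.
Local Notation G := (powm (gauss R) k).

Definition lin (a : 'I_k -> R) (t : k.-tuple (measurableTypeR R)) : R :=
  (\sum_(i < k) a i * tnth t i)%R.

Lemma measurable_lin a : measurable_fun [set: k.-tuple (measurableTypeR R)] (lin a).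
Proof.
apply: measurable_sum => i; apply: measurable_funM => //.
exact: measurable_tnth.
Qed.

Lemma measurable_expR_lin (b : R) a : measurable_fun [set: k.-tuple (measurableTypeR R)]
  (fun t => (expR (b * lin a t))%:E).
Proof.
apply/measurable_EFinP; apply: measurableT_comp => //; apply: measurable_funM => //.
exact: measurable_lin.
Qed.

Lemma mgf_powm a : \int[G]_t (expR (lin a t))%:E = (expR (\sum_(i < k) a i ^+ 2 / 2))%:E.
Proof.
transitivity (\int[G]_t \prod_(i < k) (expR (a i * tnth t i))%:E).
  apply: eq_integral => t _; rewrite /lin expR_sum.
  by rewrite (big_morph EFin EFinM (erefl _)).
rewrite (integral_powm_prod (gauss R) (G := fun i s => (expR (a i * s))%:E)); last 2 first.
- move=> i; have mi : measurable_fun [set: measurableTypeR R] (fun s : R => expR (a i * s)).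
    by apply: measurableT_comp => //; exact: measurable_funM.
  exact/measurable_EFinP.
- by move=> i s; rewrite lee_fin expR_ge0.
rewrite expR_sum (big_morph EFin EFinM (erefl _)).
by apply: eq_bigr => i _; rewrite gauss_mgf.
Qed.

Lemma mgf_powm_scaled (b : R) a : (\sum_(i < k) a i ^+ 2 = 1)%R ->
  \int[G]_t (expR (b * lin a t))%:E = (expR (b ^+ 2 / 2))%:E.
Proof.
move=> a1; have := mgf_powm (fun i => b * a i)%R.
have -> : (\sum_(i < k) (b * a i) ^+ 2 / 2 = b ^+ 2 / 2)%R.
  by rewrite -mulr_suml -[in RHS](mulr1 (b ^+ 2)%R) -a1 mulr_sumr;
    under eq_bigr do rewrite exprMn.
move=> <-; apply: eq_integral => t _; congr (expR _)%:E.
by rewrite /lin mulr_sumr; apply: eq_bigr => i _; rewrite mulrA.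
Qed.

(** The linear form lin a is a standard Gaussian variable, to which
    [exp_pospart_ineq] applies. *)
Lemma exp_pospart_mean a : (\sum_(i < k) a i ^+ 2 = 1)%R ->
  \int[G]_t (expR (- Num.max (lin a t) 0))%:E <= (49 / 50)%:E.
Proof.
move=> a1.
have mE b := measurable_expR_lin b a.
have mP : measurable_fun [set: k.-tuple (measurableTypeR R)]
    (fun t => (expR (- Num.max (lin a t) 0))%:E).
  apply/measurable_EFinP; apply: measurableT_comp => //; apply: measurable_funN.
  by apply: measurable_maxr => //; exact: measurable_lin.
have E0 b t : 0 <= (expR (b * lin a t))%:E by rewrite lee_fin expR_ge0.
have P0 t : 0 <= (expR (- Num.max (lin a t) 0))%:E by rewrite lee_fin expR_ge0.
set q := \int[G]_t _.
have mZ (c : R) (f : k.-tuple (measurableTypeR R) -> \bar R) :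
    measurable_fun [set: k.-tuple (measurableTypeR R)] f ->
    measurable_fun [set: k.-tuple (measurableTypeR R)] (fun t => c%:E * f t).
  by move=> mf; exact: emeasurable_funM.
pose J b := \int[G]_t (expR (b * lin a t))%:E.
have H : 200%:E * q + (28%:E * J 1%R + 4%:E * J (- 1)%R) <=
    230%:E + (J 2%R + J (- 2)%R).
  have -> : 200%:E * q = \int[G]_t (200%:E * (expR (- Num.max (lin a t) 0))%:E).
    by rewrite ge0_integralZl.
  have -> : 28%:E * J 1%R = \int[G]_t (28%:E * (expR (1 * lin a t))%:E).
    by rewrite ge0_integralZl.
  have -> : 4%:E * J (- 1)%R = \int[G]_t (4%:E * (expR (- 1 * lin a t))%:E).
    by rewrite ge0_integralZl.
  rewrite /J -(integral_prob_cst G 230%:E).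
  have m1 := mZ 28%R _ (mE 1%R); have m2 := mZ 4%R _ (mE (- 1)%R).
  have m3 := mZ 200%R _ mP; have m4 := emeasurable_funD m1 m2.
  have m5 := emeasurable_funD (mE 2%R) (mE (- 2)%R).
  have Z0 (c : R) (f : k.-tuple (measurableTypeR R) -> \bar R) : (0 <= c)%R ->
      (forall t, 0 <= f t) -> forall t, 0 <= c%:E * f t.
    by move=> c0 f0 t; rewrite mule_ge0// lee_fin.
  have c28 : (0 <= 28 :> R)%R by []. have c4 : (0 <= 4 :> R)%R by [].
  have c200 : (0 <= 200 :> R)%R by [].
  have z1 := Z0 28%R _ c28 (E0 1%R); have z2 := Z0 4%R _ c4 (E0 (- 1)%R).
  have z3 := Z0 200%R _ c200 P0.
  rewrite -(ge0_integralD G measurableT (fun t _ => z1 t) m1 (fun t _ => z2 t) m2).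
  have z4 t := adde_ge0 (z1 t) (z2 t).
  rewrite -(ge0_integralD G measurableT (fun t _ => z3 t) m3 (fun t _ => z4 t) m4).
  rewrite -(ge0_integralD G measurableT (fun t _ => E0 2%R t) (mE 2%R)
    (fun t _ => E0 (- 2)%R t) (mE (- 2)%R)).
  have z5 t := adde_ge0 (E0 2%R t) (E0 (- 2)%R t).
  rewrite -(ge0_integralD G measurableT _ (measurable_cst _) (fun t _ => z5 t) m5); last first.
    by move=> t _; rewrite lee_fin.
  apply: ge0_le_integral => //.
  - by move=> t _; rewrite adde_ge0.
  - exact: emeasurable_funD.
  - exact: emeasurable_funD.
  - move=> t _; rewrite -!EFinM -!EFinD lee_fin mul1r mulN1r mulNr.
    exact: exp_pospart_ineq.
have JE b : J b = (expR (b ^+ 2 / 2))%:E by exact: mgf_powm_scaled.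
rewrite !JE in H.
have fq : q \is a fin_num.
  rewrite ge0_fin_numE; last exact: integral_ge0.
  rewrite ltey; apply/negP => /eqP qy; move: H; rewrite qy.
  by rewrite mulry gtr0_sg// mul1e addye// -!EFinM -!EFinD leye_eq.
move: H; rewrite -(fineK fq) -!EFinM -!EFinD !lee_fin sqrrN sqrrN !expr1n => H.
rewrite div1r in H.
rewrite (_ : 2 ^+ 2 / 2 = 2 :> R)%R in H; last by field.
have := expR_half_ge R; have := expR_2_le R; lra.
Qed.
End gaussian_exponential_moments.

(** * Gaussian matrices and their symmetries *)

Section gauss_symmetry.
Context (R : realType).
Local Open Scope ereal_scope.
Local Notation mu := (@lebesgue_measure R).

Lemma gauss_opp (f : R -> \bar R) :
  measurable_fun [set: measurableTypeR R] f -> (forall x, 0 <= f x) ->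
  \int[gauss R]_x f (- x)%R = \int[gauss R]_x f x.
Proof.
move=> mf f0; have mN : measurable_fun [set: measurableTypeR R]
    (-%R : measurableTypeR R -> measurableTypeR R) by exact: measurable_funN.
have mg := emeasurable_funM mf (@measurable_gauss_epdf R).
have g0 x : 0 <= f x * (normal_pdf 0 1 x)%:E by rewrite mule_ge0// lee_fin gauss_pdf_ge0.
rewrite !integral_gauss//; last exact: (measurableT_comp mf mN).
transitivity (\int[mu]_x ((fun x => f x * (normal_pdf 0 1 x)%:E) \o -%R) x).
  apply: eq_integral => x _ /=; congr (_ * _%:E).
  by rewrite !gauss_pdfE sqrrN.
rewrite -[LHS](@ge0_integral_pushforward _ _ _ _ _ _ mN mu setT)//.
by apply: eq_measure_integral => A mA _; exact: lebesgue_measureN.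
Qed.

Lemma gauss_preimage_sign (s : R) (B : set (measurableTypeR R)) :
  (s = 1 \/ s = - 1)%R -> measurable B ->
  gauss R [set x | B (s * x)%R] = gauss R B.
Proof.
move=> [->|->] mB; first by congr (gauss R _); apply/seteqP; split => x /=; rewrite mul1r.
have E A : measurable A -> gauss R A = \int[gauss R]_x (\1_A x)%:E.
  by move=> mA; rewrite integral_indic// setIT.
have mN : measurable_fun [set: measurableTypeR R]
    (-%R : measurableTypeR R -> measurableTypeR R) by exact: measurable_funN.
have mB' : measurable [set x : measurableTypeR R | B (- 1 * x)%R].
  rewrite (_ : [set x | _] = [set: measurableTypeR R] `&` (-%R : measurableTypeR R -> measurableTypeR R) @^-1` B).
    exact: mN.
  by rewrite setTI; apply/seteqP; split => x /=; rewrite mulN1r.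
rewrite !E// -[RHS]gauss_opp//.
- apply: eq_integral => x _; rewrite !indicE; congr ((nat_of_bool _)%:R%:E).
  by apply/idP/idP => /set_mem H; apply/mem_set; move: H; rewrite /= mulN1r.
- by apply/measurable_EFinP; exact: measurable_indic.
Qed.
End gauss_symmetry.

Section gaussian_matrix_space.
Context (R : realType) (n : nat).
Local Notation I := ('I_n * 'I_n)%type.
Local Notation S := (n.-tuple (measurableTypeR R)).
Local Open Scope ereal_scope.

(** A Gaussian matrix as a tuple of independent rows, so that the mean of a
    product over the rows factors. *)
Definition gmat : probability (n.-tuple S) R := powm (powm (gauss R) n) n.

Definition ent (w : n.-tuple S) (k : I) : measurableTypeR R := tnth (tnth w k.1) k.2.

Lemma measurable_ent k : measurable_fun [set: n.-tuple S] (ent ^~ k).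
Proof.
exact: (measurableT_comp (measurable_tnth k.2) (measurable_tnth k.1)).
Qed.

Lemma gmat_box (C : I -> set (measurableTypeR R)) : (forall k, measurable (C k)) ->
  gmat [set w | forall k, C k (ent w k)] = \prod_k gauss R (C k).
Proof.
move=> mC.
have mCk k : measurable [set w | C k (ent w k)].
  by rewrite -[X in measurable X]setTI; exact: measurable_ent.
have mE : measurable [set w | forall k, C k (ent w k)].
  rewrite (_ : [set w | _] = \bigcap_(k in [set: I]) [set w | C k (ent w k)]).
    by apply: fin_bigcap_measurable => // k _; exact: mCk.
  by apply/seteqP; split => w /= H; [move=> k _|move=> k; have := H k Logic.I].
have -> : gmat [set w | forall k, C k (ent w k)] =
    \int[gmat]_w (\1_[set w | forall k, C k (ent w k)] w)%:E.
  by rewrite integral_indic// setIT.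
have m1 i j : measurable_fun [set: measurableTypeR R] (fun x => (\1_(C (i, j)) x : R)%:E).
  by apply/measurable_EFinP; exact: measurable_indic.
transitivity (\int[gmat]_w \prod_(i < n) \prod_(j < n) (\1_(C (i, j)) (tnth (tnth w i) j))%:E).
  apply: eq_integral => w _; rewrite pair_big/= indicE.
  have [wE|wE] := boolP (w \in _).
    rewrite big1// => -[i j] _ /=; rewrite indicE mem_set//.
    exact: (set_mem wE (i, j)).
  have [k wk] : exists k, ~ C k (ent w k).
    by apply/existsNP => H; move/negP: wE; apply; exact: mem_set.
  by rewrite (bigD1 (k.1, k.2))//= indicE memNset ?mul0e//; case: k wk.
rewrite (integral_powm_prod (powm (gauss R) n)
  (G := fun i s => \prod_(j < n) (\1_(C (i, j)) (tnth s j))%:E)); last 2 first.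
- move=> i; apply: (@emeasurable_prod _ _ _ _ _
    (fun j (s : S) => (\1_(C (i, j)) (tnth s j))%:E)) => j.
  have H := measurableT_comp (m1 i j) (@measurable_tnth _ (measurableTypeR R) n j).
  exact: H.
- by move=> i s; apply: prode_ge0 => j _; rewrite lee_fin.
transitivity (\prod_(i < n) \prod_(j < n) gauss R (C (i, j))).
  apply: eq_bigr => i _.
  rewrite (integral_powm_prod (gauss R) (G := fun j s => (\1_(C (i, j)) s)%:E)).
  - by apply: eq_bigr => j _; rewrite integral_indic// setIT.
  - exact: m1.
  - by move=> j s; rewrite lee_fin.
by rewrite pair_big/=; apply: eq_bigr => -[].
Qed.

Section coordinates.
(* With s = 1 or - 1, and pi the identity or the transposition, the family
   below consists of the entries of A, - A, A^T or - A^T. *)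
Variables (s : R) (pi : I -> I).
Hypothesis s1 : (s = 1 \/ s = - 1)%R.
Hypothesis piK : involutive pi.

Let coord_fun k w : measurableTypeR R := (s * ent w (pi k))%R.

Let measurable_coord k : measurable_fun [set: n.-tuple S] (coord_fun k).
Proof. by apply: measurable_funM => //; exact: measurable_ent. Qed.

Definition gmat_coord k : {RV gmat >-> R} :=
  HB.pack (coord_fun k : n.-tuple S -> R)
    (isMeasurableFun.Build _ _ (n.-tuple S) R (coord_fun k) (measurable_coord k)).

Let mpre (B : set (measurableTypeR R)) : measurable B -> measurable [set x : measurableTypeR R | B (s * x)%R].
Proof.
move=> mB; have ms : measurable_fun [set: measurableTypeR R] (fun x : measurableTypeR R => (s * x)%R : measurableTypeR R).
  exact: measurable_funM.
by rewrite -[X in measurable X]setTI; exact: ms.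
Qed.

Let coord_law k (B : set (measurableTypeR R)) : measurable B ->
  gmat (gmat_coord k @^-1` B) = gauss R B.
Proof.
move=> mB.
have := @gmat_box (fun l => if l == pi k then [set x | B (s * x)%R] else setT).
rewrite (bigD1 (pi k))//= eqxx big1 ?mule1 => [|l /negPf ->]; last exact: probability_setT.
rewrite gauss_preimage_sign// => <-; last by move=> l; case: ifP => // _; exact: mpre.
congr (gmat _); apply/seteqP; split => w /=.
  by move=> H l; case: eqP => [->|].
by move=> /(_ (pi k)); rewrite eqxx.
Qed.

Lemma gmat_coord_normal k : has_normal_law (gmat_coord k) 0 1.
Proof. by move=> B mB; exact: coord_law. Qed.

Lemma gmat_coord_indep : mutually_independent gmat_coord.
Proof.
move=> J B mB.
rewrite (eq_bigr (fun k => gauss R (B k))); last by move=> k _; exact: (coord_law k (mB k)).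
have := @gmat_box (fun l => if pi l \in J then [set x | B (pi l) (s * x)%R] else setT).
rewrite (_ : [set w | _] = \bigcap_(i in [set` J]) (gmat_coord i @^-1` B i)); last first.
  apply/seteqP; split => w /= H k.
    by move=> kJ; have := H (pi k); rewrite piK kJ.
  case: ifP => // kJ.
  have Hk : B (pi k) (s * ent w (pi (pi k)))%R := H (pi k) kJ.
  by rewrite piK in Hk.
move=> ->; last by move=> l; case: ifP => // _; exact: (mpre (mB (pi l))).
rewrite [RHS](reindex_inj (inv_inj piK)) [RHS]big_mkcond.
apply: eq_bigr => l _; case: ifP => _; last exact: probability_setT.
exact: (gauss_preimage_sign s1 (mB (pi l))).
Qed.
End coordinates.

End gaussian_matrix_space.

Section matrix_law.
Context (R : realType) (n : nat).
Local Notation I := ('I_n * 'I_n)%type.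
Local Notation S := (n.-tuple (measurableTypeR R)).
Local Notation TT := (#|{: I}|.-tuple (measurableTypeR R)).
Local Open Scope ereal_scope.

Definition mx_of (t : TT) : 'M[R]_n := \matrix_(i, j) tnth t (enum_rank (i, j)).

Definition mx_rows (w : n.-tuple S) : 'M[R]_n := \matrix_(i, j) ent w (i, j).

Definition mfun_mx (F : 'M[R]_n -> \bar R) : Prop :=
  measurable_fun [set: TT] (F \o mx_of).

Lemma integral_iid d (T : measurableType d) (P : probability T R)
    (M : 'M[{RV P >-> R}]_n) (F : 'M[R]_n -> \bar R) :
  iid_normal_entries M 0 1 -> mfun_mx F -> (forall A, 0 <= F A) ->
  \int[P]_w F (realization M w) = \int[gvec R I]_t F (mx_of t).
Proof.
move=> [indM normM] mF F0.
have <- := @gvec_law R I d T P (fun k => M k.1 k.2) indM (fun k => normM k.1 k.2) (F \o mx_of) mF (fun t => F0 _).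
apply: eq_integral => w _; congr (F _); apply/matrixP => i j.
by rewrite !mxE tnth_mktuple enum_rankK.
Qed.

Lemma measurable_realization d (T : measurableType d) (P : probability T R)
    (M : 'M[{RV P >-> R}]_n) (F : 'M[R]_n -> \bar R) :
  mfun_mx F -> measurable_fun [set: T] (fun w => F (realization M w)).
Proof.
move=> mF.
have := measurableT_comp mF (@measurable_sample R I d T P (fun k => M k.1 k.2)).
rewrite (_ : _ \o _ = fun w => F (realization M w))//.
apply/funext => w /=; congr (F _); apply/matrixP => i j.
by rewrite !mxE tnth_mktuple enum_rankK.
Qed.

(** The family [gmat_coord] is again independent and standard normal. *)
Lemma integral_gmat_coord (s : R) (pi : I -> I) (F : 'M[R]_n -> \bar R) :
  (s = 1 \/ s = - 1)%R -> involutive pi -> mfun_mx F -> (forall A, 0 <= F A) ->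
  \int[gmat R n]_w F (\matrix_(i, j) (s * ent w (pi (i, j)))%R) = \int[gvec R I]_t F (mx_of t).
Proof.
move=> s1 piK mF F0.
have <- := @gvec_law R I _ _ (gmat R n) _ (gmat_coord_indep s1 piK)
  (gmat_coord_normal pi s1) (F \o mx_of) mF (fun t => F0 _).
apply: eq_integral => w _; congr (F _); apply/matrixP => i j.
by rewrite !mxE tnth_mktuple enum_rankK.
Qed.

Definition swap_ij (k : I) : I := (k.2, k.1).

Lemma integral_rows (F : 'M[R]_n -> \bar R) : mfun_mx F -> (forall A, 0 <= F A) ->
  \int[gvec R I]_t F (mx_of t) = \int[gmat R n]_w F (mx_rows w).
Proof.
move=> mF F0; rewrite -(@integral_gmat_coord 1%R id)//; last by left.
apply: eq_integral => w _; congr (F _); apply/matrixP => i j.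
by rewrite !mxE mul1r.
Qed.

Lemma integral_opp_rows (F : 'M[R]_n -> \bar R) : mfun_mx F -> (forall A, 0 <= F A) ->
  \int[gvec R I]_t F (mx_of t) = \int[gmat R n]_w F (- mx_rows w)%R.
Proof.
move=> mF F0; rewrite -(@integral_gmat_coord (- 1)%R id)//; last by right.
apply: eq_integral => w _; congr (F _); apply/matrixP => i j.
by rewrite !mxE mulN1r.
Qed.

Lemma integral_tr_rows (F : 'M[R]_n -> \bar R) : mfun_mx F -> (forall A, 0 <= F A) ->
  \int[gvec R I]_t F (mx_of t) = \int[gmat R n]_w F ((mx_rows w)^T)%R.
Proof.
move=> mF F0; rewrite -(@integral_gmat_coord 1%R swap_ij)//; [|by left|by case].
apply: eq_integral => w _; congr (F _); apply/matrixP => i j.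
by rewrite !mxE mul1r.
Qed.

Lemma integral_opp_tr_rows (F : 'M[R]_n -> \bar R) : mfun_mx F -> (forall A, 0 <= F A) ->
  \int[gvec R I]_t F (mx_of t) = \int[gmat R n]_w F (- (mx_rows w)^T)%R.
Proof.
move=> mF F0; rewrite -(@integral_gmat_coord (- 1)%R swap_ij)//; [|by right|by case].
apply: eq_integral => w _; congr (F _); apply/matrixP => i j.
by rewrite !mxE mulN1r.
Qed.

Lemma mfun_mx_entry (i j : 'I_n) :
  measurable_fun [set: TT] (fun t => mx_of t i j).
Proof.
under eq_fun do rewrite mxE; exact: measurable_tnth.
Qed.

Lemma mfun_mx_lipschitz (f : 'M[R]_n -> R) (L : R) : (0 <= L)%R ->
  (forall A B, `|f A - f B| <= L * mxnorm1 (A - B))%R ->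
  measurable_fun [set: TT] (f \o mx_of).
Proof.
move=> L0 fL; apply: (@measurable_lipschitz R _ (f \o mx_of) L L0) => s t.
apply: le_trans (fL _ _) _; apply: ler_wpM2l => //.
rewrite /mxnorm1 pair_big/= (reindex _ (onW_bij _ (@enum_val_bij I)))/=.
apply: ler_sum => k _; rewrite !mxE.
by case: (enum_val k) (enum_valK k) => i j <-.
Qed.

End matrix_law.

(** * Exponential moments that dominate the exceptional events *)

Section dominating_functions.
Context (R : realType) (n : nat).
Hypothesis n0 : (0 < n)%N.
Local Notation I := ('I_n * 'I_n)%type.
Local Notation S := (n.-tuple (measurableTypeR R)).
Local Notation TT := (#|{: I}|.-tuple (measurableTypeR R)).

Let nR0 : 0 < n%:R :> R. Proof. by rewrite ltr0n. Qed.

Definition sign_vec (s : {ffun 'I_n -> bool}) : 'cV[R]_n := \col_i (if s i then 1 else -1).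

(** If this is less than 1, then all payoffs at pairs of sign vectors are at
    most 4 n^(3/2) ([cut_le]). *)
Definition cut_exp (B : 'M[R]_n) : R :=
  \sum_(s : {ffun 'I_n -> bool}) \sum_(r : {ffun 'I_n -> bool})
    expR (4 / Num.sqrt n%:R * payoff B (sign_vec s) (sign_vec r) - 16 * n%:R).

Definition znorm (z : {ffun 'I_n -> 'I_n.+1}) : R := Num.sqrt (\sum_j (z j)%:R ^+ 2).

Definition zdir (z : {ffun 'I_n -> 'I_n.+1}) (j : 'I_n) : R := (z j)%:R / znorm z.

(** If this is less than 1, then for all nonzero z whose coordinates have a sum
    at most n/1000, the positive parts of the entries of B z have a sum larger
    than |z| n/1000. The weight exp(- 10 sum_j z_j) makes the sum over z
    converge, and exp(11 n/1000) compensates for it in that range. *)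
Definition net_exp (B : 'M[R]_n) : R :=
  \sum_(z : {ffun 'I_n -> 'I_n.+1} | [exists j, z j != ord0])
    expR (n%:R * (11 / 1000) - 10 * \sum_j (z j)%:R) *
    \prod_i expR (- Num.max (\sum_j zdir z j * B i j) 0).

Lemma cut_exp_ge0 B : 0 <= cut_exp B.
Proof. by do 2 (apply: sumr_ge0 => ? _); exact: expR_ge0. Qed.

Lemma net_exp_ge0 B : 0 <= net_exp B.
Proof.
apply: sumr_ge0 => z _; rewrite mulr_ge0 ?expR_ge0//.
by apply: prodr_ge0 => i _; exact: expR_ge0.
Qed.

Let pay_coef (x y : 'cV[R]_n) (k : 'I_#|{: I}|) : R :=
  x (enum_val k).1 0 * y (enum_val k).2 0.

Lemma payoff_lin (x y : 'cV[R]_n) t : payoff (mx_of t) x y = lin (pay_coef x y) t.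
Proof.
rewrite payoffE2 pair_big/= (reindex _ (onW_bij _ (@enum_val_bij I)))/=.
apply: eq_bigr => k _; rewrite mxE mulrAC /pay_coef.
by rewrite -surjective_pairing enum_valK.
Qed.

Let cut_term_measurable s r : measurable_fun [set: TT]
  (fun t => expR (4 / Num.sqrt n%:R * payoff (mx_of t) (sign_vec s) (sign_vec r) - 16 * n%:R)).
Proof.
apply: measurableT_comp => //; apply: measurable_funB => //; apply: measurable_funM => //.
under eq_fun do rewrite payoff_lin; exact: measurable_lin.
Qed.

Lemma measurable_cut_exp : measurable_fun [set: TT] (cut_exp \o @mx_of R n).
Proof.
by apply: measurable_sum => s; apply: measurable_sum => r; exact: cut_term_measurable.
Qed.

Lemma measurable_net_exp : measurable_fun [set: TT] (net_exp \o @mx_of R n).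
Proof.
rewrite (_ : _ \o _ = (fun t => \sum_(z <- enum [pred z : {ffun 'I_n -> 'I_n.+1} | [exists j, z j != ord0]])
    expR (n%:R * (11 / 1000) - 10 * \sum_j (z j)%:R) *
    \prod_i expR (- Num.max (\sum_j zdir z j * mx_of t i j) 0))); last first.
  by apply/funext => t; rewrite /= /net_exp big_enum.
apply: measurable_sum => z; apply: measurable_funM => //.
apply: measurable_prod => i _; apply: measurableT_comp => //; apply: measurable_funN.
apply: measurable_maxr => //; apply: measurable_sum => j.
by apply: measurable_funM => //; exact: mfun_mx_entry.
Qed.

(** Each payoff at a pair of sign vectors is Gaussian with variance n^2, so each
    of the 4^n terms has mean exp(8 n - 16 n). *)
Lemma cut_exp_mean :
  (\int[gvec R I]_t (cut_exp (mx_of t))%:E = ((4 * expR (- 8)) ^+ n)%:E)%E.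
Proof.
have term s r : (\int[gvec R I]_t (expR (4 / Num.sqrt n%:R *
    payoff (mx_of t) (sign_vec s) (sign_vec r) - 16 * n%:R))%:E = (expR (- 8) ^+ n)%:E)%E.
  pose a k := 4 / Num.sqrt n%:R * pay_coef (sign_vec s) (sign_vec r) k.
  transitivity (\int[gvec R I]_t ((expR (- (16 * n%:R)))%:E * (expR (lin a t))%:E))%E.
    apply: eq_integral => t _; rewrite payoff_lin.
    have -> : 4 / Num.sqrt n%:R * lin (pay_coef (sign_vec s) (sign_vec r)) t = lin a t.
      by rewrite /lin mulr_sumr; apply: eq_bigr => k _; rewrite mulrA.
    by rewrite expRD EFinM muleC.
  have mE : measurable_fun [set: TT] (fun t => (expR (lin a t))%:E).
    apply/measurable_EFinP; apply: measurableT_comp => //; exact: measurable_lin.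
  rewrite (ge0_integralZl (gvec R I) measurableT mE); last 2 first.
  - by move=> t _; rewrite lee_fin expR_ge0.
  - by rewrite lee_fin expR_ge0.
  rewrite mgf_powm -EFinM -expRD -expRM_natl; congr (expR _)%:E.
  have ak k : a k ^+ 2 / 2 = 8 / n%:R.
    have sq1 (f : {ffun 'I_n -> bool}) i : (sign_vec f) i 0 ^+ 2 = 1.
      by rewrite mxE; case: ifP; rewrite ?sqrrN expr1n.
    rewrite /a /pay_coef !exprMn !sq1 exprVn sqr_sqrtr ?ltW//.
    by field; rewrite gt_eqF.
  under eq_bigr do rewrite ak.
  rewrite sumr_const card_ord card_prod !card_ord -[X in _ + X]mulr_natr natrM.
  by field; rewrite gt_eqF.
rewrite /cut_exp.
have mT s r := (measurable_EFinP _ _).2 (cut_term_measurable s r).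
under eq_integral => t _.
  rewrite -sumEFin; under eq_bigr do rewrite -sumEFin; over.
have E0 s r t : (0 <= (expR (4 / Num.sqrt n%:R *
    payoff (mx_of t) (sign_vec s) (sign_vec r) - 16 * n%:R))%:E)%E.
  by rewrite lee_fin expR_ge0.
rewrite (ge0_integral_sum (gvec R I) measurableT); last 2 first.
- by move=> s; apply: emeasurable_sum => r; exact: mT.
- by move=> s t _; apply: sume_ge0 => r _; exact: E0.
have inner s : (\int[gvec R I]_t \sum_(r : {ffun 'I_n -> bool}) (expR (4 / Num.sqrt n%:R *
    payoff (mx_of t) (sign_vec s) (sign_vec r) - 16 * n%:R))%:E =
    (\sum_(r : {ffun 'I_n -> bool}) expR (- 8) ^+ n)%:E)%E.
  rewrite (ge0_integral_sum (gvec R I) measurableT); last 2 first.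
  - by move=> r; exact: mT.
  - by move=> r t _; exact: E0.
  by under eq_bigr do rewrite term; rewrite sumEFin.
under eq_bigr do rewrite inner.
rewrite sumEFin !sumr_const card_ffun card_bool card_ord.
by congr EFin; rewrite exprMn -mulrnA -[LHS]mulr_natl -expnMn natrX.
Qed.

End dominating_functions.

Section net_mean.
Context (R : realType) (n : nat).
Hypothesis n0 : (0 < n)%N.
Local Notation I := ('I_n * 'I_n)%type.
Local Notation S := (n.-tuple (measurableTypeR R)).

Lemma znorm_sq (z : {ffun 'I_n -> 'I_n.+1}) :
  znorm R z ^+ 2 = \sum_j (z j)%:R ^+ 2.
Proof. by rewrite sqr_sqrtr// sumr_ge0// => j _; exact: sqr_ge0. Qed.

Lemma znorm_gt0 (z : {ffun 'I_n -> 'I_n.+1}) j : z j != ord0 -> 0 < znorm R z.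
Proof.
move=> zj; rewrite sqrtr_gt0 (bigD1 j)//= ltr_pwDl//.
  by rewrite exprn_gt0// ltr0n lt0n; apply: contra zj => /eqP z0; apply/eqP/val_inj.
by apply: sumr_ge0 => i _; exact: sqr_ge0.
Qed.

Lemma zdir_unit (z : {ffun 'I_n -> 'I_n.+1}) j : z j != ord0 ->
  \sum_(i < n) zdir R z i ^+ 2 = 1.
Proof.
move=> zj; have p := znorm_gt0 zj; rewrite /zdir.
under eq_bigr do rewrite exprMn.
by rewrite -mulr_suml -znorm_sq exprVn mulfV// expf_eq0/= gt_eqF.
Qed.

(** The sum factors over the coordinates into truncated geometric series. *)
Lemma net_weight_sum (q : R) : 0 <= q -> q < 1 ->
  \sum_(z : {ffun 'I_n -> 'I_n.+1}) q ^+ (\sum_j z j) <= ((1 - q)^-1) ^+ n.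
Proof.
move=> q0 q1.
under eq_bigr do rewrite expr_sum.
rewrite -(bigA_distr_bigA (fun (j : 'I_n) (k : 'I_n.+1) => q ^+ k)).
rewrite prodr_const card_ord.
have q1' : 0 < 1 - q by rewrite subr_gt0.
apply: lerXn2r; rewrite ?nnegrE.
- by apply: sumr_ge0 => k _; rewrite exprn_ge0.
- by rewrite invr_ge0 ltW.
rewrite -(ler_pM2l q1') mulfV ?gt_eqF//.
rewrite -opprB mulNr -subrX1 opprB gerBl exprn_ge0//.
Qed.

(** The rows are independent, and each contributes a factor of mean at most
    49/50 by [exp_pospart_mean]. *)
Lemma net_exp_mean : (\int[gmat R n]_w (net_exp (mx_rows w))%:E <=
  ((expR (11 / 1000) * (49 / 50) * (1 - expR (- 10))^-1) ^+ n)%:E)%E.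
Proof.
pose c (z : {ffun 'I_n -> 'I_n.+1}) : R :=
  expR (n%:R * (11 / 1000) - 10 * \sum_j (z j)%:R).
have c0 z : 0 <= c z by exact: expR_ge0.
pose G z (s : S) : R := expR (- Num.max (lin (zdir R z) s) 0).
have G0 z s : 0 <= G z s by exact: expR_ge0.
have mG z : measurable_fun [set: S] (fun s => (G z s)%:E).
  apply/measurable_EFinP; apply: measurableT_comp => //; apply: measurable_funN.
  by apply: measurable_maxr => //; exact: measurable_lin.
have mP z : measurable_fun [set: n.-tuple S] (fun w => \prod_(i < n) (G z (tnth w i))%:E)%E.
  apply: emeasurable_prod => i; exact: (measurableT_comp (mG z) (measurable_tnth i)).
have P0 z w : (0 <= \prod_(i < n) (G z (tnth w i))%:E)%E.
  by apply: prode_ge0 => i _; rewrite lee_fin.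
pose Z : seq {ffun 'I_n -> 'I_n.+1} := enum [pred z : {ffun 'I_n -> 'I_n.+1} | [exists j, z j != ord0]].
have ZE w : ((net_exp (mx_rows w))%:E =
    \sum_(z <- Z) (c z)%:E * \prod_(i < n) (G z (tnth w i))%:E)%E.
  rewrite /Z big_enum /net_exp -sumEFin; apply: eq_bigr => z _.
  have -> : \prod_i expR (- Num.max (\sum_j zdir R z j * mx_rows w i j) 0) =
      \prod_(i < n) G z (tnth w i).
    apply: eq_bigr => i _; rewrite /G.
    have -> : \sum_j zdir R z j * mx_rows w i j = lin (zdir R z) (tnth w i).
      by apply: eq_bigr => j _; rewrite mxE.
    by [].
  by rewrite -/(c z) EFinM (big_morph EFin EFinM (erefl _)).
under eq_integral do rewrite ZE.
rewrite (ge0_integral_sum (gmat R n) measurableT); last 2 first.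
- by move=> z; exact: (emeasurable_funM (measurable_cst _) (mP z)).
- by move=> z w _; rewrite mule_ge0// lee_fin.
have term (z : {ffun 'I_n -> 'I_n.+1}) : [exists j, z j != ord0] -> (\int[gmat R n]_w ((c z)%:E * \prod_(i < n) (G z (tnth w i))%:E)
    <= (c z * (49 / 50) ^+ n)%:E)%E.
  move=> /existsP[j zj].
  rewrite (ge0_integralZl (gmat R n) measurableT (mP z) (fun w _ => P0 z w)); last by rewrite lee_fin.
  rewrite EFinM; apply: lee_wpmul2l; first by rewrite lee_fin.
  rewrite (integral_powm_prod (powm (gauss R) n) (G := fun=> fun s => (G z s)%:E)); last 2 first.
  - by move=> i; exact: mG.
  - by move=> i s; rewrite lee_fin.
  have q1 := exp_pospart_mean (zdir_unit zj).
  have q0 : (0 <= \int[powm (gauss R) n]_s (G z s)%:E)%E.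
    by apply: integral_ge0 => s _; rewrite lee_fin.
  have fq : (\int[powm (gauss R) n]_s (G z s)%:E)%E \is a fin_num.
    by rewrite ge0_fin_numE// (le_lt_trans q1)// ltry.
  rewrite -(fineK fq); set f := fine _.
  have -> : (\prod_(i < n) f%:E = (\prod_(i < n) f)%:E)%E.
    by rewrite (big_morph EFin EFinM (erefl _)).
  rewrite prodr_const card_ord lee_fin.
  have f1 : f <= 49 / 50 by rewrite -lee_fin /f fineK.
  have f0 : 0 <= f by exact: fine_ge0.
  by apply: lerXn2r; rewrite ?nnegrE//; lra.
apply: (@le_trans _ _ (\sum_(z <- Z) (c z * (49 / 50) ^+ n)%:E)%E).
  rewrite /Z !big_enum/=; apply: lee_sum => z /= zP; exact: term.
rewrite sumEFin lee_fin -mulr_suml.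
have -> : (expR (11 / 1000) * (49 / 50) * (1 - expR (- 10))^-1) ^+ n =
    expR (n%:R * (11 / 1000)) * ((1 - expR (- 10))^-1) ^+ n * (49 / 50) ^+ n :> R.
  by rewrite !exprMn -expRM_natl mulrAC.
apply: ler_wpM2r; first by rewrite exprn_ge0//; lra.
apply: (@le_trans _ _ (\sum_z c z)).
  rewrite /Z big_enum/= [leRHS](bigID [pred z : {ffun 'I_n -> 'I_n.+1} | [exists j, z j != ord0]])/=.
  by rewrite lerDl; apply: sumr_ge0 => z _.
have cE z : c z = expR (n%:R * (11 / 1000)) * expR (- 10) ^+ (\sum_j z j).
  rewrite /c expRD -expRM_natl natr_sum; congr (_ * expR _).
  by rewrite mulrN mulrC.
under eq_bigr do rewrite cE.
rewrite -mulr_sumr; apply: ler_wpM2l; first exact: expR_ge0.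
apply: net_weight_sum; first exact: expR_ge0.
by rewrite -[ltRHS]expR0 ltr_expR; lra.
Qed.
End net_mean.

(** * Strategies that keep all payoffs small *)

Section norm_bound.
Context (R : realType) (n : nat).
Hypothesis n0 : (0 < n)%N.
Variable (B : 'M[R]_n).

Let nR0 : 0 < n%:R :> R. Proof. by rewrite ltr0n. Qed.
Let sn := Num.sqrt (n%:R : R).
Let sn0 : 0 < sn. Proof. by rewrite sqrtr_gt0. Qed.
Let sn2 : sn ^+ 2 = n%:R. Proof. by rewrite sqr_sqrtr// ltW. Qed.

Lemma cut_le s r : cut_exp B < 1 -> payoff B (sign_vec R s) (sign_vec R r) <= 4 * n%:R * sn.
Proof.
move=> H; rewrite leNgt; apply/negP => p; move: H; apply/negP; rewrite -leNgt.
rewrite /cut_exp (bigD1 s)//= (bigD1 r)//= -addrA -[leLHS]addr0 lerD//; last first.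
  rewrite addr_ge0//; first by apply: sumr_ge0 => ? _; exact: expR_ge0.
  by do 2 (apply: sumr_ge0 => ? _); exact: expR_ge0.
rewrite -[leLHS]expR0 ler_expR subr_ge0 -/sn.
rewrite (_ : 16 * n%:R = 4 / sn * (4 * n%:R * sn)); last by field; rewrite gt_eqF.
by apply: ler_wpM2l; [rewrite divr_ge0// ltW|exact: ltW].
Qed.

(** The sum of absolute values is a bilinear form in two sign vectors, and the
    cube [0,1]^n lies in the convex hull of the sign vectors. *)
Lemma cut_norm1_le (r : 'I_n -> R) : cut_exp B < 1 -> (forall j, 0 <= r j <= 1) ->
  \sum_i `|\sum_j B i j * r j| <= 4 * n%:R * sn.
Proof.
move=> HB r01.
pose s := [ffun i => 0 <= \sum_j B i j * r j].
pose c j := \sum_i sign_vec R s i 0 * B i j.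
pose s' := [ffun j => 0 <= c j].
have -> : \sum_i `|\sum_j B i j * r j| = \sum_j r j * c j.
  under [RHS]eq_bigr do rewrite mulr_sumr.
  rewrite exchange_big/=; apply: eq_bigr => i _.
  rewrite [LHS](_ : _ = sign_vec R s i 0 * \sum_j B i j * r j); last first.
    by rewrite mxE ffunE; case: ger0P => _; rewrite ?mul1r ?mulN1r.
  by rewrite mulr_sumr; apply: eq_bigr => j _; ring.
apply: (le_trans _ (cut_le s s' HB)).
rewrite payoffE2 exchange_big/=; apply: ler_sum => j _.
rewrite -mulr_suml -/(c j) mxE ffunE; have /andP[r0 r1] := r01 j.
by case: ger0P => cj; nra.
Qed.

Variables (y : 'cV[R]_n) (W : R).
Hypotheses (sy : simplex n y) (W0 : 0 <= W).
Hypothesis yW : forall i, \sum_j B i j * y j 0 <= W.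

(* The number 1000, kept behind an equation as a symbol for the algebra. *)
Variable a : R.
Hypothesis aE : a = 1000.

Let a0 : 0 < a. Proof. by rewrite aE ltr0n. Qed.
Let a1 : 1 <= a. Proof. by rewrite aE ler1n. Qed.

Let u j := n%:R * y j 0 / a.

Let u_ge0 j : 0 <= u j.
Proof. by case: sy => y0 _; rewrite divr_ge0 ?mulr_ge0// ltW. Qed.

(* The integer part of the multiple u of y; the fractional part is rt. *)
Let zt : {ffun 'I_n -> 'I_n.+1} := [ffun j => inord (Num.truncn (u j))].

Let zE j : (zt j)%:R = (Num.truncn (u j))%:R :> R.
Proof.
rewrite ffunE inordK// ltnS.
have /andP[H _] := truncn_itv (u_ge0 j).
rewrite -(ler_nat R); apply: le_trans H _.
rewrite /u ler_pdivrMr// ler_pM2l//.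
exact: le_trans (simplex_le1 j sy) a1.
Qed.

Let rt j := u j - (zt j)%:R.

Let r01 j : 0 <= rt j <= 1.
Proof.
have /andP[H1 H2] := truncn_itv (u_ge0 j); rewrite /rt zE -natr1 in H2 *.
by apply/andP; split; lra.
Qed.

Let sumz : \sum_j (zt j)%:R <= n%:R / a.
Proof.
case: sy => _ y1; rewrite -[n%:R]mulr1 -[X in _ <= _ * X / a]y1 mulr_sumr mulr_suml.
apply: ler_sum => j _; have /andP[] := r01 j; rewrite /rt /u; lra.
Qed.

Let pos_sum : cut_exp B < 1 ->
  \sum_i Num.max (\sum_j (zt j)%:R * B i j) 0 <= n%:R * (n%:R / a * W) + 4 * n%:R * sn.
Proof.
move=> HB; apply: le_trans (_ : _ <= \sum_i (n%:R / a * W + `|\sum_j B i j * rt j|)) _.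
  apply: ler_sum => i _.
  have p0 : 0 <= n%:R / a * W by rewrite mulr_ge0// divr_ge0// ltW.
  have E : \sum_j (zt j)%:R * B i j = n%:R / a * (\sum_j B i j * y j 0) - \sum_j B i j * rt j.
    rewrite mulr_sumr -sumrB; apply: eq_bigr => j _; rewrite /rt /u.
    by field; rewrite gt_eqF.
  have H1 : n%:R / a * (\sum_j B i j * y j 0) <= n%:R / a * W.
    by apply: ler_wpM2l => //; rewrite divr_ge0// ltW.
  have H2 := normr_ge0 (\sum_j B i j * rt j).
  have := ler_norm (- \sum_j B i j * rt j); rewrite normrN => H3.
  by rewrite ge_max E; apply/andP; split; lra.
have E : \sum_(i < n) (n%:R / a * W) = n%:R * (n%:R / a * W).
  by rewrite sumr_const card_ord [RHS]mulr_natl.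
by rewrite big_split/= E lerD2l; exact: cut_norm1_le.
Qed.

(* By net_exp the sum bounded in pos_sum is larger than |z| n/a, unless z = 0. *)
Let znorm_le : cut_exp B < 1 -> net_exp B < 1 -> znorm R zt <= n%:R * W + 4 * a * sn.
Proof.
move=> HB HN.
have p0 : 0 <= n%:R * W + 4 * a * sn.
  by rewrite addr_ge0// ?mulr_ge0// ltW.
have [/existsP[j zj]|] := boolP [exists j, zt j != ord0]; last first.
  rewrite negb_exists => /forallP z0; rewrite /znorm big1 ?sqrtr0// => j _.
  by have := z0 j; rewrite negbK => /eqP ->; rewrite expr0n.
have zn0 := znorm_gt0 R zj.
have H : n%:R / a < \sum_i Num.max (\sum_j zdir R zt j * B i j) 0.
  rewrite ltNge; apply/negP => H; move: HN; apply/negP; rewrite -leNgt /net_exp.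
  rewrite (bigD1 zt) /=; last by apply/existsP; exists j.
  rewrite -[leLHS]addr0 lerD//; last first.
    apply: sumr_ge0 => z _; rewrite mulr_ge0 ?expR_ge0//.
    by apply: prodr_ge0 => i _; exact: expR_ge0.
  rewrite -expR_sum -expRD -[leLHS]expR0 ler_expR sumrN.
  have E : n%:R * (11 / 1000) = 11 * (n%:R / a) by rewrite aE; field.
  rewrite E; have := sumz; lra.
have E : \sum_i Num.max (\sum_j (zt j)%:R * B i j) 0 =
    znorm R zt * \sum_i Num.max (\sum_j zdir R zt j * B i j) 0.
  rewrite mulr_sumr; apply: eq_bigr => i _.
  rewrite maxr_pMr ?ltW// mulr0 mulr_sumr; congr Num.max.
  by apply: eq_bigr => k _; rewrite /zdir; field; rewrite gt_eqF.
have := pos_sum HB; rewrite E => H2.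
have H3 : znorm R zt * (n%:R / a) <= n%:R * (n%:R / a * W) + 4 * n%:R * sn.
  by apply: le_trans H2; rewrite ler_pM2l// ltW.
have na0 : 0 < n%:R / a by rewrite divr_gt0.
rewrite -(ler_pM2r na0); apply: le_trans H3 _.
by rewrite le_eqVlt; apply/orP; left; apply/eqP; field; rewrite gt_eqF.
Qed.

Lemma norm_bound_aux : dot y y <= 66 * a ^+ 4 * (W ^+ 2 + n%:R^-1) + cut_exp B + net_exp B.
Proof.
have K0 : 0 <= 66 * a ^+ 4 * (W ^+ 2 + n%:R^-1).
  by rewrite mulr_ge0// ?mulr_ge0 ?exprn_ge0 ?addr_ge0 ?sqr_ge0 ?invr_ge0// ltW.
have c0 := cut_exp_ge0 B; have e0 := net_exp_ge0 B.
have /andP[_ y1] := simplex_dot sy sy.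
have [HB|HB] := ltP (cut_exp B) 1; last by lra.
have [HN|HN] := ltP (net_exp B) 1; last by lra.
suff : dot y y <= 66 * a ^+ 4 * (W ^+ 2 + n%:R^-1) by lra.
have zn := znorm_le HB HN.
have zn2 : \sum_j (zt j)%:R ^+ 2 <= 2 * (n%:R * W) ^+ 2 + 32 * a ^+ 2 * n%:R.
  rewrite -znorm_sq.
  have z0 : 0 <= znorm R zt by exact: sqrtr_ge0.
  have H1 : znorm R zt ^+ 2 <= (n%:R * W + 4 * a * sn) ^+ 2.
    by apply: lerXn2r => //; rewrite nnegrE; exact: le_trans zn.
  apply: le_trans H1 _; rewrite -sn2 -subr_ge0.
  by rewrite (_ : _ - _ = (sn ^+ 2 * W - 4 * a * sn) ^+ 2) ?sqr_ge0//; ring.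
have yE j : y j 0 = a / n%:R * ((zt j)%:R + rt j).
  by rewrite /rt addrC subrK /u; field; rewrite !gt_eqF.
have H : dot y y <= (a / n%:R) ^+ 2 * (2 * (\sum_j (zt j)%:R ^+ 2) + 2 * n%:R).
  have -> : 2 * (\sum_j (zt j)%:R ^+ 2) + 2 * n%:R = \sum_j (2 * (zt j)%:R ^+ 2 + 2) :> R.
    by rewrite big_split/= -mulr_sumr sumr_const card_ord [in LHS]mulr_natr.
  rewrite /dot mulr_sumr; apply: ler_sum => j _.
  rewrite -expr2 yE exprMn; apply: ler_wpM2l; first exact: sqr_ge0.
  have /andP[r0 r1] := r01 j; have r2 : rt j ^+ 2 <= 1 by rewrite exprn_ile1.
  have := sqr_ge0 ((zt j)%:R - rt j : R); lra.
apply: le_trans H _.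
apply: le_trans (_ : _ <= (a / n%:R) ^+ 2 * (2 * (2 * (n%:R * W) ^+ 2 + 32 * a ^+ 2 * n%:R) + 2 * n%:R)) _.
  by apply: ler_wpM2l; [exact: sqr_ge0|lra].
have -> : (a / n%:R) ^+ 2 * (2 * (2 * (n%:R * W) ^+ 2 + 32 * a ^+ 2 * n%:R) + 2 * n%:R) =
    4 * a ^+ 2 * W ^+ 2 + (64 * a ^+ 4 + 2 * a ^+ 2) / n%:R.
  by field; rewrite gt_eqF.
have a24 : a ^+ 2 <= a ^+ 4.
  by rewrite -[leLHS]mulr1 (_ : a ^+ 4 = a ^+ 2 * a ^+ 2); [|by rewrite -exprD];
    rewrite ler_wpM2l ?sqr_ge0// exprn_ege1.
have a4 : 0 <= a ^+ 4 by rewrite exprn_ge0// ltW.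
rewrite mulrDr; apply: lerD.
  by apply: ler_wpM2r; [exact: sqr_ge0|lra].
by apply: ler_wpM2r; [rewrite invr_ge0 ltW|lra].
Qed.

End norm_bound.

(** Let z be the integer part of (n/1000) y. As all entries of B y are at most
    W, the positive parts of the entries of B z have a sum of at most
    n^2 W/1000 plus the contribution of the remainder. For typical B this sum
    is of order n |z|, so |z| is small, and with it |y|. *)
Lemma norm_bound (R : realType) (n : nat) (B : 'M[R]_n) (y : 'cV[R]_n) (W : R) :
  (0 < n)%N -> simplex n y -> 0 <= W -> (forall i, \sum_j B i j * y j 0 <= W) ->
  dot y y <= 66 * 1000 ^+ 4 * (W ^+ 2 + n%:R^-1) + cut_exp B + net_exp B.
Proof. by move=> n0 sy W0 yW; exact: norm_bound_aux. Qed.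

(** * Resampling, change of density, Taylor bounds *)

Section power_measure_tools.
Context (R : realType) (d : measure_display) (S : measurableType d).
Variable mu : probability S R.
Local Open Scope ereal_scope.

(** The terms of [dvar_powm] resample one coordinate; this is how bounds on
    them are integrated. *)
Lemma integral_upd k (i : 'I_k) (g : k.-tuple S -> \bar R) :
  measurable_fun [set: k.-tuple S] g -> (forall t, 0 <= g t) ->
  \int[powm mu k]_t \int[mu]_s g (upd t i s) = \int[powm mu k]_t g t.
Proof.
elim: k i g => [[]//|k IH] i g mg g0.
have mcons : measurable_fun [set: S * k.-tuple S] (g \o @consp _ _ k).
  exact: (measurableT_comp mg (@measurable_consp _ _ k)).
have mupd : measurable_fun [set: k.+1.-tuple S * S] (fun p => g (upd p.1 i p.2)).
  exact: (measurableT_comp mg (@measurable_upd _ _ _ i)).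
have mI : measurable_fun [set: k.+1.-tuple S] (fun t => \int[mu]_s g (upd t i s)).
  exact: (measurable_integral_snd mu mupd (fun p => g0 _)).
have I0 t : 0 <= \int[mu]_s g (upd t i s) by exact: integral_ge0.
rewrite (integral_powmS mu mI I0) (integral_powmS mu mg g0).
case: (unliftP ord0 i) => [j ->|->].
  apply: eq_integral => x _.
  have mgx : measurable_fun [set: k.-tuple S] (fun t => g (consp (x, t))).
    exact: (measurableT_comp mcons (pair1_measurable x)).
  rewrite -(IH j _ mgx (fun t => g0 _)).
  apply: eq_integral => t _; apply: eq_integral => s _.
  by rewrite upd_consp_lift.
transitivity (\int[mu]_x \int[powm mu k]_t \int[mu]_s g (consp (s, t))).
  apply: eq_integral => x _; apply: eq_integral => t _; apply: eq_integral => s _.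
  by rewrite upd_consp0.
rewrite integral_prob_cst.
by rewrite (integral_swap mu (powm mu k) mcons (fun p => g0 _)).
Qed.

(** By induction on k: the one-dimensional formula is applied to the integral
    over the other coordinates. *)
Lemma integral_density_powm (tau : S -> S) (rho : S -> \bar R) :
  measurable_fun [set: S] tau -> measurable_fun [set: S] rho -> (forall s, 0 <= rho s) ->
  (forall f : S -> \bar R, measurable_fun [set: S] f -> (forall s, 0 <= f s) ->
     \int[mu]_s (f (tau s) * rho s) = \int[mu]_s f s) ->
  forall k (F : k.-tuple S -> \bar R), measurable_fun [set: k.-tuple S] F ->
    (forall t, 0 <= F t) ->
    \int[powm mu k]_t (F [tuple tau (tnth t i) | i < k] * \prod_(i < k) rho (tnth t i)) =
    \int[powm mu k]_t F t.
Proof.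
move=> mtau mrho rho0 H; elim=> [|k IH] F mF F0.
  apply: eq_integral => t _; rewrite big_ord0 mule1; congr F.
  by rewrite (tuple0 t); exact: tuple0.
have mmap j : measurable_fun [set: j.-tuple S] (fun t => [tuple tau (tnth t i) | i < j]).
  apply/measurable_fun_tnthP => i; rewrite (_ : _ \o _ = fun t => tau (tnth t i)).
    exact: (measurableT_comp mtau (measurable_tnth i)).
  by apply/funext => t /=; rewrite tnth_mktuple.
have mprod j : measurable_fun [set: j.-tuple S] (fun t => \prod_(i < j) rho (tnth t i)).
  by apply: emeasurable_prod => i; exact: (measurableT_comp mrho (measurable_tnth i)).
have p0 j (t : j.-tuple S) : 0 <= \prod_(i < j) rho (tnth t i) by exact: prode_ge0.
have mG := emeasurable_funM (measurableT_comp mF (mmap k.+1)) (mprod k.+1).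
have mcons : measurable_fun [set: S * k.-tuple S] (F \o @consp _ _ k).
  exact: (measurableT_comp mF (@measurable_consp _ _ k)).
have mx x : measurable_fun [set: k.-tuple S] (fun t => F (consp (x, t))).
  exact: (measurableT_comp mcons (pair1_measurable x)).
rewrite (integral_powmS mu mG); last by move=> t; apply: mule_ge0; [exact: F0|exact: p0].
rewrite (integral_powmS mu mF F0).
have mI := measurable_integral_snd (powm mu k) mcons (fun p => F0 _).
rewrite -(H _ mI); last by move=> s; apply: integral_ge0 => t _; exact: F0.
apply: eq_integral => x _.
have mI2 : measurable_fun [set: k.-tuple S] (fun t => F (consp (tau x, [tuple tau (tnth t i) | i < k])) *
    \prod_(i < k) rho (tnth t i)).
  exact: (emeasurable_funM (measurableT_comp (mx (tau x)) (mmap k)) (mprod k)).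
transitivity (\int[powm mu k]_t (rho x * (F (consp (tau x, [tuple tau (tnth t i) | i < k])) *
    \prod_(i < k) rho (tnth t i)))).
  apply: eq_integral => t _ /=; rewrite big_ord_recl tnth_consp0/= muleCA; congr (_ * (_ * _)).
    congr F; apply: eq_from_tnth => j; rewrite tnth_mktuple.
    case: (unliftP ord0 j) => [j' ->|->]; last by rewrite !tnth_consp0.
    by rewrite !tnth_consp_lift tnth_mktuple.
  by apply: eq_bigr => j _; rewrite tnth_consp_lift.
rewrite (ge0_integralZl (powm mu k) measurableT mI2); last 2 first.
- by move=> t _; rewrite mule_ge0.
- exact: rho0.
by rewrite (IH _ (mx (tau x)) (fun t => F0 _)) muleC.
Qed.

End power_measure_tools.

Section quadratic_taylor.
Context (R : realType) (f h : R -> R) (K : R).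
Hypothesis fh : forall s s', `|f s' - f s - (s' - s) * h s| <= K * (s' - s) ^+ 2.

(** The Taylor bounds at s and at s' are added. *)
Lemma quadratic_taylor_lipschitz s s' : `|h s' - h s| <= 2 * K * `|s' - s|.
Proof.
have [->|ne] := eqVneq s' s; first by rewrite !subrr normr0 mulr0.
have p : 0 < `|s' - s| by rewrite normr_gt0 subr_eq0.
rewrite -(ler_pM2r p) -normrM.
have H1 := fh s s'; have H2 := fh s' s.
have -> : (h s' - h s) * (s' - s) =
   (f s' - f s - (s' - s) * h s) + (f s - f s' - (s - s') * h s') by ring.
apply: le_trans (ler_normD _ _) _; apply: le_trans (lerD H1 H2) _.
have E : `|s' - s| * `|s' - s| = (s' - s) ^+ 2 by rewrite -expr2 real_normK ?num_real.
have E' : (s - s') ^+ 2 = (s' - s) ^+ 2 by rewrite -sqrrN opprB.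
have -> : 2 * K * `|s' - s| * `|s' - s| = 2 * K * (s' - s) ^+ 2 by rewrite -E mulrA.
by rewrite E'; lra.
Qed.

Lemma quadratic_taylor_continuous : continuous h.
Proof.
move=> s; apply: (@cvg_of_dist_le _ _ h (fun v => 2 * K * `|v - s|)) => [v|].
  by rewrite distrC; exact: quadratic_taylor_lipschitz.
rewrite -[X in _ --> X](mulr0 (2 * K)); apply: cvgMl_tmp.
rewrite -[X in _ --> X](normr0 R) -[in X in _ --> X](subrr s).
apply: cvg_norm; apply: (@cvgB _ R^o); [exact: cvg_id|exact: cvg_cst].
Qed.

Lemma quadratic_taylor_derive (s : R) : is_derive s 1 f (h s).
Proof.
apply/is_derive1_caratheodory.
exists (fun z => if z == s then h s else (f z - f s) / (z - s)); split.
- move=> z; case: eqVneq => [->|ne]; first by rewrite !subrr mulr0.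
  by rewrite divfK// subr_eq0.
- apply: (@cvg_of_dist_le _ _ _ (fun v => K * `|v - s|)) => [v|]; last first.
    rewrite -[X in _ --> X](mulr0 K); apply: cvgMl_tmp.
    rewrite -[X in _ --> X](normr0 R) -[in X in _ --> X](subrr s).
    apply: cvg_norm; apply: (@cvgB _ R^o); [exact: cvg_id|exact: cvg_cst].
  rewrite eqxx; case: eqVneq => [->|ne]; first by rewrite !subrr normr0 mulr0.
  have p : 0 < `|v - s| by rewrite normr_gt0 subr_eq0.
  have E : `|v - s| * `|v - s| = (v - s) ^+ 2 by rewrite -expr2 real_normK ?num_real.
  have -> : K * `|v - s| = K * (v - s) ^+ 2 / `|v - s|.
    by rewrite -E mulrA mulfK// gt_eqF.
  rewrite ler_pdivlMr// -normrM mulrBl divfK ?subr_eq0// distrC [h s * _]mulrC.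
  exact: fh.
- by rewrite eqxx.
Qed.
End quadratic_taylor.

(** * The regularised value of a Gaussian matrix *)

Section regularised_value.
Context (R : realType) (n : nat).
Hypothesis n0 : (0 < n)%N.
Local Notation I := ('I_n * 'I_n)%type.
Local Notation TT := (#|{: I}|.-tuple (measurableTypeR R)).
Variable e : R.
Hypothesis e0 : 0 < e.

Lemma saddle_pair (A : 'M[R]_n) : exists p : 'cV[R]_n * 'cV[R]_n, saddle e A p.1 p.2.
Proof. by have [x [y s]] := saddle_exists e0 n0 n0 A; exists (x, y). Qed.

Definition opt (A : 'M[R]_n) := projT1 (cid (saddle_pair A)).
Definition reg_w (A : 'M[R]_n) : R := reg_value e A (opt A).1 (opt A).2.

Lemma optP A : saddle e A (opt A).1 (opt A).2.
Proof. by rewrite /opt; case: cid. Qed.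

Let optP' A B : saddle e (B + (A - B)) (opt A).1 (opt A).2.
Proof. by rewrite addrC subrK; exact: optP. Qed.

Lemma reg_w_lipschitz A B : `|reg_w A - reg_w B| <= 1 * mxnorm1 (A - B).
Proof.
have := reg_value_lipschitz e0 (optP B) (optP' A B).
by rewrite [B + _]addrC subrK mul1r.
Qed.

Lemma opt_lipschitz A B :
  (forall i, `|(opt A).1 i 0 - (opt B).1 i 0| <= 2 / e * mxnorm1 (A - B)) /\
  (forall j, `|(opt A).2 j 0 - (opt B).2 j 0| <= 2 / e * mxnorm1 (A - B)).
Proof.
have [Hx Hy] := saddle_stable e0 (optP B) (optP' A B).
by split=> i; rewrite mulrAC; [have := Hx i|have := Hy i]; rewrite !mxE.
Qed.

Lemma reg_w_opp_tr A : reg_w (- A^T) = - reg_w A.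
Proof.
have [Ex Ey] := saddle_unique e0 (saddle_opp_tr (optP A)) (optP (- A^T)).
by rewrite /reg_w Ex Ey reg_value_opp_tr.
Qed.

Let e2 : 0 <= 2 / e. Proof. by rewrite divr_ge0// ltW. Qed.

Lemma measurable_reg_w : measurable_fun [set: TT] (reg_w \o @mx_of R n).
Proof. exact: (mfun_mx_lipschitz ler01 reg_w_lipschitz). Qed.

Lemma measurable_opt1 i : measurable_fun [set: TT] (fun t => (opt (mx_of t)).1 i 0).
Proof.
apply: (@mfun_mx_lipschitz R n (fun A => (opt A).1 i 0) (2 / e) e2) => A B.
by have [H _] := opt_lipschitz A B; exact: H.
Qed.

Lemma measurable_opt2 i : measurable_fun [set: TT] (fun t => (opt (mx_of t)).2 i 0).
Proof.
apply: (@mfun_mx_lipschitz R n (fun A => (opt A).2 i 0) (2 / e) e2) => A B.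
by have [_ H] := opt_lipschitz A B; exact: H.
Qed.

(** The squared norm of the gradient of [reg_w], whose entries are x_i y_j. *)
Definition energy (A : 'M[R]_n) : R := dot (opt A).1 (opt A).1 * dot (opt A).2 (opt A).2.

Let grad (k : I) (A : 'M[R]_n) : R := (opt A).1 k.1 0 * (opt A).2 k.2 0.

Lemma energyE A : energy A = \sum_(k : 'I_#|{: I}|) grad (enum_val k) A ^+ 2.
Proof.
transitivity (\sum_(k : I) grad k A ^+ 2); last first.
  by rewrite (reindex _ (onW_bij _ (@enum_val_bij I))).
transitivity (\sum_i \sum_j grad (i, j) A ^+ 2); last first.
  by rewrite pair_big; apply: eq_bigr => -[].
rewrite /energy /dot mulr_suml; apply: eq_bigr => i _.
by rewrite mulr_sumr; apply: eq_bigr => j _; rewrite /grad /= exprMn -!expr2.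
Qed.

Lemma energy_ge0 A : 0 <= energy A.
Proof. by rewrite mulr_ge0 ?dot_ge0. Qed.

Lemma energy_le1 A : energy A <= 1.
Proof.
have [sx sy _ _] := optP A.
have /andP[x0 x1] := simplex_dot sx sx; have /andP[y0 y1] := simplex_dot sy sy.
by rewrite -[leRHS]mulr1; apply: ler_pM.
Qed.

Let mx_upd (t : TT) k s s' : mx_of (upd t k s') =
  mx_of (upd t k s) + (s' - s) *: delta_mx (enum_val k).1 (enum_val k).2.
Proof.
apply/matrixP => i j; rewrite !mxE !tnth_upd.
have -> : (enum_rank (i, j) == k) = (i == (enum_val k).1) && (j == (enum_val k).2).
  rewrite -(inj_eq enum_val_inj) enum_rankK; by case: (enum_val k).
by case: ifP => _; rewrite ?mulr1 ?mulr0 ?addr0// addrC subrK.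
Qed.

Let taylor (t : TT) k (s s' : R) :
  `|reg_w (mx_of (upd t k s')) - reg_w (mx_of (upd t k s))
    - (s' - s) * grad (enum_val k) (mx_of (upd t k s))| <= 2 / e * (s' - s) ^+ 2.
Proof.
have := optP (mx_of (upd t k s')); rewrite (mx_upd t k s s').
set D := _ *: _ => sD.
have := reg_value_diff e0 (optP (mx_of (upd t k s))) sD.
have -> : payoff D (opt (mx_of (upd t k s))).1 (opt (mx_of (upd t k s))).2 =
    (s' - s) * grad (enum_val k) (mx_of (upd t k s)).
  set x := (opt _).1; set y := (opt _).2.
  rewrite payoffE2 (bigD1 (enum_val k).1)//= [X in _ + X]big1 ?addr0; last first.
    move=> i /negPf ik; rewrite big1// => j _.
    by rewrite !mxE ik /= !mulr0 mul0r.
  rewrite (bigD1 (enum_val k).2)//= big1 ?addr0; last first.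
    by move=> j /negPf jk; rewrite !mxE jk andbF !mulr0 mul0r.
  by rewrite !mxE !eqxx /grad -/x -/y/=; ring.
have -> : mxnorm1 D = `|s' - s|.
  rewrite /mxnorm1 (bigD1 (enum_val k).1)//= [X in _ + X]big1 ?addr0; last first.
    move=> i /negPf ik; rewrite big1// => j _.
    by rewrite !mxE ik /= mulr0 normr0.
  rewrite (bigD1 (enum_val k).2)//= big1 ?addr0; last first.
    by move=> j /negPf jk; rewrite !mxE jk andbF mulr0 normr0.
  by rewrite !mxE !eqxx mulr1.
by rewrite real_normK ?num_real// -/(reg_w _) -/(reg_w _).
Qed.

Let m_grad2 (k : 'I_#|{: I}|) : measurable_fun [set: TT] (fun t => (grad (enum_val k) (mx_of t) ^+ 2)%:E).
Proof.
apply/measurable_EFinP; apply: measurable_funX; apply: measurable_funM.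
- exact: measurable_opt1.
- exact: measurable_opt2.
Qed.

Lemma measurable_energy : measurable_fun [set: TT] (fun t => (energy (mx_of t))%:E).
Proof.
under eq_fun do rewrite energyE -sumEFin.
by apply: emeasurable_sum => k; exact: m_grad2.
Qed.

(** The partial derivatives of the regularised value are x_i y_j, so the
    Efron-Stein inequality and the Poincare inequality in each coordinate
    produce the energy. *)
Lemma reg_w_poincare :
  (dvar (gvec R I) (reg_w \o @mx_of R n) <= 4%:E * \int[gvec R I]_t (energy (mx_of t))%:E)%E.
Proof.
apply: le_trans (dvar_powm (gauss R) measurable_reg_w) _.
have g0 (k : 'I_#|{: I}|) t : (0 <= (grad (enum_val k) (mx_of t) ^+ 2)%:E)%E by exact: sq_ge0E.
have -> : (\int[gvec R I]_t (energy (mx_of t))%:E =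
    \sum_(k < #|{: I}|) \int[gvec R I]_t (grad (enum_val k) (mx_of t) ^+ 2)%:E)%E.
  rewrite -(ge0_integral_sum (gvec R I) measurableT m_grad2 (fun k t _ => g0 k t)).
  by apply: eq_integral => t _; rewrite energyE sumEFin.
rewrite ge0_sume_distrr; last by move=> k _; apply: integral_ge0 => t _; exact: g0.
apply: lee_sum => k _.
have mU : measurable_fun [set: TT * measurableTypeR R]
    (fun p => (grad (enum_val k) (mx_of (upd p.1 k p.2)) ^+ 2)%:E).
  exact: (measurableT_comp (m_grad2 k) (@measurable_upd _ _ _ k)).
have mI := measurable_integral_snd (gauss R) mU (fun p => g0 k _).
rewrite -(integral_upd (gauss R) k (m_grad2 k) (g0 k)).
rewrite -(ge0_integralZl (gvec R I) measurableT mI); last 2 first.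
- by move=> t _; apply: integral_ge0 => s _; exact: g0.
- by [].
apply: ge0_le_integral => //.
- by move=> t _; exact: dvar_ge0.
- apply: (@measurable_dvar _ _ _ (gauss R) _ _ (fun p => reg_w (mx_of (upd p.1 k p.2)))).
  exact: (measurableT_comp measurable_reg_w (@measurable_upd _ _ _ k)).
- exact: emeasurable_funM.
- move=> t _; apply: (@gauss_poincare R (fun s : R => reg_w (mx_of (upd t k s)))
    (fun s : R => grad (enum_val k) (mx_of (upd t k s)))).
    exact: (quadratic_taylor_derive (@taylor t k)).
  exact: (quadratic_taylor_continuous (@taylor t k)).
Qed.

Let m_w : measurable_fun [set: TT] (fun t => reg_w (mx_of t)).
Proof. exact: measurable_reg_w. Qed.

(** The game with matrix - A^T is the same game with the players exchanged,
    so the regularised value has a symmetric law. *)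
Lemma reg_w_symmetric (c : R) :
  (\int[gvec R I]_t ((c - reg_w (mx_of t)) ^+ 2)%:E =
   \int[gvec R I]_t ((c + reg_w (mx_of t)) ^+ 2)%:E)%E.
Proof.
pose F (s : R) (A : 'M[R]_n) : \bar R := ((c + s * reg_w A) ^+ 2)%:E.
have mF s : mfun_mx (F s).
  apply/measurable_EFinP; apply: measurable_funX; apply: measurable_funD => //.
  exact: measurable_funM.
have F0 s A : (0 <= F s A)%E by exact: sq_ge0E.
have H1 := integral_rows (mF 1) (F0 1).
have H2 := integral_opp_tr_rows (mF (-1)) (F0 (-1)).
transitivity (\int[gvec R I]_t F (-1)%R (mx_of t))%E.
  by apply: eq_integral => t _; rewrite /F mulN1r.
transitivity (\int[gvec R I]_t F 1%R (mx_of t))%E; last first.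
  by apply: eq_integral => t _; rewrite /F mul1r.
rewrite H1 H2; apply: eq_integral => w _.
by rewrite /F reg_w_opp_tr mulN1r opprK mul1r.
Qed.

(** As w and - w have the same law, (c - w)^2 has the same mean as the average
    c^2 + w^2 of (c - w)^2 and (c + w)^2. *)
Lemma dvar_reg_w :
  (dvar (gvec R I) (reg_w \o @mx_of R n) =
   2%:E * \int[gvec R I]_t (reg_w (mx_of t) ^+ 2)%:E)%E.
Proof.
pose W t := reg_w (mx_of t).
have mW2 : measurable_fun [set: TT] (fun t => (W t ^+ 2)%:E).
  by apply/measurable_EFinP; exact: measurable_funX.
have mWz : measurable_fun [set: TT] (fun t => (2 * W t ^+ 2)%:E).
  by apply/measurable_EFinP; apply: measurable_funM => //; exact: measurable_funX.
have W0 t : (0 <= (W t ^+ 2)%:E)%E by exact: sq_ge0E.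
have Wz0 t : (0 <= (2 * W t ^+ 2)%:E)%E by rewrite lee_fin mulr_ge0// sqr_ge0.
set J := (\int[gvec R I]_t (W t ^+ 2)%:E)%E.
have J0 : (0 <= J)%E by exact: integral_ge0.
have JE : (\int[gvec R I]_t (2 * W t ^+ 2)%:E = 2%:E * J)%E.
  by rewrite -(ge0_integralZl (gvec R I) measurableT mW2).
pose p c t := ((c - W t) ^+ 2)%:E. pose q c t := ((c + W t) ^+ 2)%:E.
have mp c : measurable_fun [set: TT] (p c).
  by apply/measurable_EFinP; apply: measurable_funX; exact: measurable_funB.
have mq c : measurable_fun [set: TT] (q c).
  by apply/measurable_EFinP; apply: measurable_funX; exact: measurable_funD.
have p0 c t : (0 <= p c t)%E by exact: sq_ge0E.
have q0 c t : (0 <= q c t)%E by exact: sq_ge0E.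
have inner c : (\int[gvec R I]_t p c t + \int[gvec R I]_t p c t = (2 * c ^+ 2)%:E + 2%:E * J)%E.
  rewrite [X in (_ + X)%E](reg_w_symmetric c) -(ge0_integralD (gvec R I) measurableT
    (fun t _ => p0 c t) (mp c) (fun t _ => q0 c t) (mq c)).
  rewrite -JE -[X in (X + _)%E](integral_prob_cst (gvec R I)).
  rewrite -(ge0_integralD (gvec R I) measurableT _ (measurable_cst _)
    (fun t _ => Wz0 t) mWz); last by move=> t _; rewrite lee_fin mulr_ge0// sqr_ge0.
  by apply: eq_integral => t _; rewrite -!EFinD; congr EFin; ring.
have mD : measurable_fun [set: TT] (fun t => \int[gvec R I]_t' p (W t) t')%E.
  apply: (@measurable_integral_snd _ _ _ _ _ (gvec R I) (fun z => ((W z.1 - W z.2) ^+ 2)%:E)).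
    exact: (measurable_sq_diff (measurableT_comp m_w measurable_fst)
      (measurableT_comp m_w measurable_snd)).
  by move=> z; exact: sq_ge0E.
have D0 t : (0 <= \int[gvec R I]_t' p (W t) t')%E by apply: integral_ge0 => t' _; exact: p0.
have dd : (dvar (gvec R I) W + dvar (gvec R I) W = 2%:E * J + 2%:E * J)%E.
  rewrite /dvar -(ge0_integralD (gvec R I) measurableT (fun t _ => D0 t) mD (fun t _ => D0 t) mD).
  under eq_integral do rewrite inner.
  rewrite (ge0_integralD (gvec R I) measurableT (fun t _ => Wz0 t) mWz _ (measurable_cst _)).
    by rewrite JE integral_prob_cst.
  by move=> t _; rewrite mule_ge0// lee_fin.
rewrite -[LHS]/(dvar (gvec R I) W); apply/eqP; rewrite eq_le.
by apply/andP; split; apply: lee_double; rewrite dd.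
Qed.

Lemma reg_w_energy :
  (\int[gvec R I]_t (reg_w (mx_of t) ^+ 2)%:E <=
   2%:E * \int[gvec R I]_t (energy (mx_of t))%:E)%E.
Proof.
have := reg_w_poincare; rewrite dvar_reg_w.
have -> : (4%:E = 2%:E * 2%:E :> \bar R)%E by rewrite -EFinM; congr EFin; ring.
by rewrite -muleA lee_pmul2l// lte_fin.
Qed.

End regularised_value.

(** * The energy of the optimal strategies *)

Section energy_bound.
Context (R : realType) (n : nat).
Hypothesis n0 : (0 < n)%N.
Local Notation I := ('I_n * 'I_n)%type.
Local Notation TT := (#|{: I}|.-tuple (measurableTypeR R)).
Local Notation e := (n%:R^-1 : R).

Let nR0 : 0 < n%:R :> R. Proof. by rewrite ltr0n. Qed.
Hypothesis e0 : 0 < e.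
Let e1 : e <= 1. Proof. by rewrite invf_le1// ler1n. Qed.

(** At least 1 when one of the typical bounds on B that lead to [norm_bound]
    fails. *)
Definition defect (B : 'M[R]_n) : R := cut_exp B + net_exp B.

Lemma defect_ge0 B : 0 <= defect B.
Proof. by rewrite addr_ge0 ?cut_exp_ge0 ?net_exp_ge0. Qed.

Lemma measurable_defect : measurable_fun [set: TT] (fun t => (defect (mx_of t))%:E).
Proof.
apply/measurable_EFinP; apply: measurable_funD.
- exact: measurable_cut_exp.
- exact: measurable_net_exp.
Qed.

Section pointwise.
Variable K : R.
Hypothesis K0 : 0 <= K.
Hypothesis bound : forall (B : 'M[R]_n) (y : 'cV[R]_n) (W : R),
  simplex n y -> 0 <= W -> (forall i, \sum_j B i j * y j 0 <= W) ->
  dot y y <= K * (W ^+ 2 + e) + defect B.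

(* If q <= 1 the factors are multiplied out; if q > 1 the second factor is
   at most 1 < q. *)
Let prod_combine (a b p q u v : R) : 0 <= a <= 1 -> 0 <= b <= 1 -> 0 <= p -> 0 <= q ->
  0 <= u -> 0 <= v -> a <= p + u -> b <= q + v -> a * b <= p * q + (u + v).
Proof.
move=> /andP[a0 a1] /andP[b0 b1] p0 q0 u0 v0 ap bq.
have [q1|q1] := leP q 1.
  have H1 : a * b <= a * (q + v) by exact: ler_wpM2l.
  have H2 : a * v <= v by rewrite ler_piMl.
  have H3 : a * q <= (p + u) * q by exact: ler_wpM2r.
  have H4 : u * q <= u by rewrite ler_piMr.
  rewrite mulrDr in H1; rewrite mulrDl in H3; lra.
have H1 : a * b <= a by rewrite ler_piMr.
have H2 : p <= p * q by rewrite ler_peMr// ltW.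
lra.
Qed.

(** The regularised value is close to the payoff V at the saddle point. By the
    sign of V, one of the two strategies has a squared norm bounded in terms of
    1/n alone and the other one in terms of |V| and 1/n, so the product gains a
    factor 1/n. *)
Lemma energy_pointwise (A : 'M[R]_n) : energy n0 e0 A <=
  10 * K ^+ 2 / n%:R * (reg_w n0 e0 A ^+ 2 + e) + (defect A^T + defect (- A)).
Proof.
have sad := optP n0 e0 A; have [sx sy _ _] := sad.
rewrite /energy /reg_w; set x := (opt n0 e0 A).1 in sad sx *.
set y := (opt n0 e0 A).2 in sad sy *.
set w := reg_value e A x y; pose V := payoff A x y.
have wV : `|w - V| <= e / 2 := reg_value_payoff e0 sad.
have e0' := ltW e0.
have Wp : 0 <= Num.max V 0 + e by rewrite addr_ge0// le_max lexx orbT.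
have Wm : 0 <= Num.max (- V) 0 + e by rewrite addr_ge0// le_max lexx orbT.
have Hx : dot x x <= K * ((Num.max V 0 + e) ^+ 2 + e) + defect A^T.
  apply: bound => // i; have := saddle_payoff_le e0 sad (simplex_delta R i).
  rewrite payoff_delta mxE -/V => H.
  apply: (@le_trans _ _ (V + e)); last by rewrite lerD2r le_max lexx.
  by apply: le_trans H; apply: ler_sum => j _; rewrite !mxE mulrC.
have Hy : dot y y <= K * ((Num.max (- V) 0 + e) ^+ 2 + e) + defect (- A).
  apply: bound => // i; have := saddle_payoff_ge e0 sad (simplex_delta R i).
  rewrite -(payoff_tr A (delta_mx i 0)) payoff_delta mxE -/V => H.
  apply: (@le_trans _ _ (- V + e)); last by rewrite lerD2r le_max lexx.
  rewrite -[leLHS]opprK -sumrN -[leRHS]opprK lerN2 opprD opprK.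
  apply: le_trans H _; apply: ler_sum => j _; rewrite !mxE; lra.
have comb := prod_combine (simplex_dot sx sx) (simplex_dot sy sy)
  (mulr_ge0 K0 (addr_ge0 (sqr_ge0 _) e0')) (mulr_ge0 K0 (addr_ge0 (sqr_ge0 _) e0'))
  (defect_ge0 _) (defect_ge0 _) Hx Hy.
apply: le_trans comb _; rewrite lerD2r.
have ee : e ^+ 2 <= e by rewrite expr2 ler_piMr.
have key : ((Num.max V 0 + e) ^+ 2 + e) * ((Num.max (- V) 0 + e) ^+ 2 + e) <=
    (2 * e) * ((`|V| + e) ^+ 2 + e).
  have p0 : 0 <= (`|V| + e) ^+ 2 + e by rewrite addr_ge0 ?sqr_ge0.
  case: (ger0P V) p0 => V0 p0.
    rewrite (max_r (_ : - V <= 0)) ?oppr_le0// add0r mulrC.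
    by apply: ler_wpM2r => //; lra.
  rewrite (max_l (_ : 0 <= - V)) ?oppr_ge0 ?(ltW V0)// add0r.
  by apply: ler_wpM2r => //; lra.
have key2 : (`|V| + e) ^+ 2 + e <= 5 * (w ^+ 2 + e).
  have H1 : `|V| <= `|w| + e / 2.
    have := ler_normD w (V - w); rewrite addrC subrK distrC => H.
    by apply: le_trans H _; rewrite lerD2l distrC.
  have H2 : (`|V| + e) ^+ 2 <= (`|w| + e / 2 + e) ^+ 2.
    by apply: lerXn2r; rewrite ?nnegrE ?addr_ge0 ?lerD2r// divr_ge0.
  have H3 : `|w| ^+ 2 = w ^+ 2 by rewrite real_normK ?num_real.
  have := sqr_ge0 (4 * `|w| - 3 * e); have := sqr_ge0 w; nra.
apply: (@le_trans _ _ (K ^+ 2 * (2 * e * (5 * (w ^+ 2 + e))))); last first.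
  by rewrite le_eqVlt; apply/orP; left; apply/eqP; ring.
rewrite [leLHS](_ : _ = K ^+ 2 * (((Num.max V 0 + e) ^+ 2 + e) *
  ((Num.max (- V) 0 + e) ^+ 2 + e))); last by ring.
apply: ler_wpM2l; first exact: sqr_ge0.
apply: le_trans key _; apply: ler_wpM2l => //; exact: mulr_ge0.
Qed.

End pointwise.

Lemma measurable_opp_mx (F : 'M[R]_n -> \bar R) :
  mfun_mx F -> mfun_mx (fun A => F (- A)).
Proof.
move=> mF.
have mt : measurable_fun [set: TT] (fun t => [tuple - tnth t k | k < #|{: I}|]).
  by apply: measurable_mktuple => k; apply: measurable_funN; exact: measurable_tnth.
have := measurableT_comp mF mt; congr measurable_fun.
by apply/funext => t /=; congr F; apply/matrixP => i j; rewrite !mxE tnth_mktuple.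
Qed.

Lemma measurable_tr_mx (F : 'M[R]_n -> \bar R) :
  mfun_mx F -> mfun_mx (fun A => F A^T).
Proof.
move=> mF.
have mt : measurable_fun [set: TT]
    (fun t => [tuple tnth t (enum_rank (swap_ij (enum_val k))) | k < #|{: I}|]).
  by apply: measurable_mktuple => k; exact: measurable_tnth.
have := measurableT_comp mF mt; congr measurable_fun.
apply/funext => t /=; congr F; apply/matrixP => i j.
by rewrite !mxE tnth_mktuple enum_rankK.
Qed.

Let mdef : mfun_mx (fun A => (defect A)%:E) := measurable_defect.
Let def0 A : (0 <= (defect A)%:E)%E. Proof. by rewrite lee_fin defect_ge0. Qed.

Lemma defect_mean : (\int[gvec R I]_t (defect (mx_of t))%:E <=
  ((4 * expR (- 8)) ^+ n + (expR (11 / 1000) * (49 / 50) * (1 - expR (- 10))^-1) ^+ n)%:E)%E.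
Proof.
have mc := (measurable_EFinP _ _).2 (@measurable_cut_exp R n).
have mn := (measurable_EFinP _ _).2 (@measurable_net_exp R n).
have c0 (t : TT) : (0 <= (cut_exp (mx_of t))%:E)%E by rewrite lee_fin cut_exp_ge0.
have nn0 A : (0 <= (@net_exp R n A)%:E)%E by rewrite lee_fin net_exp_ge0.
have -> : (\int[gvec R I]_t (defect (mx_of t))%:E = \int[gvec R I]_t (cut_exp (mx_of t))%:E
    + \int[gvec R I]_t (net_exp (mx_of t))%:E)%E.
  exact: (ge0_integralD (gvec R I) measurableT (fun t _ => c0 t) mc (fun t _ => nn0 (mx_of t)) mn).
rewrite cut_exp_mean// EFinD; apply: leeD; first exact: lexx.
rewrite (@integral_rows R n (fun A => (net_exp A)%:E) mn nn0).
exact: net_exp_mean.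
Qed.

Lemma defect_opp_mean :
  (\int[gvec R I]_t (defect (- mx_of t))%:E = \int[gvec R I]_t (defect (mx_of t))%:E)%E.
Proof.
rewrite (integral_opp_rows (measurable_opp_mx mdef) (fun A => def0 _)).
rewrite (integral_rows mdef def0).
by apply: eq_integral => w _; rewrite opprK.
Qed.

Lemma defect_tr_mean :
  (\int[gvec R I]_t (defect (mx_of t)^T)%:E = \int[gvec R I]_t (defect (mx_of t))%:E)%E.
Proof.
rewrite (integral_tr_rows (measurable_tr_mx mdef) (fun A => def0 _)).
rewrite (integral_rows mdef def0).
by apply: eq_integral => w _; rewrite trmxK.
Qed.

End energy_bound.

(** * The second moment of the regularised value *)

(** Both bases are at most exp(-1/125), and exp(n/125) >= (n/250)^2. *)
Lemma defect_decay (R : realType) : exists2 c : R, 0 <= c & forall n : nat, (0 < n)%N ->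
  (4 * expR (- 8)) ^+ n + (expR (11 / 1000) * (49 / 50) * (1 - expR (- 10))^-1) ^+ n
    <= c / n%:R ^+ 2 :> R.
Proof.
pose q : R := expR (- (125^-1)).
have qge : 124 / 125 <= q.
  by apply: le_trans (expR_ge1Dx _); lra.
have h1 : 4 * expR (- 8) <= q.
  apply: le_trans qge; rewrite expRN.
  have e8 : 9 <= expR 8 :> R by apply: le_trans (expR_ge1Dx _); lra.
  have e8i : (expR 8)^-1 <= 9^-1 :> R by rewrite lef_pV2 ?posrE ?expR_gt0// ltr0n.
  lra.
have h2 : expR (11 / 1000) * (49 / 50) * (1 - expR (- 10))^-1 <= q.
  apply: le_trans qge.
  have a : expR (11 / 1000) <= 1000 / 989 :> R.
    apply: le_trans (expR_le_inv _) _; first by lra.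
    rewrite (_ : 1 - 11 / 1000 = 989 / 1000); last by field.
    by rewrite invf_div.
  have b : expR (- 10) <= 1 / 1000 :> R.
    by rewrite expRN div1r lef_pV2 ?posrE ?expR_gt0 ?ltr0n// expR_10_ge.
  have b' : (1 - expR (- 10))^-1 <= 1000 / 999 :> R.
    have b1 : 999 / 1000 <= 1 - expR (- 10) :> R by lra.
    have b2 : 0 < 999 / 1000 :> R by rewrite divr_gt0 ?ltr0n.
    have -> : 1000 / 999 = (999 / 1000)^-1 :> R by rewrite invf_div.
    have b3 := lt_le_trans b2 b1; by rewrite lef_pV2 ?posrE.
  have b0 : 0 <= (1 - expR (- 10))^-1 :> R by rewrite invr_ge0; lra.
  by nra.
exists (2 * 250 ^+ 2) => [|n n0]; first by rewrite mulr_ge0 ?sqr_ge0.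
have qn : q ^+ n <= 250 ^+ 2 / n%:R ^+ 2.
  rewrite /q -expRM_natl mulrN expRN -expr_div_n -[leRHS]invrK lef_pV2 ?posrE ?invr_gt0 ?exprn_gt0 ?expR_gt0 ?divr_gt0 ?ltr0n//.
  rewrite -exprVn invf_div.
  have -> : n%:R * 125^-1 = 2%:R * (n%:R / 250) :> R by field.
  rewrite expRM_natl; apply: lerXn2r; rewrite ?nnegrE ?divr_ge0 ?ler0n ?expR_ge0//.
  by apply: le_trans (expR_ge1Dx _); rewrite lerDr.
have mono (p : R) : 0 <= p -> p <= q -> p ^+ n <= q ^+ n.
  by move=> p0 pq; apply: lerXn2r => //; rewrite nnegrE expR_ge0.
have M1 := mono _ (mulr_ge0 (ler0n R 4) (expR_ge0 _)) h1.
have p2 : 0 <= expR (11 / 1000) * (49 / 50) * (1 - expR (- 10))^-1 :> R.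
  have b0 : expR (- 10) <= 1 :> R.
    rewrite expRN invf_le1 ?expR_gt0//; apply: le_trans (expR_ge1Dx _).
    by rewrite lerDl ler0n.
  by apply: mulr_ge0; [apply: mulr_ge0; [exact: expR_ge0|lra]|rewrite invr_ge0 subr_ge0].
have M2 := mono _ p2 h2.
rewrite -[leRHS]mulrA; apply: (@le_trans _ _ (q ^+ n + q ^+ n)); first exact: (lerD M1 M2).
by rewrite mulr_natl mulr2n; exact: (lerD qn qn).
Qed.

Section second_moment.
Context (R : realType) (n : nat).
Hypothesis n0 : (0 < n)%N.
Local Notation I := ('I_n * 'I_n)%type.
Local Notation TT := (#|{: I}|.-tuple (measurableTypeR R)).
Local Notation e := (n%:R^-1 : R).
Hypothesis e0 : 0 < e.
Variables K c : R.
Hypotheses (K0 : 0 <= K) (c0 : 0 <= c).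
Hypothesis bound : forall A : 'M[R]_n,
  energy n0 e0 A <= K / n%:R * (reg_w n0 e0 A ^+ 2 + e) + (defect A^T + defect (- A)).
Hypothesis decay : (\int[gvec R I]_t (defect (mx_of t))%:E <= (c / n%:R ^+ 2)%:E)%E.

Let nR0 : 0 < n%:R :> R. Proof. by rewrite ltr0n. Qed.
Let w t := reg_w n0 e0 (@mx_of R n t).
Let m := (\int[gvec R I]_t (w t ^+ 2)%:E)%E.

Let energy_mean : (\int[gvec R I]_t (energy n0 e0 (mx_of t))%:E <=
  (K / n%:R)%:E * m + ((K + 2 * c) / n%:R ^+ 2)%:E)%E.
Proof.
have Kn : 0 <= K / n%:R by rewrite divr_ge0// ltW.
have mw : measurable_fun [set: TT] (fun t => (w t ^+ 2)%:E).
  by apply/measurable_EFinP; apply: measurable_funX; exact: measurable_reg_w.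
have w0 t : (0 <= (w t ^+ 2)%:E)%E by exact: sq_ge0E.
have mD : mfun_mx (fun A : 'M[R]_n => (defect A)%:E) := @measurable_defect R n.
have mT := measurable_tr_mx mD; have mN := measurable_opp_mx mD.
have D0 (A : 'M[R]_n) : (0 <= (defect A)%:E)%E by rewrite lee_fin defect_ge0.
pose F1 t := ((K / n%:R)%:E * (w t ^+ 2)%:E)%E.
pose F2 (t : TT) := ((defect (mx_of t)^T)%:E + (defect (- mx_of t))%:E)%E.
pose k := (K / n%:R ^+ 2)%:E.
have mF1 : measurable_fun [set: TT] F1 by exact: emeasurable_funM.
have F10 t : (0 <= F1 t)%E by rewrite mule_ge0// lee_fin.
have mF2 : measurable_fun [set: TT] F2 by exact: emeasurable_funD.
have F20 t : (0 <= F2 t)%E by rewrite adde_ge0.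
have k0 : (0 <= k)%E by rewrite lee_fin divr_ge0// exprn_ge0// ltW.
have mF12 : measurable_fun [set: TT] (fun t => F1 t + F2 t)%E by exact: emeasurable_funD.
have F120 t : (0 <= F1 t + F2 t)%E by rewrite adde_ge0.
apply: (@le_trans _ _ (\int[gvec R I]_t ((F1 t + F2 t) + k))%E).
  apply: ge0_le_integral => //.
  - by move=> t _; rewrite lee_fin energy_ge0.
  - exact: measurable_energy.
  - exact: emeasurable_funD.
  - move=> t _; rewrite /F1 /F2 /k -!EFinM -!EFinD lee_fin; apply: le_trans (bound _) _.
    by rewrite le_eqVlt; apply/orP; left; apply/eqP; rewrite /w; field; rewrite gt_eqF.
rewrite (ge0_integralD (gvec R I) measurableT (fun t _ => F120 t) mF12 (fun t _ => k0) (measurable_cst k)).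
rewrite (ge0_integralD (gvec R I) measurableT (fun t _ => F10 t) mF1 (fun t _ => F20 t) mF2).
rewrite (ge0_integralD (gvec R I) measurableT (fun t _ => D0 _) mT (fun t _ => D0 _) mN).
rewrite defect_tr_mean defect_opp_mean// integral_prob_cst.
have -> : (\int[gvec R I]_t F1 t = (K / n%:R)%:E * m)%E.
  by apply: (ge0_integralZl (gvec R I) measurableT mw) => //; rewrite lee_fin.
rewrite -addeA; apply: leeD; first exact: lexx.
apply: (@le_trans _ _ ((c / n%:R ^+ 2)%:E + (c / n%:R ^+ 2)%:E + k)%E).
  by apply: leeD; [exact: leeD|exact: lexx].
rewrite -!EFinD lee_fin le_eqVlt; apply/orP; left; apply/eqP; ring.
Qed.

(** For large n the bound on the energy by the second moment of the value
    improves itself; for small n the energy is at most one. *)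
Lemma second_moment_le : (m <= ((4 * (K + 2 * c) + 32 * K ^+ 2) / n%:R ^+ 2)%:E)%E.
Proof.
have mE : (m <= 2%:E * \int[gvec R I]_t (energy n0 e0 (mx_of t))%:E)%E := reg_w_energy n0 e0.
have m2 : (m <= 2%:E)%E.
  apply: le_trans mE _; rewrite -[leRHS]mule1; apply: lee_wpmul2l; first by rewrite lee_fin.
  rewrite -[leRHS](integral_prob_cst (gvec R I)).
  apply: ge0_le_integral => //.
  - by move=> t _; rewrite lee_fin energy_ge0.
  - exact: measurable_energy.
  - by move=> t _; rewrite lee_fin energy_le1.
have m0 : (0 <= m)%E by apply: integral_ge0 => t _; exact: sq_ge0E.
have : (m <= 2%:E * ((K / n%:R)%:E * m + ((K + 2 * c) / n%:R ^+ 2)%:E))%E.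
  apply: le_trans mE _; exact: (lee_wpmul2l _ energy_mean).
have mfin : m \is a fin_num by rewrite ge0_fin_numE// (le_lt_trans m2)// ltry.
rewrite -(fineK mfin) in m2 m0 *; set r := fine m in m2 m0 *.
rewrite !lee_fin in m2 m0; rewrite -(EFinM (K / n%:R)) -EFinD -EFinM !lee_fin.
set b := K + 2 * c; have b0 : 0 <= b by rewrite addr_ge0 ?mulr_ge0.
have n2 : 0 < n%:R ^+ 2 :> R by rewrite exprn_gt0.
move=> H; rewrite ler_pdivlMr//.
have H2 : r * n%:R ^+ 2 <= 2 * K * r * n%:R + 2 * b.
  have -> : 2 * K * r * n%:R + 2 * b = 2 * (K / n%:R * r + b / n%:R ^+ 2) * n%:R ^+ 2.
    by field; rewrite gt_eqF.
  by rewrite ler_pM2r.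
have [big|small] := leP (4 * K) n%:R.
  have H3 : 4 * K * (r * n%:R) <= n%:R * (r * n%:R).
    by apply: ler_wpM2r => //; rewrite mulr_ge0// ltW.
  have := sqr_ge0 K; rewrite expr2 in H2 *; lra.
have H3 : n%:R ^+ 2 <= 16 * K ^+ 2.
  rewrite (_ : 16 * K ^+ 2 = (4 * K) ^+ 2); last by ring.
  by apply: lerXn2r; rewrite ?nnegrE ?mulr_ge0// ltW.
have H4 : r * n%:R ^+ 2 <= 2 * (16 * K ^+ 2) by apply: ler_pM => //; exact: ltW.
lra.
Qed.

End second_moment.

Lemma reg_w_second_moment (R : realType) : exists2 C : R, 0 <= C &
  forall n (n0 : (0 < n)%N) (e0 : 0 < (n%:R^-1 : R)),
  (\int[gvec R ('I_n * 'I_n)%type]_t (reg_w n0 e0 (mx_of t) ^+ 2)%:E <= (C / n%:R ^+ 2)%:E)%E.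
Proof.
have [c c0 cP] := defect_decay R.
have [K K0 bnd] : exists2 K : R, 0 <= K &
    forall n (B : 'M[R]_n) (y : 'cV[R]_n) (W : R), (0 < n)%N -> simplex n y -> 0 <= W ->
    (forall i, \sum_j B i j * y j 0 <= W) ->
    dot y y <= K * (W ^+ 2 + n%:R^-1) + defect B.
  exists (66 * 1000 ^+ 4); first by rewrite mulr_ge0 ?exprn_ge0 ?ler0n.
  by move=> n B y W n0 sy W0 H; rewrite addrA; exact: norm_bound.
pose K1 := 10 * K ^+ 2.
have K10 : 0 <= K1 by rewrite mulr_ge0 ?sqr_ge0 ?ler0n.
exists (4 * (K1 + 2 * c) + 32 * K1 ^+ 2) => [|n n0 e0].
  by rewrite !addr_ge0 ?mulr_ge0 ?addr_ge0 ?mulr_ge0 ?sqr_ge0 ?ler0n.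
apply: (second_moment_le K10 c0) => [A|].
  by apply: energy_pointwise => // B y W; exact: bnd.
by apply: le_trans (defect_mean R n0) _; rewrite lee_fin; exact: cP.
Qed.

(** * The variance of the value *)

Section variance_bounds.
Context d (T : measurableType d) (R : realType) (P : probability T R).
Local Open Scope ereal_scope.

Lemma variance_integral (X : T -> R) :
  'V_P[X] = \int[P]_w ((X w - fine 'E_P[X]) ^+ 2)%:E.
Proof.
rewrite /variance covariance.unlock expectation.unlock.
by apply: eq_integral => w _; rewrite expr2.
Qed.

Lemma variance_le_second_moment (X : T -> R) : measurable_fun [set: T] X ->
  \int[P]_w ((X w ^+ 2)%R)%:E < +oo -> 'V_P[X] <= \int[P]_w ((X w ^+ 2)%R)%:E.
Proof.
move=> mX fX.
have XL : X \in Lfun P 2%:E.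
  rewrite inE; apply/andP; split; first by rewrite inE.
  rewrite inE/= /finite_norm (@lty_poweRy _ _ 2%R)// poweR_Lnorm//.
  apply: le_lt_trans fX; rewrite le_eqVlt; apply/orP; left; apply/eqP.
  apply: eq_integral => w _ /=.
  by rewrite -[2%R]/(2%:R) powR_mulrn// real_normK ?num_real.
rewrite varianceE// [in X in X - _]expectation.unlock.
rewrite -[leRHS]sube0; apply: leeB; first exact: lexx.
exact: sqre_ge0.
Qed.
End variance_bounds.

Section game_value_moments.
Context (R : realType) (n : nat).
Hypothesis n0 : (0 < n)%N.
Local Notation I := ('I_n * 'I_n)%type.
Local Notation TT := (#|{: I}|.-tuple (measurableTypeR R)).
Local Notation tau := (n%:R^-1 : R).

Let nR0 : 0 < n%:R :> R. Proof. by rewrite ltr0n. Qed.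
Hypothesis tau0 : 0 < tau.

Lemma measurable_game_value : measurable_fun [set: TT] (fun t => game_value (@mx_of R n t)).
Proof.
apply: (mfun_mx_lipschitz ler01) => A B; rewrite mul1r.
by have := game_value_lipschitz n0 n0 B (A - B); rewrite [B + _]addrC subrK.
Qed.

Lemma measurable_game_value_sq (m : R) : mfun_mx (fun A => ((@game_value R n n A - m) ^+ 2)%:E).
Proof.
apply/measurable_EFinP; apply: measurable_funX; apply: measurable_funB => //.
exact: measurable_game_value.
Qed.

Lemma game_value_second_moment (C : R) :
  (\int[gvec R I]_t (reg_w n0 tau0 (mx_of t) ^+ 2)%:E <= (C / n%:R ^+ 2)%:E)%E ->
  (\int[gvec R I]_t (game_value (mx_of t) ^+ 2)%:E <= ((2 * C + 8) / n%:R ^+ 2)%:E)%E.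
Proof.
move=> HC; pose w t := reg_w n0 tau0 (@mx_of R n t).
have mw : measurable_fun [set: TT] (fun t => (w t ^+ 2)%:E).
  by apply/measurable_EFinP; apply: measurable_funX; exact: measurable_reg_w.
have w0 t : (0 <= (w t ^+ 2)%:E)%E by exact: sq_ge0E.
have m2w : measurable_fun [set: TT] (fun t => 2%:E * (w t ^+ 2)%:E)%E by exact: emeasurable_funM.
have w20 t : (0 <= 2%:E * (w t ^+ 2)%:E)%E by rewrite mule_ge0.
pose k := (8 * tau ^+ 2)%:E.
have k0 : (0 <= k)%E by rewrite lee_fin mulr_ge0 ?sqr_ge0.
apply: (@le_trans _ _ (\int[gvec R I]_t (2%:E * (w t ^+ 2)%:E + k))%E).
  apply: ge0_le_integral => //.
  - by move=> t _; exact: sq_ge0E.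
  - by apply/measurable_EFinP; apply: measurable_funX; exact: measurable_game_value.
  - exact: emeasurable_funD.
  - move=> t _; rewrite /k -EFinM -EFinD lee_fin.
    have sad := optP n0 tau0 (mx_of t).
    have H1 := game_value_saddle tau0 n0 n0 sad; have H2 := reg_value_payoff tau0 sad.
    rewrite -/(reg_w _ _ _) -/(w t) in H2; set V := payoff _ _ _ in H1 H2.
    set v := game_value _ in H1 *.
    move: H1 H2; rewrite !ler_norml => /andP[a1 a2] /andP[b1 b2].
    have H : (v - w t) ^+ 2 <= (2 * tau) ^+ 2.
      rewrite -real_normK ?num_real//; apply: lerXn2r; rewrite ?nnegrE ?mulr_ge0 ?(ltW tau0)//.
      by rewrite ler_norml; apply/andP; split; lra.
    have := sqr_ge0 (v - 2 * w t); rewrite exprMn in H; lra.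
rewrite (ge0_integralD (gvec R I) measurableT (fun t _ => w20 t) m2w (fun t _ => k0) (measurable_cst k)).
have -> : (\int[gvec R I]_t (2%:E * (w t ^+ 2)%:E) = 2%:E * \int[gvec R I]_t (w t ^+ 2)%:E)%E.
  exact: (ge0_integralZl (gvec R I) measurableT mw).
rewrite integral_prob_cst; apply: (@le_trans _ _ (2%:E * (C / n%:R ^+ 2)%:E + k)%E).
  by apply: leeD; [apply: lee_wpmul2l|exact: lexx].
rewrite /k -EFinM -EFinD lee_fin le_eqVlt; apply/orP; left; apply/eqP; field.
by rewrite gt_eqF.
Qed.

(** Over all a, the sum of the two squares is at least s^2 u^2 / (1 + u^2), and
    s^2 u / 2 - s^2 (1 + u^2) / 16 is a lower bound for this quotient. When u^2
    is the density of a shifted law, all terms except the squares have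
    explicit means. *)
Lemma shift_ineq (a u s : R) :
  s ^+ 2 * u / 2 <= a ^+ 2 + (a + s) ^+ 2 * u ^+ 2 + s ^+ 2 / 16 * (1 + u ^+ 2).
Proof.
have p : 0 < 1 + u ^+ 2 by rewrite ltr_wpDr ?sqr_ge0.
rewrite -subr_ge0 -(pmulr_rge0 _ p).
rewrite [X in 0 <= X](_ : _ = (a + u ^+ 2 * (a + s)) ^+ 2 + (s / 4 * (4 * u - (1 + u ^+ 2))) ^+ 2).
  by rewrite addr_ge0 ?sqr_ge0.
by field.
Qed.

Let S (t : TT) : R := lin (fun _ => - (tau / 2)) t.
(* The square root of the density of the law of the matrix with all entries
   lowered by tau. *)
Let u (t : TT) : R := expR (S t - 4^-1).
Let shift (t : TT) : TT := [tuple tnth t i + tau | i < #|{: I}|].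

Let cardI : #|{: I}|%:R = n%:R ^+ 2 :> R.
Proof. by rewrite card_prod card_ord natrM expr2. Qed.

Let sum_cst (b : R) : \sum_(i < #|{: I}|) b = n%:R ^+ 2 * b.
Proof. by rewrite sumr_const card_ord -cardI mulr_natl. Qed.

Let density (t : TT) : (\prod_(i < #|{: I}|) (expR (- (tau * tnth t i) - tau ^+ 2 / 2))%:E
  = (u t ^+ 2)%:E)%E.
Proof.
rewrite prodEFin -expR_sum /u -expRM_natl; congr (expR _)%:E.
rewrite sumrB sum_cst mulrBr /S /lin mulr_sumr.
congr (_ - _); last by field; rewrite gt_eqF.
by apply: eq_bigr => i _; field; rewrite gt_eqF.
Qed.

Let shift_law (F : TT -> \bar R) : measurable_fun [set: TT] F -> (forall t, (0 <= F t)%E) ->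
  (\int[gvec R I]_t (F (shift t) * (u t ^+ 2)%:E) = \int[gvec R I]_t F t)%E.
Proof.
move=> mF F0.
rewrite -(@integral_density_powm _ _ _ (gauss R) (fun x : R => x + tau)
  (fun x : R => (expR (- (tau * x) - tau ^+ 2 / 2))%:E) _ _ _ _ _ F mF F0).
- by apply: eq_integral => t _; rewrite density.
- exact: measurable_funD.
- apply/measurable_EFinP; apply: measurableT_comp => //; apply: measurable_funB => //.
  by apply: measurable_funN; exact: measurable_funM.
- by move=> x; rewrite lee_fin expR_ge0.
- exact: gauss_shift.
Qed.

Lemma mean_sqrt_density : (\int[gvec R I]_t (u t)%:E = (expR (- 8^-1))%:E)%E.
Proof.
transitivity (\int[gvec R I]_t ((expR (- 4^-1))%:E * (expR (S t))%:E))%E.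
  by apply: eq_integral => t _; rewrite -EFinM -expRD addrC.
have mS : measurable_fun [set: TT] (fun t => (expR (S t))%:E).
  by apply/measurable_EFinP; apply: measurableT_comp => //; exact: measurable_lin.
rewrite (ge0_integralZl (gvec R I) measurableT mS); last 2 first.
- by move=> t _; rewrite lee_fin expR_ge0.
- by rewrite lee_fin expR_ge0.
rewrite mgf_powm -EFinM -expRD; congr (expR _)%:E.
rewrite sum_cst.
by field; rewrite gt_eqF.
Qed.

(** The two squares in [shift_ineq] have the same mean after the change of
    density, which is the mean of (v - m)^2. *)
Lemma game_value_variance_ge (m : R) :
  (((4^-1 / n%:R) ^+ 2)%:E <= \int[gvec R I]_t ((game_value (mx_of t) - m) ^+ 2)%:E)%E.
Proof.
pose a t := game_value (@mx_of R n t) - m.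
pose F t := (a t ^+ 2)%:E; pose k := (tau ^+ 2 / 16)%:E.
have mF : measurable_fun [set: TT] F := measurable_game_value_sq m.
have F0 t : (0 <= F t)%E by exact: sq_ge0E.
have aS t : a (shift t) = a t + tau.
  rewrite /a [LHS](_ : _ = game_value (mx_of t + const_mx tau) - m).
    by rewrite game_value_shift// addrAC.
  by congr (game_value _ - _); apply/matrixP => i j; rewrite !mxE tnth_mktuple.
have mu : measurable_fun [set: TT] u.
  by apply: measurableT_comp => //; apply: measurable_funB => //; exact: measurable_lin.
have mu1 : measurable_fun [set: TT] (fun t => (u t)%:E) by exact/measurable_EFinP.
have mu2 : measurable_fun [set: TT] (fun t => (u t ^+ 2)%:E).
  by apply/measurable_EFinP; exact: measurable_funX.
have u20 t : (0 <= (u t ^+ 2)%:E)%E by exact: sq_ge0E.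
have mshift : measurable_fun [set: TT] shift.
  apply: measurable_mktuple => i; apply: measurable_funD => //; exact: measurable_tnth.
pose G t := (F (shift t) * (u t ^+ 2)%:E)%E.
have mG : measurable_fun [set: TT] G by exact: emeasurable_funM (measurableT_comp mF mshift) mu2.
have G0 t : (0 <= G t)%E by rewrite mule_ge0.
have k0 : (0 <= k)%E by rewrite lee_fin divr_ge0 ?sqr_ge0.
pose H t := (k * (1 + (u t ^+ 2)%:E))%E.
have m1u : measurable_fun [set: TT] (fun t => 1 + (u t ^+ 2)%:E)%E by exact: emeasurable_funD.
have mH : measurable_fun [set: TT] H by exact: emeasurable_funM.
have u1 t : (0 <= 1 + (u t ^+ 2)%:E)%E by rewrite adde_ge0.
have H0 t : (0 <= H t)%E by rewrite mule_ge0.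
have mGH : measurable_fun [set: TT] (fun t => G t + H t)%E by exact: emeasurable_funD.
have GH0 t : (0 <= G t + H t)%E by rewrite adde_ge0.
have le : (\int[gvec R I]_t ((tau ^+ 2 / 2)%:E * (u t)%:E) <=
    \int[gvec R I]_t (F t + (G t + H t)))%E.
  apply: ge0_le_integral => //.
  - by move=> t _; rewrite -EFinM lee_fin mulr_ge0 ?expR_ge0// divr_ge0 ?sqr_ge0.
  - exact: emeasurable_funM.
  - exact: emeasurable_funD.
  - move=> t _; rewrite /G /H /F /k aS -!EFinM -!EFinD lee_fin.
    by have := shift_ineq (a t) (u t) tau; lra.
rewrite (ge0_integralZl (gvec R I) measurableT mu1) in le; last 2 first.
- by move=> t _; rewrite lee_fin expR_ge0.
- by rewrite lee_fin divr_ge0 ?sqr_ge0.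
rewrite mean_sqrt_density in le.
rewrite (ge0_integralD (gvec R I) measurableT (fun t _ => F0 t) mF (fun t _ => GH0 t) mGH) in le.
rewrite (ge0_integralD (gvec R I) measurableT (fun t _ => G0 t) mG (fun t _ => H0 t) mH) in le.
rewrite (shift_law mF F0) (ge0_integralZl (gvec R I) measurableT m1u (fun t _ => u1 t) k0) in le.
rewrite (ge0_integralD (gvec R I) measurableT (fun t _ => lee01) (measurable_cst _)
  (fun t _ => u20 t) mu2) integral_prob_cst in le.
have Eu2 : (\int[gvec R I]_t (u t ^+ 2)%:E = 1)%E.
  rewrite -[RHS](integral_prob_cst (gvec R I)).
  rewrite -(@shift_law (fun _ => 1%E) (measurable_cst _) (fun _ => lee01)).
  by apply: eq_integral => t _; rewrite mul1e.
rewrite Eu2 in le; change (((4^-1 / n%:R) ^+ 2)%:E <= \int[gvec R I]_t F t)%E.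
have J0 : (0 <= \int[gvec R I]_t F t)%E by exact: integral_ge0.
move: le J0; case: (\int[gvec R I]_t F t)%E => [r||]; [|by move=> _ _; rewrite leey|by move=> _; rewrite leeNy_eq].
move=> le _; rewrite lee_fin.
have {}le : tau ^+ 2 / 2 * expR (- 8^-1) <= r + (r + tau ^+ 2 / 16 * (1 + 1)).
  by rewrite -lee_fin; exact: le.
have e8 : 7 / 8 <= expR (- 8^-1) :> R by apply: le_trans (expR_ge1Dx _); lra.
have t2 : tau ^+ 2 / 2 * (7 / 8) <= tau ^+ 2 / 2 * expR (- 8^-1).
  by apply: ler_wpM2l => //; rewrite divr_ge0 ?sqr_ge0.
rewrite exprMn; have := sqr_ge0 tau; rewrite !expr2 in le t2 *; lra.
Qed.

End game_value_moments.

Theorem mainTheorem2 (R : realType) :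
  exists c C : R, [/\ 0 < c, 0 < C &
    forall (n : nat), (2 <= n)%N ->
    forall (d : measure_display) (T : measurableType d) (P : probability T R)
      (M : 'M[{RV P >-> R}]_n),
      iid_normal_entries M 0 1 ->
      ((c / n%:R)%:E <= std_dev P (fun w => game_value (realization M w))
        <= (C / n%:R)%:E)%E].
Proof.
have [C C0 HC] := reg_w_second_moment R.
exists 4^-1, (Num.sqrt (2 * C + 8)); split=> //.
  by rewrite sqrtr_gt0; lra.
move=> n n2 d T P M iid; have n0 : (0 < n)%N by exact: leq_trans n2.
have nR0 : 0 < n%:R :> R by rewrite ltr0n.
have tau0 : 0 < n%:R^-1 :> R by rewrite invr_gt0.
pose X w := game_value (realization M w).
have mX : measurable_fun [set: T] X.
  apply/measurable_EFinP; apply: (measurable_realization M (F := fun A => (game_value A)%:E)).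
  by apply/measurable_EFinP; exact: measurable_game_value.
have transfer (m : R) : (\int[P]_w ((X w - m) ^+ 2)%:E =
    \int[gvec R ('I_n * 'I_n)%type]_t ((game_value (mx_of t) - m) ^+ 2)%:E)%E.
  apply: (integral_iid (F := fun A => ((game_value A - m) ^+ 2)%:E) iid).
    exact: measurable_game_value_sq.
  by move=> A; exact: sq_ge0E.
have sdE (q : R) : 0 <= q -> sqrte (q ^+ 2)%:E = q%:E.
  by move=> q0; rewrite /= sqrtr_sqr ger0_norm.
have c0 : 0 <= 4^-1 / n%:R :> R by rewrite divr_ge0.
have C1 : 0 <= Num.sqrt (2 * C + 8) / n%:R by rewrite divr_ge0 ?sqrtr_ge0.
apply/andP; split; rewrite /std_dev -/X.
  rewrite -(sdE _ c0) lee_sqrt; last first.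
    by rewrite variance_integral; apply: integral_ge0 => w _; exact: sq_ge0E.
  rewrite variance_integral transfer; exact: game_value_variance_ge.
have C8 : 0 <= 2 * C + 8 by lra.
rewrite -(sdE _ C1) lee_sqrt; last exact: sq_ge0E.
rewrite exprMn sqr_sqrtr// exprVn.
have X2 : (\int[P]_w (X w ^+ 2)%:E <= ((2 * C + 8) / n%:R ^+ 2)%:E)%E.
  apply: le_trans (game_value_second_moment (HC n n0 tau0)).
  have := transfer 0; under eq_integral do rewrite subr0; move=> ->.
  by under eq_integral do rewrite subr0.
apply: (le_trans (variance_le_second_moment mX _) X2).
exact: le_lt_trans X2 (ltry _).
Qed.
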